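(* Let $\phi(\tau)=\eta(\tau)^2\eta(2\tau)^2\eta(3\tau)^2\eta(6\tau)^2=\sum_{n\ge1}a_nq^n$ (a weight-$4$ newform of level $6$) and let $\psi=\phi\otimes\chi_{-3}$, i.e. $\psi(\tau)=\sum_{n\ge1}\chi_{-3}(n)a_nq^n$, be its quadratic twist. The critical values of $\phi$ and $\psi$ satisfy $$L(\psi,3)=\frac{4\pi}{3\sqrt{3}}L(\phi,2),\qquad L(\phi,3)=\frac{\pi\sqrt{3}}{10}L(\psi,2).$$
   Context: Here $q=e^{2\pi i\tau}$ with $\tau$ in the upper half-plane, $\eta(\tau)=q^{1/24}\prod_{n\ge1}(1-q^n)$ is the Dedekind eta function (with $q^{1/24}=e^{2\pi i\tau/24}$), and $\chi_{-3}(n)=\left(\frac{-3}{n}\right)$ is the nontrivial Dirichlet character modulo $3$ ($\chi_{-3}(n)=1,-1,0$ according as $n\equiv1,2,0\pmod 3$). For a cusp form $f(\tau)=\sum_{n\ge1}b_nq^n$, its $L$-function is $L(f,s)=\sum_{n\ge1}b_nn^{-s}$, understood by analytic continuation where the series does not converge absolutely; equivalently, for each positive integer $s$, $$L(f,s)=\frac{(2\pi)^s}{\Gamma(s)}\int_0^\infty f(it)\,t^{s-1}\,dt .$$ *)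

(* Defs.v *)
From Stdlib Require Import Reals Factorial ClassicalEpsilon.
From Coquelicot Require Import Coquelicot.

Open Scope C_scope.

Definition Cexp (z : C) : C :=
  RtoC (exp (Re z)) * (cos (Im z), sin (Im z)).

(* [Lim_seq] and [Series] only exist for real sequences; these are the
   coordinatewise (total) versions. *)
Definition C_Lim_seq (u : nat -> C) : C :=
  (real (Lim_seq (fun n => Re (u n))), real (Lim_seq (fun n => Im (u n)))).

Definition C_Series (u : nat -> C) : C :=
  (Series (fun n => Re (u n)), Series (fun n => Im (u n))).

(* The nome at tau, e^(2 pi i tau). *)
Definition nome (tau : C) : C := Cexp (RtoC (2 * PI) * Ci * tau).

Fixpoint euler_prod (q : C) (N : nat) : C :=
  match N with
  | O => 1
  | S m => euler_prod q m * (1 - q ^ S m)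
  end.

Definition eta (tau : C) : C :=
  Cexp (RtoC (2 * PI) * Ci * tau / RtoC 24) * C_Lim_seq (euler_prod (nome tau)).

(* The character (-3/n). *)
Definition chi_m3 (n : nat) : C :=
  match Nat.modulo n 3 with
  | 1%nat => 1
  | 2%nat => - (1)
  | _ => 0
  end.

Definition twist (chi b : nat -> C) (n : nat) : C := chi n * b n.

(* Sequences of coefficients are indexed by nat, but all series below start at
   n = 1: the term of rank k is the one for n = k + 1, and [b 0] is never used. *)

Definition is_q_expansion (f : C -> C) (b : nat -> C) : Prop :=
  forall tau : C, (0 < Im tau)%R ->
    is_series (V := C_NormedModule)
      (fun k => b (S k) * nome tau ^ S k) (f tau).

Definition q_series (b : nat -> C) (tau : C) : C :=
  C_Series (fun k => b (S k) * nome tau ^ S k).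

Definition dirichlet_term (b : nat -> C) (s : nat) (k : nat) : C :=
  b (S k) / RtoC (INR (S k)) ^ s.

Definition mellin_L (b : nat -> C) (s : nat) : C :=
  RtoC ((2 * PI) ^ s / INR (fact (s - 1)))
  * RInt_gen (V := C_R_CompleteNormedModule)
      (fun t => q_series b (Ci * RtoC t) * RtoC (t ^ (s - 1)))
      (at_right 0) (Rbar_locally p_infty).

(* The value at a positive integer s of the L-function of the cusp form
   f = q_series b.  It is the Dirichlet series where that converges absolutely;
   elsewhere it is its analytic continuation, given by the Mellin integral
   (2 pi)^s / Gamma(s) * int_0^oo f(it) t^(s-1) dt, with Gamma(s) = (s-1)!. *)
Definition L_value (b : nat -> C) (s : nat) : C :=
  if excluded_middle_informative
       (ex_series (fun k => Cmod (dirichlet_term b s k)))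
  then C_Series (dirichlet_term b s)
  else mellin_L b s.

Definition phi (tau : C) : C :=
  eta tau ^ 2 * eta (2 * tau) ^ 2 * eta (3 * tau) ^ 2 * eta (6 * tau) ^ 2.

(* Main.v *)
Require Import Defs.
From Stdlib Require Import Reals Lra Lia ZArith List Permutation Classical ClassicalEpsilon.
From Coquelicot Require Import Coquelicot.
Open Scope C_scope.

(** The relations come from Manin's theory of periods. Write [E] for the Eichler
    integral [sum a_n n^-3 q^n] of [phi], so that [E] is a third primitive of [phi].

    The form [phi] is invariant, with sign [+1], under the involutions
    [r + w -> r - 1/(N w)] for [(r, N)] equal to [(0, 6)], [(1/3, 18)], [(-1/3, 18)]
    and [(1/2, 12)], and under translation by 1: these are Atkin-Lehner involutions
    of level 6 and their translates. By Bol's identity the defect of [E] under each of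
    them has a vanishing third derivative, so it is a polynomial in [w], of the shape
    [p0 + p1 w - N p0 w^2] ([period_relations_exist]). Letting [w] tend to 0 identifies
    [- p0] and [p1] with the boundary values of [E] and of its derivative at the cusp
    [r] ([period_boundary_values]). At the cusp 0 these are [L(phi, 3)] and [L(phi, 2)]
    up to elementary factors; since the Gauss sum writes [psi] as
    [(phi(tau + 1/3) - phi(tau - 1/3)) / (i sqrt 3)], the differences of the values at
    the cusps [1/3] and [-1/3] are [L(psi, 3)] and [L(psi, 2)]. This holds for either
    branch of the definition of the L-value: the Mellin integral has an explicit
    primitive built from [E], and an absolutely convergent Dirichlet series is treated
    by Abel's theorem ([L_value_2_limit], [L_value_3_limit]).

    The involutions satisfy relations in the group that they generate: composing the
    one at 0 with the one at [1/3] or [-1/3] gives the one at [1/2], up to a translation.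
    Comparing coefficients of the corresponding polynomials ([cocycle_third],
    [cocycle_third_neg]) gives linear equations between the periods. They already imply
    the first identity, but they cannot determine the second one, because they remain
    true when a constant is added to [E]. The missing equation is
    [a_(2n) = -2 a_n], that is [phi(tau) + phi(tau + 1/2) = -4 phi(2 tau)] ([phi_U2]).
    Through the triple product this is the classical identity between theta series of
    the form [m^2 + 3 n^2], whose proof is a bijection given by multiplication by a unit
    of the Eisenstein integers ([theta_modular_equation]).

    The invariance of [phi] rests on [eta(-1/tau)^2 = - i tau eta(tau)^2]
    ([eta_sqr_inversion]). The logarithmic derivative of [eta^2] is the Eisenstein
    series of weight two, which is a conditionally convergent double sum of
    [1/(m tau + n)^2]; exchanging the order of summation produces the anomaly
    [6 / (pi i tau)], whose primitive is the factor [tau] ([row_sums_inversion],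
    [eisenstein_2_inversion]). The inner sums are evaluated by the partial fractions of
    the cotangent, obtained from its duplication formula and dominated convergence. *)

(** * Limits along filters, unordered sums *)

Definition tendsto {T : Type} (F : (T -> Prop) -> Prop) (u : T -> C) (l : C) : Prop :=
  forall eps : R, (0 < eps)%R -> F (fun k => (Cmod (u k - l) < eps)%R).

Lemma half_pos (eps : R) : (0 < eps)%R -> (0 < eps / 2)%R.
Proof. lra. Qed.

Lemma quarter_pos (eps : R) : (0 < eps)%R -> (0 < eps / 4)%R.
Proof. lra. Qed.

Lemma Cmod_sub_sym (x y : C) : Cmod (x - y) = Cmod (y - x).
Proof. rewrite <- Cmod_opp. f_equal. ring. Qed.

Lemma Cmod_triangle_sub (x y z : C) : (Cmod (x - z) <= Cmod (x - y) + Cmod (y - z))%R.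
Proof. replace (x - z) with ((x - y) + (y - z)) by ring. apply Cmod_triangle. Qed.

Lemma Cmod_triangle_mid (x y z : C) : (Cmod (x - z) <= Cmod (y - x) + Cmod (y - z))%R.
Proof. rewrite (Cmod_sub_sym y x). apply Cmod_triangle_sub. Qed.

Lemma Cmod_diff_le (x y : C) : (Cmod x - Cmod y <= Cmod (x - y))%R.
Proof.
  pose proof (Cmod_triangle (x - y) y) as H.
  replace (x - y + y) with x in H by ring. lra.
Qed.

Lemma Rabs_Im_le (z : C) : (Rabs (Im z) <= Cmod z)%R.
Proof.
  replace (Im z) with (- Re (z * Ci))%R by (rewrite re_mult_Ci; ring).
  rewrite Rabs_Ropp. eapply Rle_trans; [apply re_le_Cmod|].
  rewrite Cmod_mult, Cmod_Ci. lra.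
Qed.

Lemma Cmod_small_eq (x y : C) :
  (forall eps : R, (0 < eps)%R -> (Cmod (x - y) <= eps)%R) -> x = y.
Proof.
  intros H. apply Ceq_minus, Cmod_eq_0.
  destruct (Rle_lt_or_eq_dec _ _ (Cmod_ge_0 (x - y))) as [h|h]; [|easy].
  specialize (H (Cmod (x - y) / 2)%R ltac:(lra)). lra.
Qed.

Section Tendsto.
Context {T : Type} {F : (T -> Prop) -> Prop}.

Lemma tendsto_const {FF : Filter F} (l : C) : tendsto F (fun _ => l) l.
Proof.
  intros eps He. apply filter_forall. intros _.
  replace (l - l) with (RtoC 0) by ring. rewrite Cmod_0. lra.
Qed.

Lemma tendsto_plus {FF : Filter F} u v l m :
  tendsto F u l -> tendsto F v m -> tendsto F (fun k => u k + v k) (l + m).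
Proof.
  intros Hu Hv eps He.
  generalize (filter_and _ _ (Hu _ (half_pos _ He)) (Hv _ (half_pos _ He))).
  apply filter_imp. intros k [h1 h2].
  replace (u k + v k - (l + m)) with ((u k - l) + (v k - m)) by ring.
  eapply Rle_lt_trans; [apply Cmod_triangle|lra].
Qed.

Lemma tendsto_mult {FF : Filter F} u v l m :
  tendsto F u l -> tendsto F v m -> tendsto F (fun k => u k * v k) (l * m).
Proof.
  intros Hu Hv eps He.
  set (K := (1 + Cmod l + Cmod m)%R).
  assert (HK : (1 <= K)%R) by (unfold K; pose proof (Cmod_ge_0 l); pose proof (Cmod_ge_0 m); lra).
  assert (He' : (0 < Rmin 1 (eps / (2 * K)))%R).
  { apply Rmin_pos; [lra|]. apply Rdiv_lt_0_compat; lra. }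
  generalize (filter_and _ _ (Hu _ He') (Hv _ He')).
  apply filter_imp. intros k [h1 h2].
  set (d := Rmin 1 (eps / (2 * K))) in *.
  assert (Hd1 : (d <= 1)%R) by apply Rmin_l.
  assert (Hd2 : (d * (2 * K) <= eps)%R).
  { apply (Rmult_le_compat_r (2 * K)) in Hd1; [|lra].
    pose proof (Rmin_r 1 (eps / (2 * K))) as h. fold d in h.
    apply (Rmult_le_compat_r (2 * K)) in h; [|lra].
    unfold Rdiv in h. rewrite Rmult_assoc, Rinv_l in h by lra. lra. }
  replace (u k * v k - l * m) with ((u k - l) * (v k - m) + (l * (v k - m) + m * (u k - l))) by ring.
  pose proof (Cmod_triangle ((u k - l) * (v k - m)) (l * (v k - m) + m * (u k - l))) as t1.
  pose proof (Cmod_triangle (l * (v k - m)) (m * (u k - l))) as t2.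
  rewrite !Cmod_mult in *.
  pose proof (Cmod_ge_0 (u k - l)). pose proof (Cmod_ge_0 (v k - m)).
  pose proof (Cmod_ge_0 l). pose proof (Cmod_ge_0 m).
  assert (Cmod (u k - l) * Cmod (v k - m) <= d * 1)%R by (apply Rmult_le_compat; lra).
  assert (Cmod l * Cmod (v k - m) <= Cmod l * d)%R by (apply Rmult_le_compat_l; lra).
  assert (Cmod m * Cmod (u k - l) <= Cmod m * d)%R by (apply Rmult_le_compat_l; lra).
  assert (d * (1 + Cmod l + Cmod m) <= eps / 2)%R by (fold K; lra).
  lra.
Qed.

Lemma tendsto_scal {FF : Filter F} c u l :
  tendsto F u l -> tendsto F (fun k => c * u k) (c * l).
Proof. intros H. apply tendsto_mult; [apply tendsto_const|easy]. Qed.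

Lemma tendsto_opp {FF : Filter F} u l : tendsto F u l -> tendsto F (fun k => - u k) (- l).
Proof.
  intros H eps He. generalize (H eps He). apply filter_imp. intros k h.
  replace (- u k - - l) with (- (u k - l)) by ring. now rewrite Cmod_opp.
Qed.

Lemma tendsto_minus {FF : Filter F} u v l m :
  tendsto F u l -> tendsto F v m -> tendsto F (fun k => u k - v k) (l - m).
Proof. intros H H'. apply tendsto_plus; [easy|now apply tendsto_opp]. Qed.

Lemma tendsto_ext_loc {FF : Filter F} u v l :
  F (fun k => u k = v k) -> tendsto F u l -> tendsto F v l.
Proof.
  intros H Hu eps He. generalize (filter_and _ _ H (Hu eps He)).
  apply filter_imp. intros k [-> h]. exact h.
Qed.

Lemma tendsto_ext {FF : Filter F} u v l :
  (forall k, u k = v k) -> tendsto F u l -> tendsto F v l.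
Proof. intros H. apply tendsto_ext_loc. now apply filter_forall. Qed.

Lemma tendsto_unique {FF : ProperFilter F} u l m : tendsto F u l -> tendsto F u m -> l = m.
Proof.
  intros Hl Hm. apply Cmod_small_eq. intros eps He.
  destruct (filter_ex _ (filter_and _ _ (Hl _ (half_pos _ He)) (Hm _ (half_pos _ He))))
    as [k [h1 h2]].
  pose proof (Cmod_triangle_mid l (u k) m). lra.
Qed.

Lemma tendsto_le_0 {FF : Filter F} u (g : T -> R) :
  F (fun k => (Cmod (u k) <= g k)%R) ->
  (forall eps : R, (0 < eps)%R -> F (fun k => (g k < eps)%R)) -> tendsto F u 0.
Proof.
  intros H Hg eps He. generalize (filter_and _ _ H (Hg eps He)). apply filter_imp.
  intros k [h1 h2]. replace (u k - 0) with (u k) by ring. lra.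
Qed.

Lemma tendsto_filterlim {FF : Filter F} u l :
  tendsto F u l -> filterlim (U := C_UniformSpace) u F (locally (T := C_UniformSpace) l).
Proof.
  intros H P [d Hd]. unfold filtermap.
  generalize (H d (cond_pos d)). apply filter_imp. intros k hk. apply Hd.
  split.
  - change (Rabs (Re (u k) - Re l) < d)%R.
    eapply Rle_lt_trans; [|exact hk].
    exact (re_le_Cmod (u k - l)).
  - change (Rabs (Im (u k) - Im l) < d)%R.
    eapply Rle_lt_trans; [|exact hk].
    exact (Rabs_Im_le (u k - l)).
Qed.

End Tendsto.

Lemma Cmod_le_Re_Im (z : C) : (Cmod z <= Rabs (Re z) + Rabs (Im z))%R.
Proof.
  replace z with (RtoC (Re z) + Ci * RtoC (Im z)) at 1
    by (destruct z; unfold RtoC, Ci, Cplus, Cmult; simpl; f_equal; ring).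
  eapply Rle_trans; [apply Cmod_triangle|].
  rewrite Cmod_mult, Cmod_Ci, !Cmod_R. lra.
Qed.

Definition lsum {I : Type} (f : I -> C) (l : list I) : C :=
  fold_right (fun i s => f i + s) 0 l.

Definition rsum {I : Type} (f : I -> R) (l : list I) : R :=
  fold_right (fun i s => (f i + s)%R) 0%R l.

(** Unordered summation: reindexing, sums over pairs and sums over [Z] need no
    enumeration of the index type. *)
Definition has_sum {I : Type} (f : I -> C) (s : C) : Prop :=
  forall eps : R, (0 < eps)%R -> exists l0, forall l,
    NoDup l -> incl l0 l -> (Cmod (lsum f l - s) < eps)%R.

Definition summable {I : Type} (g : I -> R) : Prop :=
  (forall i, (0 <= g i)%R) /\ exists M, forall l, NoDup l -> (rsum g l <= M)%R.

Definition eq_dec_classic {I : Type} (x y : I) : {x = y} + {x <> y} :=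
  excluded_middle_informative (x = y).

Section FiniteSums.
Context {I : Type}.
Implicit Types (f : I -> C) (g : I -> R) (l : list I).

Lemma lsum_app f l l' : lsum f (l ++ l') = lsum f l + lsum f l'.
Proof. induction l as [|i l IH]; simpl; [ring|rewrite IH; ring]. Qed.

Lemma rsum_app g l l' : rsum g (l ++ l') = (rsum g l + rsum g l')%R.
Proof. induction l as [|i l IH]; simpl; [ring|rewrite IH; ring]. Qed.

Lemma lsum_perm f l l' : Permutation l l' -> lsum f l = lsum f l'.
Proof. induction 1; simpl; try congruence; ring. Qed.

Lemma rsum_perm g l l' : Permutation l l' -> rsum g l = rsum g l'.
Proof. induction 1; simpl; try congruence; ring. Qed.

Lemma lsum_ext f f' l : (forall i, In i l -> f i = f' i) -> lsum f l = lsum f' l.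
Proof.
  induction l as [|i l IH]; simpl; intros H; [easy|].
  rewrite IH by (intros; apply H; auto). now rewrite H by auto.
Qed.

Lemma lsum_plus f f' l : lsum (fun i => f i + f' i) l = lsum f l + lsum f' l.
Proof. induction l as [|i l IH]; simpl; [ring|rewrite IH; ring]. Qed.

Lemma lsum_scal c f l : lsum (fun i => c * f i) l = c * lsum f l.
Proof. induction l as [|i l IH]; simpl; [ring|rewrite IH; ring]. Qed.

Lemma rsum_plus g g' l : rsum (fun i => (g i + g' i)%R) l = (rsum g l + rsum g' l)%R.
Proof. induction l as [|i l IH]; simpl; [ring|rewrite IH; ring]. Qed.

Lemma rsum_scal c g l : rsum (fun i => (c * g i)%R) l = (c * rsum g l)%R.
Proof. induction l as [|i l IH]; simpl; [ring|rewrite IH; ring]. Qed.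

Lemma rsum_le g g' l : (forall i, In i l -> (g i <= g' i)%R) -> (rsum g l <= rsum g' l)%R.
Proof.
  induction l as [|i l IH]; simpl; intros H; [lra|].
  specialize (IH (fun i h => H i (or_intror h))). specialize (H i (or_introl eq_refl)). lra.
Qed.

Lemma rsum_nonneg g l : (forall i, (0 <= g i)%R) -> (0 <= rsum g l)%R.
Proof. intros H. induction l as [|i l IH]; simpl; [lra|]. specialize (H i). lra. Qed.

Lemma Cmod_lsum_le f g l :
  (forall i, In i l -> (Cmod (f i) <= g i)%R) -> (Cmod (lsum f l) <= rsum g l)%R.
Proof.
  induction l as [|i l IH]; simpl; intros H; [rewrite Cmod_0; lra|].
  eapply Rle_trans; [apply Cmod_triangle|].
  specialize (IH (fun i h => H i (or_intror h))). specialize (H i (or_introl eq_refl)). lra.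
Qed.

Lemma perm_complement l0 l : NoDup l0 -> incl l0 l -> exists r, Permutation l (l0 ++ r).
Proof.
  revert l. induction l0 as [|i l0 IH]; intros l H0 Hi.
  - exists l. apply Permutation_refl.
  - destruct (in_split i l (Hi i (or_introl eq_refl))) as [l1 [l2 ->]].
    inversion_clear H0.
    destruct (IH (l1 ++ l2)) as [r Hr]; [easy| |].
    + intros j Hj. specialize (Hi j (or_intror Hj)).
      apply in_app_iff in Hi. apply in_app_iff. destruct Hi as [h|[h|h]]; auto.
      subst j. now elim H.
    + exists r. rewrite <- Permutation_middle. simpl. now constructor.
Qed.

Lemma rsum_incl g l l' :
  (forall i, (0 <= g i)%R) -> NoDup l -> incl l l' -> (rsum g l <= rsum g l')%R.
Proof.
  intros Hg Hl Hi. destruct (perm_complement l l' Hl Hi) as [r Hr].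
  rewrite (rsum_perm g _ _ Hr), rsum_app. pose proof (rsum_nonneg g r Hg). lra.
Qed.

Lemma Re_lsum f l : Re (lsum f l) = rsum (fun i => Re (f i)) l.
Proof. induction l as [|i l IH]; simpl; [easy|]. now rewrite <- IH. Qed.

Lemma Im_lsum f l : Im (lsum f l) = rsum (fun i => Im (f i)) l.
Proof. induction l as [|i l IH]; simpl; [easy|]. now rewrite <- IH. Qed.

Definition nd l : list I := nodup eq_dec_classic l.

Lemma NoDup_nd l : NoDup (nd l).
Proof. apply NoDup_nodup. Qed.

Lemma incl_nd l l' : incl l l' -> incl l (nd l').
Proof. intros H i Hi. apply nodup_In. auto. Qed.

Lemma summable_le g g' : (forall i, (0 <= g i <= g' i)%R) -> summable g' -> summable g.
Proof.
  intros H [_ [M HM]]. split; [intros i; apply H|]. exists M. intros l Hl.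
  eapply Rle_trans; [|apply (HM l Hl)]. apply rsum_le. intros; apply H.
Qed.

Lemma summable_plus g g' :
  summable g -> summable g' -> summable (fun i => (g i + g' i)%R).
Proof.
  intros [P [M HM]] [P' [M' HM']]. split.
  - intros i. specialize (P i). specialize (P' i). lra.
  - exists (M + M')%R. intros l Hl. rewrite rsum_plus.
    specialize (HM l Hl). specialize (HM' l Hl). lra.
Qed.

Lemma summable_scal c g : (0 <= c)%R -> summable g -> summable (fun i => (c * g i)%R).
Proof.
  intros Hc [P [M HM]]. split.
  - intros i. now apply Rmult_le_pos.
  - exists (c * M)%R. intros l Hl. rewrite rsum_scal. apply Rmult_le_compat_l; auto.
Qed.

Lemma summable_sup g : summable g ->
  exists s, (forall l, NoDup l -> (rsum g l <= s)%R) /\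
    forall eps : R, (0 < eps)%R -> exists l, NoDup l /\ (s - eps < rsum g l)%R.
Proof.
  intros [_ [M HM]].
  destruct (completeness (fun x => exists l, NoDup l /\ x = rsum g l)) as [s [Hs1 Hs2]].
  - exists M. intros x [l [Hl ->]]. auto.
  - exists 0%R, nil. split; [constructor|easy].
  - exists s. split; [eauto|]. intros eps He. apply NNPP. intros h.
    assert (s <= s - eps)%R; [|lra]. apply Hs2. intros x [l [Hl ->]].
    apply Rnot_lt_le. intros h'. apply h. eauto.
Qed.

(** Finite families beyond a suitable one have small sums: this single estimate
    gives both the comparison of partial sums and dominated convergence. *)
Lemma summable_tail g : summable g -> forall eps : R, (0 < eps)%R ->
  exists l0, NoDup l0 /\ forall r, NoDup (l0 ++ r) -> (rsum g r <= eps)%R.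
Proof.
  intros Hg eps He. destruct (summable_sup g Hg) as [s [Hs H]].
  destruct (H eps He) as [l [Hl h]]. exists l. split; [easy|]. intros r Hr.
  pose proof (Hs _ Hr) as B. rewrite rsum_app in B. lra.
Qed.

Lemma lsum_tail f g l0 l eps :
  (forall i, (Cmod (f i) <= g i)%R) -> NoDup l0 ->
  (forall r, NoDup (l0 ++ r) -> (rsum g r <= eps)%R) ->
  NoDup l -> incl l0 l -> (Cmod (lsum f l - lsum f l0) <= eps)%R.
Proof.
  intros Hg H0 Ht Hl Hi. destruct (perm_complement l0 l H0 Hi) as [r Hr].
  rewrite (lsum_perm f _ _ Hr), lsum_app.
  replace (lsum f l0 + lsum f r - lsum f l0) with (lsum f r) by ring.
  eapply Rle_trans; [apply (Cmod_lsum_le f g); auto|].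
  apply Ht. eapply Permutation_NoDup; eassumption.
Qed.

End FiniteSums.

Section HasSum.
Context {I : Type}.
Implicit Types (f : I -> C) (g : I -> R).

Lemma has_sum_tail f g s l0 eps :
  has_sum f s -> (forall i, (Cmod (f i) <= g i)%R) -> NoDup l0 ->
  (forall r, NoDup (l0 ++ r) -> (rsum g r <= eps)%R) ->
  (Cmod (s - lsum f l0) <= eps)%R.
Proof.
  intros Hs Hg H0 Ht. apply Rle_plus_epsilon. intros d Hd.
  destruct (Hs d Hd) as [l1 H1].
  set (l := nd (l0 ++ l1)).
  assert (Cmod (lsum f l - s) < d)%R.
  { apply H1; [apply NoDup_nd|]. apply incl_nd. intros i Hi. apply in_app_iff; auto. }
  assert (Cmod (lsum f l - lsum f l0) <= eps)%R.
  { eapply lsum_tail; eauto; [apply NoDup_nd|]. apply incl_nd. intros i Hi. apply in_app_iff; auto. }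
  pose proof (Cmod_triangle_mid s (lsum f l) (lsum f l0)). lra.
Qed.

Lemma rsum_converges (g : I -> R) : summable g ->
  exists s, forall eps : R, (0 < eps)%R -> exists l0, forall l,
    NoDup l -> incl l0 l -> (Rabs (rsum g l - s) < eps)%R.
Proof.
  intros Hg. destruct (summable_sup g Hg) as [s [Hs H]]. exists s. intros eps He.
  destruct (H eps He) as [l [Hl h]]. exists l. intros l' Hl' Hi.
  pose proof (Hs _ Hl'). pose proof (rsum_incl g l l' (proj1 Hg) Hl Hi).
  apply Rabs_def1; lra.
Qed.

Lemma rsum_abs_converges (h g : I -> R) : (forall i, (Rabs (h i) <= g i)%R) -> summable g ->
  exists s, forall eps : R, (0 < eps)%R -> exists l0, forall l,
    NoDup l -> incl l0 l -> (Rabs (rsum h l - s) < eps)%R.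
Proof.
  intros Hh Hg.
  destruct (rsum_converges g Hg) as [s Hs].
  destruct (rsum_converges (fun i => (g i + h i)%R)) as [s' Hs'].
  { apply (summable_le _ (fun i => (g i + g i)%R)); [|now apply summable_plus].
    intros i. specialize (Hh i). apply Rabs_le_between in Hh. lra. }
  exists (s' - s)%R. intros eps He.
  destruct (Hs _ (half_pos _ He)) as [l0 H0].
  destruct (Hs' _ (half_pos _ He)) as [l1 H1].
  exists (l0 ++ l1). intros l Hl Hi.
  specialize (H0 l Hl (fun i hi => Hi i (in_or_app _ _ _ (or_introl hi)))).
  specialize (H1 l Hl (fun i hi => Hi i (in_or_app _ _ _ (or_intror hi)))).
  rewrite rsum_plus in H1. apply Rabs_def2 in H0. apply Rabs_def2 in H1. apply Rabs_def1; lra.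
Qed.

(** Absolute convergence implies convergence, through real and imaginary parts. *)
Lemma summable_has_sum f g :
  (forall i, (Cmod (f i) <= g i)%R) -> summable g -> exists s, has_sum f s.
Proof.
  intros Hf Hg.
  destruct (rsum_abs_converges (fun i => Re (f i)) g) as [x Hx]; [|easy|].
  { intros i. eapply Rle_trans; [apply re_le_Cmod|auto]. }
  destruct (rsum_abs_converges (fun i => Im (f i)) g) as [y Hy]; [|easy|].
  { intros i. eapply Rle_trans; [apply Rabs_Im_le|auto]. }
  exists (x, y). intros eps He.
  destruct (Hx _ (half_pos _ He)) as [l0 H0].
  destruct (Hy _ (half_pos _ He)) as [l1 H1].
  exists (l0 ++ l1). intros l Hl Hi.
  specialize (H0 l Hl (fun i hi => Hi i (in_or_app _ _ _ (or_introl hi)))).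
  specialize (H1 l Hl (fun i hi => Hi i (in_or_app _ _ _ (or_intror hi)))).
  eapply Rle_lt_trans; [apply Cmod_le_Re_Im|].
  unfold Cminus. rewrite re_plus, im_plus, re_opp, im_opp, Re_lsum, Im_lsum.
  unfold Rminus in H0, H1. simpl (Re (x, y)). simpl (Im (x, y)). lra.
Qed.

Lemma has_sum_unique f s s' : has_sum f s -> has_sum f s' -> s = s'.
Proof.
  intros H H'. apply Cmod_small_eq. intros eps He.
  destruct (H _ (half_pos _ He)) as [l0 H0].
  destruct (H' _ (half_pos _ He)) as [l1 H1].
  set (l := nd (l0 ++ l1)).
  specialize (H0 l (NoDup_nd _) (incl_nd _ _ (incl_appl _ (incl_refl _)))).
  specialize (H1 l (NoDup_nd _) (incl_nd _ _ (incl_appr _ (incl_refl _)))).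
  pose proof (Cmod_triangle_mid s (lsum f l) s'). lra.
Qed.

Lemma has_sum_ext f f' s : (forall i, f i = f' i) -> has_sum f s -> has_sum f' s.
Proof.
  intros E H eps He. destruct (H eps He) as [l0 H0]. exists l0. intros l Hl Hi.
  rewrite <- (lsum_ext f f') by auto. auto.
Qed.

Lemma has_sum_plus f f' s s' :
  has_sum f s -> has_sum f' s' -> has_sum (fun i => f i + f' i) (s + s').
Proof.
  intros H H' eps He.
  destruct (H _ (half_pos _ He)) as [l0 H0].
  destruct (H' _ (half_pos _ He)) as [l1 H1].
  exists (l0 ++ l1). intros l Hl Hi.
  specialize (H0 l Hl (fun i hi => Hi i (in_or_app _ _ _ (or_introl hi)))).
  specialize (H1 l Hl (fun i hi => Hi i (in_or_app _ _ _ (or_intror hi)))).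
  rewrite lsum_plus.
  replace (lsum f l + lsum f' l - (s + s')) with ((lsum f l - s) + (lsum f' l - s')) by ring.
  eapply Rle_lt_trans; [apply Cmod_triangle|lra].
Qed.

Lemma has_sum_scal c f s : has_sum f s -> has_sum (fun i => c * f i) (c * s).
Proof.
  intros H eps He. pose proof (Cmod_ge_0 c) as Hc.
  destruct (H (eps / (1 + Cmod c))%R) as [l0 H0].
  { apply Rdiv_lt_0_compat; lra. }
  exists l0. intros l Hl Hi. specialize (H0 l Hl Hi). rewrite lsum_scal.
  replace (c * lsum f l - c * s) with (c * (lsum f l - s)) by ring. rewrite Cmod_mult.
  apply (Rmult_lt_compat_r (1 + Cmod c)) in H0; [|lra].
  unfold Rdiv in H0. rewrite Rmult_assoc, Rinv_l in H0 by lra.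
  pose proof (Cmod_ge_0 (lsum f l - s)). nra.
Qed.

Lemma has_sum_minus f f' s s' :
  has_sum f s -> has_sum f' s' -> has_sum (fun i => f i - f' i) (s - s').
Proof.
  intros H H'. apply (has_sum_scal (- (1))) in H'.
  pose proof (has_sum_plus _ _ _ _ H H') as h.
  replace (s - s') with (s + - (1) * s') by ring.
  eapply has_sum_ext; [|exact h]. intros i; simpl; ring.
Qed.

Lemma has_sum_finite f l0 :
  NoDup l0 -> (forall i, ~ In i l0 -> f i = 0) -> has_sum f (lsum f l0).
Proof.
  intros H0 Hz eps He. exists l0. intros l Hl Hi.
  destruct (perm_complement l0 l H0 Hi) as [r Hr].
  rewrite (lsum_perm f _ _ Hr), lsum_app.
  assert (Hr0 : lsum f r = 0).
  { assert (NoDup (l0 ++ r)) by (eapply Permutation_NoDup; eassumption).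
    clear Hr. assert (forall i, In i r -> ~ In i l0).
    { intros i Hir Hi0. apply in_split in Hir. destruct Hir as [r1 [r2 ->]].
      rewrite app_assoc in H. apply NoDup_remove_2 in H. apply H.
      apply in_app_iff. left. apply in_app_iff. now left. }
    clear H Hi. induction r as [|i r IH]; simpl; [easy|].
    rewrite IH by (intros; apply H1; now right). rewrite Hz by (apply H1; now left). ring. }
  rewrite Hr0. replace (lsum f l0 + 0 - lsum f l0) with (RtoC 0) by ring.
  now rewrite Cmod_0.
Qed.

(** Dominated convergence for sums, along an arbitrary filter: beyond a finite set
    that is common to all members of the family, the majorant bounds every tail. *)
Lemma has_sum_tannery {T : Type} {F : (T -> Prop) -> Prop} {FF : Filter F}
  (u : T -> I -> C) f g (S : T -> C) s :
  summable g -> F (fun k => forall i, (Cmod (u k i) <= g i)%R) ->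
  (forall i, (Cmod (f i) <= g i)%R) ->
  (forall i, tendsto F (fun k => u k i) (f i)) ->
  F (fun k => has_sum (u k) (S k)) -> has_sum f s -> tendsto F S s.
Proof.
  intros Hg Hu Hf Hl HS Hs eps He.
  destruct (summable_tail g Hg _ (quarter_pos _ He)) as [l0 [H0 Ht]].
  assert (Hfin : tendsto F (fun k => lsum (u k) l0) (lsum f l0)).
  { clear - FF Hl. induction l0 as [|i l IH]; simpl; [apply tendsto_const|].
    now apply (tendsto_plus (fun k => u k i)). }
  generalize (filter_and _ _ (filter_and _ _ Hu HS) (Hfin _ (quarter_pos _ He))).
  apply filter_imp. intros k [[h1 h2] h3].
  pose proof (has_sum_tail _ _ _ _ _ h2 h1 H0 Ht).
  pose proof (has_sum_tail _ _ _ _ _ Hs Hf H0 Ht).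
  pose proof (Cmod_triangle_sub (S k) (lsum (u k) l0) s).
  pose proof (Cmod_triangle_sub (lsum (u k) l0) (lsum f l0) s).
  pose proof (Cmod_sub_sym (lsum f l0) s). lra.
Qed.

End HasSum.

Lemma lsum_map {I J : Type} (h : I -> J) (f : J -> C) l :
  lsum f (map h l) = lsum (fun i => f (h i)) l.
Proof. induction l as [|i l IH]; simpl; [easy|now rewrite IH]. Qed.

Lemma rsum_map {I J : Type} (h : I -> J) (f : J -> R) l :
  rsum f (map h l) = rsum (fun i => f (h i)) l.
Proof. induction l as [|i l IH]; simpl; [easy|now rewrite IH]. Qed.

Lemma NoDup_map_inj {I J : Type} (h : I -> J) l :
  (forall x y, h x = h y -> x = y) -> NoDup l -> NoDup (map h l).
Proof.
  intros Hh. induction 1; simpl; constructor; auto.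
  intros Hi. apply in_map_iff in Hi. destruct Hi as [y [E Hy]]. apply Hh in E. now subst.
Qed.

Lemma has_sum_reindex {I J : Type} (h : I -> J) (k : J -> I) (f : J -> C) s :
  (forall i, k (h i) = i) -> (forall j, h (k j) = j) ->
  has_sum f s -> has_sum (fun i => f (h i)) s.
Proof.
  intros kh hk H eps He. destruct (H eps He) as [l0 H0].
  exists (map k l0). intros l Hl Hi. rewrite <- (lsum_map h f). apply H0.
  - apply NoDup_map_inj; [|easy]. intros x y E. rewrite <- (kh x), E. apply kh.
  - intros j Hj. rewrite <- (hk j). apply in_map. apply Hi. now apply in_map.
Qed.

Lemma summable_inj {I J : Type} (h : I -> J) (g : J -> R) :
  (forall x y, h x = h y -> x = y) -> summable g -> summable (fun i => g (h i)).
Proof.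
  intros Hh [P [M HM]]. split; [auto|]. exists M. intros l Hl.
  rewrite <- (rsum_map h g). apply HM. now apply NoDup_map_inj.
Qed.

(** Extension of a family by zero outside the image of an injection. *)
Lemma has_sum_support {I J : Type} (h : I -> J) (f : J -> C) s :
  (forall x y, h x = h y -> x = y) ->
  (forall j, (forall i, j <> h i) -> f j = 0) ->
  has_sum (fun i => f (h i)) s -> has_sum f s.
Proof.
  intros Hh Hz H eps He. destruct (H eps He) as [l0 H0].
  exists (map h l0). intros l Hl Hi.
  assert (E : exists l', NoDup l' /\ (forall i, In (h i) l <-> In i l') /\
    lsum f l = lsum (fun i => f (h i)) l').
  { clear Hi. induction Hl as [|j l Hj Hl IH]; simpl.
    - exists nil. repeat split; try constructor; intros [].
    - destruct IH as [l' [N [In' E]]].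
      destruct (classic (exists i, j = h i)) as [[i ->]|Hn].
      + exists (i :: l'). repeat split.
        * constructor; [|easy]. now rewrite <- In'.
        * intros [E'|E']; [left; now apply Hh|right; now apply In'].
        * intros [->|E']; [now left|right; now apply In'].
        * simpl. now rewrite E.
      + exists l'. repeat split; auto.
        * intros [->|E']; [elim Hn; eauto|now apply In'].
        * intros E'. right. now apply In'.
        * rewrite Hz, E; [ring|]. intros i ->. apply Hn. eauto. }
  destruct E as [l' [N [In' ->]]]. apply H0; [easy|].
  intros i Hi'. apply In'. apply Hi. now apply in_map.
Qed.

Lemma lsum_list_prod_fibre {I J : Type} (f : I * J -> C) (i : I) (K : list J) :
  lsum f (map (pair i) K) = lsum (fun j => f (i, j)) K.
Proof. apply (lsum_map (pair i)). Qed.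

(** Each inner sum is approximated by a finite one whose index set contains the
    fibre of a good finite set of pairs, with an error spread over the outer set. *)
Lemma has_sum_fubini {I J : Type} (f : I * J -> C) (h : I -> C) s :
  has_sum f s -> (forall i, has_sum (fun j => f (i, j)) (h i)) -> has_sum h s.
Proof.
  intros Hf Hh eps He.
  destruct (Hf _ (half_pos _ He)) as [l0 H0].
  exists (map fst l0). intros l Hl Hi.
  assert (E : forall d : R, (0 < d)%R -> exists L, NoDup L /\
    (forall p, In p L -> In (fst p) l) /\
    (forall p, In p l0 -> In (fst p) l -> In p L) /\
    (Cmod (lsum f L - lsum h l) <= d * INR (length l))%R).
  { intros d Hd. clear Hi. induction Hl as [|i l Hil Hl IH].
    - exists nil. split; [constructor|]. split; [easy|]. split; [easy|].
      simpl. replace (0 - 0) with (RtoC 0) by ring. rewrite Cmod_0. lra.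
    - destruct IH as [L [N [S1 [S2 E]]]].
      destruct (Hh i d Hd) as [K HK].
      set (K' := nd (K ++ map snd (filter (fun p => if eq_dec_classic (fst p) i then true else false) l0))).
      specialize (HK K' (NoDup_nd _) (incl_nd _ _ (incl_appl _ (incl_refl _)))).
      exists (map (pair i) K' ++ L). repeat split.
      + assert (ND : NoDup (map (pair i) K')).
        { apply NoDup_map_inj; [|apply NoDup_nd]. intros x y E'. now injection E'. }
        clear - ND N S1 Hil.
        assert (D : forall p, In p (map (pair i) K') -> ~ In p L).
        { intros p Hp Hp'. apply in_map_iff in Hp. destruct Hp as [j [<- _]].
          apply S1 in Hp'. now apply Hil. }
        induction ND as [|p m Hp ND IH]; simpl; [easy|]. constructor.
        * rewrite in_app_iff. intros [h|h]; [easy|]. apply (D p); [now left|easy].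
        * apply IH. intros q Hq. apply D. now right.
      + intros p Hp. apply in_app_iff in Hp. destruct Hp as [Hp|Hp].
        * apply in_map_iff in Hp. destruct Hp as [j [<- _]]. now left.
        * right. auto.
      + intros p Hp [Ep|Hp']; apply in_app_iff; [left|right; auto].
        apply in_map_iff. exists (snd p). split; [destruct p; simpl in *; congruence|].
        apply nodup_In. apply in_app_iff. right. apply in_map. apply filter_In. split; [easy|].
        destruct (eq_dec_classic (fst p) i); congruence.
      + rewrite lsum_app, lsum_list_prod_fibre. simpl lsum at 3. simpl length. rewrite S_INR.
        replace (lsum (fun j => f (i, j)) K' + lsum f L - (h i + lsum h l))
          with ((lsum (fun j => f (i, j)) K' - h i) + (lsum f L - lsum h l)) by ring.
        eapply Rle_trans; [apply Cmod_triangle|]. lra. }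
  assert (Hn : (0 < 1 + INR (length l))%R) by (pose proof (pos_INR (length l)); lra).
  destruct (E (eps / 2 / (1 + INR (length l)))%R) as [L [N [_ [S2 B]]]].
  { apply Rdiv_lt_0_compat; lra. }
  specialize (H0 L N). assert (Cmod (lsum f L - s) < eps / 2)%R.
  { apply H0. intros p Hp. apply S2; [easy|]. apply Hi. now apply in_map. }
  assert (eps / 2 / (1 + INR (length l)) * INR (length l) <= eps / 2)%R.
  { unfold Rdiv at 1. rewrite Rmult_assoc. rewrite <- (Rmult_1_r (eps / 2)) at 2.
    apply Rmult_le_compat_l; [lra|]. apply (Rmult_le_reg_l (1 + INR (length l))); [easy|].
    rewrite <- Rmult_assoc, Rinv_r by lra. lra. }
  pose proof (Cmod_triangle_mid (lsum h l) (lsum f L) s). lra.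
Qed.

Lemma rsum_list_prod {I J : Type} (g : I -> R) (h : J -> R) l m :
  rsum (fun p => (g (fst p) * h (snd p))%R) (list_prod l m) = (rsum g l * rsum h m)%R.
Proof.
  induction l as [|i l IH]; simpl; [ring|].
  rewrite rsum_app, IH, rsum_map. simpl. rewrite (rsum_scal (g i) h). ring.
Qed.

Lemma summable_prod {I J : Type} (g : I -> R) (h : J -> R) :
  summable g -> summable h -> summable (fun p : I * J => (g (fst p) * h (snd p))%R).
Proof.
  intros [Pg [M HM]] [Ph [M' HM']]. split.
  - intros p. now apply Rmult_le_pos.
  - exists (M * M')%R. intros l Hl.
    eapply Rle_trans.
    { apply (rsum_incl _ l (list_prod (nd (map fst l)) (nd (map snd l)))); [|easy|].
      - intros p. now apply Rmult_le_pos.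
      - intros [i j] Hp. apply in_prod; apply nodup_In;
          [apply (in_map fst _ _ Hp)|apply (in_map snd _ _ Hp)]. }
    rewrite rsum_list_prod.
    apply Rmult_le_compat; try (apply rsum_nonneg; auto); [apply HM|apply HM']; apply NoDup_nd.
Qed.

Lemma has_sum_mult {I J : Type} (f : I -> C) (h : J -> C) s t :
  summable (fun i => Cmod (f i)) -> summable (fun j => Cmod (h j)) ->
  has_sum f s -> has_sum h t -> has_sum (fun p : I * J => f (fst p) * h (snd p)) (s * t).
Proof.
  intros Hf Hh Hs Ht.
  destruct (summable_has_sum (fun p : I * J => f (fst p) * h (snd p)) _
    (fun p => Req_le _ _ (Cmod_mult _ _)) (summable_prod _ _ Hf Hh)) as [u Hu].
  replace (s * t) with u; [easy|].
  apply (has_sum_unique (fun i => t * f i)).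
  - apply (has_sum_fubini _ _ _ Hu). intros i. simpl.
    rewrite Cmult_comm. now apply has_sum_scal.
  - rewrite Cmult_comm. now apply has_sum_scal.
Qed.

Lemma has_sum_swap {I J : Type} (f : I * J -> C) s :
  has_sum f s -> has_sum (fun p : J * I => f (snd p, fst p)) s.
Proof.
  apply (has_sum_reindex (fun p : J * I => (snd p, fst p)) (fun p => (snd p, fst p)));
    now intros [].
Qed.

Lemma has_sum_tendsto {I : Type} (f : I -> C) s (L : nat -> list I) :
  (forall n, NoDup (L n)) -> (forall i, exists N, forall n, (N <= n)%nat -> In i (L n)) ->
  has_sum f s -> tendsto eventually (fun n => lsum f (L n)) s.
Proof.
  intros HN Hi H eps He. destruct (H eps He) as [l0 H0].
  assert (E : exists N, forall n, (N <= n)%nat -> incl l0 (L n)).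
  { clear H0. induction l0 as [|i l IH].
    - exists O. intros n _ j [].
    - destruct IH as [N HN']. destruct (Hi i) as [N' HN'']. exists (max N N').
      intros n Hn j [<-|Hj]; [apply HN''; lia|apply HN'; [lia|easy]]. }
  destruct E as [N E]. exists N. intros n Hn. apply H0; auto.
Qed.

Lemma lsum_seq (f : nat -> C) n : lsum f (seq 0 (S n)) = sum_n f n.
Proof.
  induction n as [|n IH].
  - simpl. rewrite sum_O. ring.
  - rewrite seq_S, lsum_app, IH, sum_Sn. simpl. change plus with Cplus. f_equal. ring.
Qed.

Lemma rsum_seq (f : nat -> R) n : rsum f (seq 0 (S n)) = sum_n f n.
Proof.
  induction n as [|n IH].
  - simpl. rewrite sum_O. ring.
  - rewrite seq_S, rsum_app, IH, sum_Sn. simpl. change plus with Rplus. f_equal. ring.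
Qed.

Lemma has_sum_nat_tendsto (f : nat -> C) s :
  has_sum f s -> tendsto eventually (fun n => sum_n f n) s.
Proof.
  intros H. eapply tendsto_ext; [intros n; apply (lsum_seq f)|].
  apply (has_sum_tendsto f s (fun n => seq 0 (S n))); [| |easy].
  - intros n. apply seq_NoDup.
  - intros i. exists i. intros n Hn. apply in_seq. lia.
Qed.

Lemma NoDup_nat_bound (l : list nat) : exists n, incl l (seq 0 (S n)).
Proof.
  exists (list_max l). intros i Hi. apply in_seq.
  pose proof (proj1 (list_max_le l (list_max l)) (Nat.le_refl _)) as H.
  rewrite Forall_forall in H. specialize (H i Hi). lia.
Qed.

Lemma ex_series_summable (g : nat -> R) :
  (forall n, (0 <= g n)%R) -> ex_series g -> summable g.
Proof.
  intros P [s Hs]. split; [easy|]. exists s. intros l Hl.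
  destruct (NoDup_nat_bound l) as [n Hn].
  eapply Rle_trans; [apply (rsum_incl g l _ P Hl Hn)|].
  rewrite rsum_seq.
  assert (Hlim : is_lim_seq (sum_n g) s) by exact Hs.
  apply (is_lim_seq_incr_compare _ _ Hlim).
  intros k. rewrite sum_Sn. change plus with Rplus. specialize (P (S k)). lra.
Qed.

(** * The complex exponential *)

Lemma Cexp_plus (a b : C) : Cexp (a + b) = Cexp a * Cexp b.
Proof.
  unfold Cexp. rewrite re_plus, im_plus, exp_plus, cos_plus, sin_plus.
  unfold RtoC, Cmult; simpl. f_equal; ring.
Qed.

Lemma Cexp_0 : Cexp 0 = 1.
Proof.
  unfold Cexp. simpl (Re 0). simpl (Im 0). rewrite exp_0, cos_0, sin_0.
  unfold RtoC, Cmult; simpl. f_equal; ring.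
Qed.

Lemma Cmod_cos_sin (y : R) : Cmod (cos y, sin y) = 1%R.
Proof.
  unfold Cmod. simpl fst. simpl snd.
  replace (cos y ^ 2 + sin y ^ 2)%R with 1%R; [apply sqrt_1|].
  pose proof (sin2_cos2 y) as H. unfold Rsqr in H. simpl. lra.
Qed.

Lemma Cmod_Cexp (z : C) : Cmod (Cexp z) = exp (Re z).
Proof.
  unfold Cexp. rewrite Cmod_mult, Cmod_cos_sin, Cmod_R, Rmult_1_r.
  apply Rabs_pos_eq, Rlt_le, exp_pos.
Qed.

Lemma Cexp_neq_0 (z : C) : Cexp z <> 0.
Proof.
  intros E. pose proof (Cmod_Cexp z) as H. rewrite E, Cmod_0 in H.
  pose proof (exp_pos (Re z)). lra.
Qed.

Lemma Cexp_opp (z : C) : Cexp (- z) = / Cexp z.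
Proof.
  assert (H : Cexp (- z) * Cexp z = 1).
  { rewrite <- Cexp_plus. replace (- z + z) with (RtoC 0) by ring. apply Cexp_0. }
  pose proof (Cexp_neq_0 z) as Hz.
  rewrite <- (Cmult_1_l (/ Cexp z)), <- H. field. easy.
Qed.

Lemma Cexp_nat (n : nat) (z : C) : Cexp (RtoC (INR n) * z) = Cexp z ^ n.
Proof.
  induction n as [|n IH].
  - simpl. rewrite <- Cexp_0. f_equal. ring.
  - rewrite S_INR, RtoC_plus, Cpow_S, <- IH, <- Cexp_plus. f_equal. ring.
Qed.

Lemma taylor_bound_2 (g g1 g2 : R -> R) (M : R) :
  (forall t, is_derive g t (g1 t)) -> (forall t, is_derive g1 t (g2 t)) ->
  (forall t, (0 <= t <= 1)%R -> (Rabs (g2 t) <= M)%R) ->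
  g 0%R = 0%R -> g1 0%R = 0%R -> (Rabs (g 1%R) <= M)%R.
Proof.
  intros H1 H2 HM E0 E1.
  assert (B1 : forall t, (0 <= t <= 1)%R -> (Rabs (g1 t) <= M)%R).
  { intros t Ht. destruct (MVT_gen g1 0 t g2) as [c [Hc E]].
    - intros; auto.
    - intros x Hx. apply continuity_pt_filterlim, (ex_derive_continuous g1). eexists; apply H2.
    - rewrite Rmin_left, Rmax_right in Hc by lra. rewrite E1 in E.
      replace (g1 t) with (g2 c * t)%R by lra. rewrite Rabs_mult, (Rabs_pos_eq t) by lra.
      pose proof (HM c ltac:(lra)). pose proof (Rabs_pos (g2 c)). nra. }
  destruct (MVT_gen g 0 1 g1) as [c [Hc E]].
  - intros; auto.
  - intros x Hx. apply continuity_pt_filterlim, (ex_derive_continuous g). eexists; apply H1.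
  - rewrite Rmin_left, Rmax_right in Hc by lra. rewrite E0 in E.
    replace (g 1%R) with (g1 c) by lra. apply B1. lra.
Qed.

Lemma exp_le_compat (x y : R) : (x <= y)%R -> (exp x <= exp y)%R.
Proof. intros [H| ->]; [left; now apply exp_increasing|right; easy]. Qed.

(** The bound is uniform in [h], unlike differentiability at 0, so that it applies
    to [h] multiplied by an unbounded exponent when a series is differentiated. *)
Lemma Cexp_taylor_2 (h : C) :
  (Cmod (Cexp h - 1 - h) <= 4 * Cmod h ^ 2 * exp (Cmod h))%R.
Proof.
  destruct h as [x y]. set (h := (x, y)).
  assert (Hx : (Rabs x <= Cmod h)%R) by apply (re_le_Cmod h).
  assert (Hy : (Rabs y <= Cmod h)%R) by apply (Rabs_Im_le h).
  assert (HM : forall t A B, (0 <= t <= 1)%R -> (Rabs A <= 1)%R -> (Rabs B <= 1)%R ->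
    (Rabs (exp (t * x) * ((x * x - y * y) * A + 2 * x * y * B)) <= 2 * Cmod h ^ 2 * exp (Cmod h))%R).
  { intros t A B Ht HA HB. rewrite Rabs_mult, (Rabs_pos_eq (exp _)) by (left; apply exp_pos).
    assert (E : (exp (t * x) <= exp (Cmod h))%R).
    { apply exp_le_compat. pose proof (Rle_abs x). pose proof (Rabs_pos x). nra. }
    assert (Q : (Rabs ((x * x - y * y) * A + 2 * x * y * B) <= 2 * Cmod h ^ 2)%R).
    { assert (D : (Cmod h ^ 2 = x * x + y * y)%R).
      { rewrite Cmod2_alt. simpl. ring. }
      rewrite D. eapply Rle_trans; [apply Rabs_triang|].
      rewrite !Rabs_mult, (Rabs_pos_eq 2) by lra.
      assert (Rabs (x * x - y * y) <= x * x + y * y)%R by (apply Rabs_le; nra).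
      assert (2 * Rabs x * Rabs y <= x * x + y * y)%R.
      { pose proof (Rsqr_abs x). pose proof (Rsqr_abs y). unfold Rsqr in *.
        pose proof (Rle_0_sqr (Rabs x - Rabs y)). unfold Rsqr in *. lra. }
      pose proof (Rabs_pos A). pose proof (Rabs_pos B).
      pose proof (Rabs_pos (x * x - y * y)). pose proof (Rabs_pos x). pose proof (Rabs_pos y).
      assert (Rabs (x * x - y * y) * Rabs A <= (x * x + y * y) * 1)%R by (apply Rmult_le_compat; lra).
      assert (2 * Rabs x * Rabs y * Rabs B <= (x * x + y * y) * 1)%R by (apply Rmult_le_compat; nra).
      lra. }
    pose proof (exp_pos (t * x)). pose proof (Rabs_pos ((x * x - y * y) * A + 2 * x * y * B)).
    rewrite (Rmult_comm (exp _)). apply Rmult_le_compat; lra. }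
  assert (Bc : forall u, (Rabs (cos u) <= 1)%R) by (intros u; apply Rabs_le, COS_bound).
  assert (Bs : forall u, (Rabs (sin u) <= 1)%R) by (intros u; apply Rabs_le, SIN_bound).
  eapply Rle_trans; [apply Cmod_le_Re_Im|].
  assert (R1 : (Rabs (Re (Cexp h - 1 - h)) <= 2 * Cmod h ^ 2 * exp (Cmod h))%R).
  { replace (Re (Cexp h - 1 - h)) with (exp (1 * x) * cos (1 * y) - 1 - 1 * x)%R
      by (rewrite !Rmult_1_l; unfold Cexp, RtoC; simpl; ring).
    apply (taylor_bound_2 (fun t => exp (t * x) * cos (t * y) - 1 - t * x)%R
      (fun t => exp (t * x) * (x * cos (t * y) - y * sin (t * y)) - x)%R
      (fun t => exp (t * x) * ((x * x - y * y) * cos (t * y) + 2 * x * y * - sin (t * y)))%R).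
    - intros t. auto_derive; [easy|ring].
    - intros t. auto_derive; [easy|ring].
    - intros t Ht. apply HM; auto. now rewrite Rabs_Ropp.
    - rewrite !Rmult_0_l, exp_0, cos_0. ring.
    - rewrite !Rmult_0_l, exp_0, cos_0, sin_0. ring. }
  assert (R2 : (Rabs (Im (Cexp h - 1 - h)) <= 2 * Cmod h ^ 2 * exp (Cmod h))%R).
  { replace (Im (Cexp h - 1 - h)) with (exp (1 * x) * sin (1 * y) - 1 * y)%R
      by (rewrite !Rmult_1_l; unfold Cexp, RtoC; simpl; ring).
    apply (taylor_bound_2 (fun t => exp (t * x) * sin (t * y) - t * y)%R
      (fun t => exp (t * x) * (x * sin (t * y) + y * cos (t * y)) - y)%R
      (fun t => exp (t * x) * ((x * x - y * y) * sin (t * y) + 2 * x * y * cos (t * y)))%R).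
    - intros t. auto_derive; [easy|ring].
    - intros t. auto_derive; [easy|ring].
    - intros t Ht. apply HM; auto.
    - rewrite !Rmult_0_l, sin_0. ring.
    - rewrite !Rmult_0_l, exp_0, cos_0, sin_0. ring. }
  lra.
Qed.

(** * Complex derivatives *)

Definition cderiv (f : C -> C) (z l : C) : Prop :=
  is_derive (K := C_AbsRing) (V := AbsRing_NormedModule C_AbsRing) f z l.

Lemma cderiv_iff (f : C -> C) (z l : C) : cderiv f z l <->
  forall eps : R, (0 < eps)%R -> exists d, (0 < d)%R /\ forall h,
    (Cmod h < d)%R -> (Cmod (f (z + h)%C - f z - l * h) <= eps * Cmod h)%R.
Proof.
  split.
  - intros [_ H] eps He.
    destruct (H z (fun P HP => HP) (mkposreal eps He)) as [d Hd].
    exists d. split; [apply cond_pos|]. intros h Hh.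
    specialize (Hd (z + h)).
    assert (E : z + h - z = h) by ring.
    assert (B : (Cmod (z + h - z) < d)%R) by (rewrite E; exact Hh).
    specialize (Hd B).
    change (Cmod (f (z + h)%C - f z - (z + h - z) * l) <= eps * Cmod (z + h - z))%R in Hd.
    rewrite E in Hd. rewrite (Cmult_comm l). exact Hd.
  - intros H. split; [apply (is_linear_scal_l (K := C_AbsRing) (V := AbsRing_NormedModule C_AbsRing))|].
    intros x Hx eps. apply (is_filter_lim_locally_unique (K := C_AbsRing) (V := AbsRing_NormedModule C_AbsRing)) in Hx. subst x.
    destruct (H eps (cond_pos eps)) as [d [Hd B]]. exists (mkposreal d Hd). intros y Hy.
    change (Cmod (y - z) < d)%R in Hy. specialize (B (y - z) Hy).
    change (Cmod (f y - f z - (y - z) * l) <= eps * Cmod (y - z))%R.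
    assert (E : forall t : C, z + (t - z) = t) by (intros t; ring).
    rewrite E in B. rewrite (Cmult_comm (y - z)). exact B.
Qed.

Lemma cderiv_quadratic (f : C -> C) (z l : C) (K d : R) :
  (0 < d)%R ->
  (forall h, (Cmod h < d)%R -> (Cmod (f (z + h)%C - f z - l * h) <= K * Cmod h ^ 2)%R) ->
  cderiv f z l.
Proof.
  intros Hd H. apply cderiv_iff. intros eps He. exists (Rmin d (eps / (1 + Rabs K)))%R.
  pose proof (Rabs_pos K). pose proof (Rle_abs K).
  assert (0 < eps / (1 + Rabs K))%R by (apply Rdiv_lt_0_compat; lra).
  split; [now apply Rmin_pos|]. intros h Hh.
  assert (h1 : (Cmod h < d)%R) by (eapply Rlt_le_trans; [exact Hh|apply Rmin_l]).
  assert (h2 : (Cmod h < eps / (1 + Rabs K))%R) by (eapply Rlt_le_trans; [exact Hh|apply Rmin_r]).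
  eapply Rle_trans; [now apply H|].
  apply (Rmult_lt_compat_r (1 + Rabs K)) in h2; [|lra].
  unfold Rdiv in h2. rewrite Rmult_assoc, Rinv_l in h2 by lra.
  pose proof (Cmod_ge_0 h). simpl.
  assert (K * Cmod h <= eps)%R by nra. nra.
Qed.

Lemma cderiv_ext_loc (f g : C -> C) (z l : C) :
  (exists d, (0 < d)%R /\ forall h, (Cmod h < d)%R -> f (z + h)%C = g (z + h)%C) ->
  cderiv f z l -> cderiv g z l.
Proof.
  intros [d [Hd E]] H. apply cderiv_iff. intros eps He.
  destruct (proj1 (cderiv_iff _ _ _) H eps He) as [d' [Hd' H']].
  exists (Rmin d d'). split; [now apply Rmin_pos|]. intros h Hh.
  rewrite <- E by (eapply Rlt_le_trans; [exact Hh|apply Rmin_l]).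
  assert (E0 : f z = g z).
  { replace z with (z + 0) by ring. apply E. now rewrite Cmod_0. }
  rewrite <- E0. apply H'. eapply Rlt_le_trans; [exact Hh|apply Rmin_r].
Qed.

Lemma cderiv_ext (f g : C -> C) (z l : C) :
  (forall x, f x = g x) -> cderiv f z l -> cderiv g z l.
Proof. intros E. apply cderiv_ext_loc. exists 1%R. split; [lra|auto]. Qed.

Lemma cderiv_const (c z : C) : cderiv (fun _ => c) z 0.
Proof. exact (is_derive_const (K := C_AbsRing) (V := AbsRing_NormedModule C_AbsRing) c z). Qed.

Lemma cderiv_id (z : C) : cderiv (fun x => x) z 1.
Proof. exact (is_derive_id (K := C_AbsRing) z). Qed.

Lemma cderiv_plus (f g : C -> C) (z l m : C) :
  cderiv f z l -> cderiv g z m -> cderiv (fun x => f x + g x) z (l + m).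
Proof. exact (is_derive_plus (K := C_AbsRing) (V := AbsRing_NormedModule C_AbsRing) f g z l m). Qed.

Lemma cderiv_lipschitz (f : C -> C) (z l : C) : cderiv f z l ->
  exists d, (0 < d)%R /\ forall h, (Cmod h < d)%R ->
    (Cmod (f (z + h)%C - f z) <= (1 + Cmod l) * Cmod h)%R.
Proof.
  intros H. destruct (proj1 (cderiv_iff _ _ _) H 1%R Rlt_0_1) as [d [Hd H']]. exists d. split; [easy|].
  intros h Hh. specialize (H' h Hh).
  replace (f (z + h)%C - f z) with ((f (z + h)%C - f z - l * h) + l * h) by ring.
  eapply Rle_trans; [apply Cmod_triangle|]. rewrite (Cmod_mult l). lra.
Qed.

Lemma cderiv_mult (f g : C -> C) (z l m : C) :
  cderiv f z l -> cderiv g z m -> cderiv (fun x => f x * g x) z (l * g z + f z * m).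
Proof. intros Hf Hg. exact (is_derive_mult (K := C_AbsRing) f g z l m Hf Hg Cmult_comm). Qed.

Lemma cderiv_eq (f : C -> C) (z l m : C) : l = m -> cderiv f z l -> cderiv f z m.
Proof. now intros ->. Qed.

Lemma cderiv_scal (c : C) (f : C -> C) (z l : C) :
  cderiv f z l -> cderiv (fun x => c * f x) z (c * l).
Proof.
  intros H. eapply cderiv_eq; [|apply (cderiv_mult (fun _ => c)); [apply cderiv_const|exact H]].
  simpl. ring.
Qed.

Lemma cderiv_minus (f g : C -> C) (z l m : C) :
  cderiv f z l -> cderiv g z m -> cderiv (fun x => f x - g x) z (l - m).
Proof.
  intros Hf Hg. apply (cderiv_scal (- (1))) in Hg.
  eapply cderiv_ext; [|eapply cderiv_eq; [|exact (cderiv_plus _ _ _ _ _ Hf Hg)]];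
    [intros x; simpl; ring|ring].
Qed.

Lemma cderiv_comp (f g : C -> C) (z l m : C) :
  cderiv f (g z) l -> cderiv g z m -> cderiv (fun x => f (g x)) z (l * m).
Proof.
  intros Hf Hg. rewrite Cmult_comm.
  exact (is_derive_comp (K := C_AbsRing) (V := AbsRing_NormedModule C_AbsRing) f g z l m Hf Hg).
Qed.

Lemma cderiv_inv (z : C) : z <> 0 -> cderiv (fun x => / x) z (- / (z * z)).
Proof.
  intros Hz. pose proof (proj1 (Cmod_gt_0 z) Hz) as Hp.
  apply (cderiv_quadratic _ _ _ (2 / Cmod z ^ 3)%R (Cmod z / 2)%R); [lra|].
  intros h Hh.
  assert (Hzh : (Cmod z / 2 <= Cmod (z + h))%R).
  { pose proof (Cmod_triangle (z + h) (- h)) as T.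
    replace (z + h + - h) with z in T by ring. rewrite Cmod_opp in T. lra. }
  assert (Hn : z + h <> 0) by (intros E; rewrite E, Cmod_0 in Hzh; lra).
  replace (/ (z + h) - / z - - / (z * z) * h) with (h * h * / (z * z * (z + h))) by (field; auto).
  rewrite Cmod_mult, Cmod_inv by (repeat apply Cmult_neq_0; easy).
  rewrite !Cmod_mult.
  replace (2 / Cmod z ^ 3 * Cmod h ^ 2)%R with (Cmod h * Cmod h * (2 / Cmod z ^ 3))%R by ring.
  pose proof (Cmod_ge_0 h).
  apply Rmult_le_compat_l; [nra|].
  replace (2 / Cmod z ^ 3)%R with (/ (Cmod z * Cmod z * (Cmod z / 2)))%R by (field; lra).
  apply Rinv_le_contravar; [|apply Rmult_le_compat_l; nra].
  repeat apply Rmult_lt_0_compat; lra.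
Qed.

Lemma cderiv_Cexp (z : C) : cderiv Cexp z (Cexp z).
Proof.
  apply (cderiv_quadratic _ _ _ (Cmod (Cexp z) * (4 * exp 1))%R 1%R); [lra|].
  intros h Hh. rewrite Cexp_plus.
  replace (Cexp z * Cexp h - Cexp z - Cexp z * h) with (Cexp z * (Cexp h - 1 - h)) by ring.
  rewrite Cmod_mult, Rmult_assoc. apply Rmult_le_compat_l; [apply Cmod_ge_0|].
  eapply Rle_trans; [apply Cexp_taylor_2|].
  assert (exp (Cmod h) <= exp 1)%R by (apply exp_le_compat; lra).
  pose proof (pow2_ge_0 (Cmod h)). nra.
Qed.

Lemma cderiv_line (f : C -> C) (z v l : C) (t : R) :
  cderiv f (z + RtoC t * v)%C l ->
  is_derive (fun s => Re (f (z + RtoC s * v)%C)) t (Re (l * v)) /\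
  is_derive (fun s => Im (f (z + RtoC s * v)%C)) t (Im (l * v)).
Proof.
  intros H.
  assert (K : forall eps : R, (0 < eps)%R -> exists d : posreal, forall h : R, h <> 0%R ->
    (Rabs h < d)%R ->
    (Cmod (f (z + RtoC (t + h)%R * v)%C - f (z + RtoC t * v)%C - l * v * RtoC h) < eps * Rabs h)%R).
  { intros eps He. pose proof (Cmod_ge_0 v) as Hv.
    assert (He1 : (0 < eps / (1 + Cmod v))%R) by (apply Rdiv_lt_0_compat; lra).
    destruct (proj1 (cderiv_iff _ _ _) H _ He1) as [d [Hd H']].
    assert (Hd1 : (0 < d / (1 + Cmod v))%R) by (apply Rdiv_lt_0_compat; lra).
    exists (mkposreal _ Hd1). simpl. intros h Hh0 Hh.
    specialize (H' (RtoC h * v)). rewrite Cmod_mult, Cmod_R in H'.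
    pose proof (Rabs_pos_lt h Hh0) as Hp.
    replace (z + RtoC t * v + RtoC h * v) with (z + RtoC (t + h)%R * v) in H'
      by (rewrite RtoC_plus; ring).
    replace (l * v * RtoC h) with (l * (RtoC h * v)) by ring.
    eapply Rle_lt_trans; [apply H'|].
    - apply (Rmult_lt_compat_r (1 + Cmod v)) in Hh; [|lra].
      replace (d / (1 + Cmod v) * (1 + Cmod v))%R with d in Hh by (field; lra). nra.
    - replace (eps * Rabs h)%R with (eps / (1 + Cmod v) * (Rabs h * (1 + Cmod v)))%R by (field; lra).
      apply Rmult_lt_compat_l; [easy|]. nra. }
  split; apply is_derive_Reals; intros eps He; destruct (K eps He) as [d Hd]; exists d;
    intros h Hh0 Hh; specialize (Hd h Hh0 Hh); pose proof (Rabs_pos_lt h Hh0) as Hp;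
    apply (Rmult_lt_reg_r (Rabs h)); try easy; rewrite <- Rabs_mult;
    (eapply Rle_lt_trans; [|exact Hd]).
  - eapply Rle_trans; [|apply re_le_Cmod]. apply Req_le. f_equal.
    unfold Cminus. rewrite !re_plus, !re_opp, re_scal_r. field. easy.
  - eapply Rle_trans; [|apply Rabs_Im_le]. apply Req_le. f_equal.
    unfold Cminus. rewrite !im_plus, !im_opp, im_scal_r. field. easy.
Qed.

(** The upper half-plane is convex: the function is constant along the segment from
    [z] to [w], by the mean value theorem for its real and imaginary parts. *)
Lemma zero_deriv_const (f : C -> C) :
  (forall z, (0 < Im z)%R -> cderiv f z 0) ->
  forall z w, (0 < Im z)%R -> (0 < Im w)%R -> f z = f w.
Proof.
  intros H z w Hz Hw.
  assert (Hs : forall t, (0 <= t <= 1)%R -> cderiv f (z + RtoC t * (w - z)) 0).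
  { intros t Ht. apply H. rewrite im_plus, im_scal_l. unfold Cminus. rewrite im_plus, im_opp.
    destruct (Rle_lt_dec (Im z) (Im w)); nra. }
  assert (E : forall g : C -> R, (g 0 = 0%R) ->
    (forall t, (0 <= t <= 1)%R -> is_derive (fun s => g (f (z + RtoC s * (w - z))%C)) t 0%R) ->
    g (f z) = g (f w)).
  { intros g Hg0 Hg.
    replace z with (z + RtoC 0 * (w - z)) at 1 by ring.
    replace w with (z + RtoC 1 * (w - z)) at 2 by ring.
    apply (eq_is_derive (fun s => g (f (z + RtoC s * (w - z))%C))); [easy|lra]. }
  assert (E1 : Re (f z) = Re (f w)).
  { apply (E Re); [easy|]. intros t Ht. destruct (cderiv_line _ _ _ _ _ (Hs t Ht)) as [h _].
    replace 0%R with (Re (0 * (w - z))); [exact h|]. rewrite Cmult_0_l. easy. }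
  assert (E2 : Im (f z) = Im (f w)).
  { apply (E Im); [easy|]. intros t Ht. destruct (cderiv_line _ _ _ _ _ (Hs t Ht)) as [_ h].
    replace 0%R with (Im (0 * (w - z))); [exact h|]. rewrite Cmult_0_l. easy. }
  destruct (f z), (f w). simpl in *. congruence.
Qed.

(** * Exponential sums in the upper half-plane *)

Lemma nome_plus (a b : C) : nome (a + b) = nome a * nome b.
Proof. unfold nome. rewrite <- Cexp_plus. f_equal. ring. Qed.

Lemma Cmod_nome (z : C) : Cmod (nome z) = exp (- (2 * PI * Im z)).
Proof.
  unfold nome. rewrite Cmod_Cexp. f_equal.
  destruct z as [x y]. unfold RtoC, Ci, Cmult; simpl. ring.
Qed.

Lemma Cmod_nome_lt_1 (z : C) : (0 < Im z)%R -> (0 < Cmod (nome z) < 1)%R.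
Proof.
  intros H. rewrite Cmod_nome. split; [apply exp_pos|].
  rewrite <- exp_0. apply exp_increasing. pose proof PI_RGT_0. nra.
Qed.

Lemma nome_neq_0 (z : C) : nome z <> 0.
Proof. apply Cexp_neq_0. Qed.

Lemma nome_mul_nat (n : nat) (z : C) : nome (RtoC (INR n) * z) = nome z ^ n.
Proof. unfold nome. rewrite <- Cexp_nat. f_equal. ring. Qed.

Lemma nome_opp (z : C) : nome (- z) = / nome z.
Proof. unfold nome. rewrite <- Cexp_opp. f_equal. ring. Qed.

Lemma nome_0 : nome 0 = 1.
Proof. unfold nome. rewrite <- Cexp_0. f_equal. ring. Qed.

Lemma nome_1 : nome 1 = 1.
Proof.
  unfold nome, Cexp, RtoC, Ci, Cmult; simpl.
  match goal with |- context [exp ?x] => replace x with 0%R by ring end.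
  match goal with |- context [cos ?x] => replace x with (2 * PI)%R by ring end.
  rewrite exp_0, cos_2PI, sin_2PI. f_equal; ring.
Qed.

Lemma nome_add_1 (z : C) : nome (z + 1) = nome z.
Proof. rewrite nome_plus, nome_1. ring. Qed.

(** The value is chosen classically, and is arbitrary for a family without a sum. *)
Definition Csum {I : Type} (f : I -> C) : C := epsilon (inhabits (RtoC 0)) (has_sum f).

Lemma Csum_unique {I : Type} (f : I -> C) s : has_sum f s -> Csum f = s.
Proof.
  intros H. apply (has_sum_unique f); [|easy].
  apply (epsilon_spec (inhabits (RtoC 0)) (has_sum f)). eauto.
Qed.

Lemma Csum_correct {I : Type} (f : I -> C) (g : I -> R) :
  (forall i, (Cmod (f i) <= g i)%R) -> summable g -> has_sum f (Csum f).
Proof.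
  intros H Hg. apply (epsilon_spec (inhabits (RtoC 0)) (has_sum f)).
  eapply summable_has_sum; eassumption.
Qed.

Lemma has_sum_bound {I : Type} (f : I -> C) (g : I -> R) s M :
  has_sum f s -> (forall i, (Cmod (f i) <= g i)%R) ->
  (forall l, NoDup l -> (rsum g l <= M)%R) -> (Cmod s <= M)%R.
Proof.
  intros Hs Hf HM.
  assert (H : (Cmod (s - lsum f nil)%C <= M)%R).
  { apply (has_sum_tail f g s nil M Hs Hf); [constructor|intros r Hr; now apply HM]. }
  simpl in H. replace (s - 0) with s in H by ring. exact H.
Qed.

(** Absolute convergence of [sum b_i q^(n_i)] on the whole unit disc. The index type is
    arbitrary so that Lambert series can be handled as double sums. *)
Definition disc_summable {I : Type} (b : I -> C) (n : I -> nat) : Prop :=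
  forall r : R, (0 <= r < 1)%R -> summable (fun i => (Cmod (b i) * r ^ n i)%R).

Definition qsum {I : Type} (b : I -> C) (n : I -> nat) (tau : C) : C :=
  Csum (fun i => b i * nome tau ^ n i).

Section QSum.
Context {I : Type}.
Implicit Types (b : I -> C) (n : I -> nat).

Lemma qsum_correct b n tau :
  disc_summable b n -> (0 < Im tau)%R -> has_sum (fun i => b i * nome tau ^ n i) (qsum b n tau).
Proof.
  intros H Ht. apply (Csum_correct _ (fun i => (Cmod (b i) * Cmod (nome tau) ^ n i)%R)).
  - intros i. rewrite Cmod_mult, Cmod_pow. lra.
  - apply H. pose proof (Cmod_nome_lt_1 tau Ht). lra.
Qed.

(** A linear factor is absorbed by a slightly larger ratio. Derivatives of a series
    that converges on the disc therefore converge there too. *)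
Lemma linear_geometric_bound (r rho : R) (k : nat) :
  (0 <= r < rho)%R -> (INR k * (rho - r) * r ^ k <= rho ^ S k)%R.
Proof.
  intros H. induction k as [|k IH]; [simpl; lra|].
  rewrite S_INR.
  assert (P1 : (0 <= rho ^ S k)%R) by (apply pow_le; lra).
  assert (P2 : (r ^ S k <= rho ^ S k)%R) by (apply pow_incr; lra).
  replace ((INR k + 1) * (rho - r) * r ^ S k)%R
    with (r * (INR k * (rho - r) * r ^ k) + (rho - r) * r ^ S k)%R by (simpl; ring).
  replace (rho ^ S (S k))%R with (r * rho ^ S k + (rho - r) * rho ^ S k)%R by (simpl; ring).
  apply Rplus_le_compat; apply Rmult_le_compat_l; lra.
Qed.

Lemma disc_summable_mul b n :
  disc_summable b n -> disc_summable (fun i => RtoC (INR (n i)) * b i) n.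
Proof.
  intros H r Hr. set (rho := ((1 + r) / 2)%R).
  assert (Hrho : (r < rho < 1)%R) by (unfold rho; lra).
  apply (summable_le _ (fun i => (rho / (rho - r) * (Cmod (b i) * rho ^ n i))%R)).
  - intros i. rewrite Cmod_mult, Cmod_R, Rabs_pos_eq by apply pos_INR.
    pose proof (pos_INR (n i)). pose proof (Cmod_ge_0 (b i)).
    assert (0 <= r ^ n i)%R by (apply pow_le; lra).
    split; [repeat apply Rmult_le_pos; easy|].
    pose proof (linear_geometric_bound r rho (n i) ltac:(lra)) as L.
    apply (Rmult_le_reg_l (rho - r)); [lra|].
    replace ((rho - r) * (rho / (rho - r) * (Cmod (b i) * rho ^ n i)))%R
      with (Cmod (b i) * rho ^ S (n i))%R by (simpl; field; lra).
    replace ((rho - r) * (INR (n i) * Cmod (b i) * r ^ n i))%R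
      with (Cmod (b i) * (INR (n i) * (rho - r) * r ^ n i))%R by ring.
    now apply Rmult_le_compat_l.
  - apply summable_scal; [|apply H; lra].
    apply Rlt_le, Rdiv_lt_0_compat; lra.
Qed.

Lemma disc_summable_le b b' n :
  (forall i, (Cmod (b i) <= Cmod (b' i))%R) -> disc_summable b' n -> disc_summable b n.
Proof.
  intros Hb H r Hr. apply (summable_le _ _) with (2 := H r Hr). intros i.
  assert (0 <= r ^ n i)%R by (apply pow_le; lra). pose proof (Cmod_ge_0 (b i)).
  split; [now apply Rmult_le_pos|]. apply Rmult_le_compat_r; auto.
Qed.

(** Termwise differentiation: the second order remainders are dominated by a
    convergent series on the disc of half the distance to the real axis. *)
Lemma cderiv_qsum b n tau :
  disc_summable b n -> (0 < Im tau)%R ->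
  cderiv (qsum b n) tau
    (RtoC (2 * PI) * Ci * qsum (fun i => RtoC (INR (n i)) * b i) n tau).
Proof.
  intros H Ht.
  set (y := Im tau) in *. pose proof PI_RGT_0 as Hpi.
  set (r := exp (- (PI * y))).
  assert (Hr : (0 <= r < 1)%R).
  { unfold r. split; [left; apply exp_pos|]. rewrite <- exp_0. apply exp_increasing. nra. }
  pose proof (disc_summable_mul _ _ (disc_summable_mul _ _ H) r Hr) as [_ [M HM]].
  apply (cderiv_quadratic _ _ _ (4 * (2 * PI) ^ 2 * M)%R (y / 2)%R); [lra|].
  intros h Hh.
  assert (Hth : (0 < Im (tau + h))%R).
  { rewrite im_plus. fold y. pose proof (Rabs_Im_le h) as B. apply Rabs_le_between in B. lra. }
  pose proof (qsum_correct b n _ H Hth) as S1.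
  pose proof (qsum_correct b n _ H Ht) as S0.
  pose proof (qsum_correct _ n _ (disc_summable_mul _ _ H) Ht) as S2.
  pose proof (has_sum_minus _ _ _ _ (has_sum_minus _ _ _ _ S1 S0)
    (has_sum_scal (RtoC (2 * PI) * Ci * h) _ _ S2)) as S.
  replace (RtoC (2 * PI) * Ci * qsum (fun i => RtoC (INR (n i)) * b i) n tau * h)
    with (RtoC (2 * PI) * Ci * h * qsum (fun i => RtoC (INR (n i)) * b i) n tau) by ring.
  rewrite (Rmult_comm _ (Cmod h ^ 2)).
  rewrite <- Rmult_assoc.
  eapply (has_sum_bound _ _ _ _ S).
  2:{ intros l Hl. rewrite (rsum_scal (Cmod h ^ 2 * (4 * (2 * PI) ^ 2))).
      apply Rmult_le_compat_l; [|apply (HM l Hl)].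
      pose proof (pow2_ge_0 (Cmod h)). pose proof (pow2_ge_0 (2 * PI)). nra. }
  intros i. simpl.
  set (w := RtoC (INR (n i)) * (RtoC (2 * PI) * Ci * h)).
  assert (E : nome (tau + h) ^ n i = nome tau ^ n i * Cexp w).
  { rewrite nome_plus, Cpow_mult_l. f_equal. unfold w. now rewrite Cexp_nat. }
  rewrite E.
  replace (b i * (nome tau ^ n i * Cexp w) - b i * nome tau ^ n i
     - RtoC (2 * PI) * Ci * h * (RtoC (INR (n i)) * b i * nome tau ^ n i))
    with (b i * nome tau ^ n i * (Cexp w - 1 - w)) by (unfold w; ring).
  assert (Hw : Cmod w = (INR (n i) * (2 * PI * Cmod h))%R).
  { unfold w. rewrite !Cmod_mult, Cmod_Ci, !Cmod_R, !Rabs_pos_eq; try ring; [lra|apply pos_INR]. }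
  pose proof (Cexp_taylor_2 w) as T. rewrite Hw in T.
  set (N := INR (n i)) in *. assert (HN : (0 <= N)%R) by apply pos_INR.
  assert (Q : (Cmod (nome tau) ^ n i * exp (N * (2 * PI * Cmod h)) <= r ^ n i)%R).
  { rewrite Cmod_nome. fold y. unfold r.
    rewrite <- !Rpower_pow by apply exp_pos. unfold Rpower. rewrite !ln_exp, <- exp_plus.
    fold N. apply exp_le_compat.
    replace (N * - (2 * PI * y) + N * (2 * PI * Cmod h))%R
      with (N * (2 * PI * Cmod h - 2 * PI * y))%R by ring.
    apply Rmult_le_compat_l; [easy|]. nra. }
  pose proof (Cmod_ge_0 (b i)) as Hb.
  assert (P : (0 <= Cmod (nome tau) ^ n i)%R) by (apply pow_le, Cmod_ge_0).
  pose proof (Cmod_ge_0 h) as Hhh.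
  rewrite Cmod_mult. rewrite (Cmod_mult (b i)), Cmod_pow. rewrite (Cmod_mult _ (_ * b i)), (Cmod_mult _ (b i)), !Cmod_R, !(Rabs_pos_eq N) by exact HN.
  eapply Rle_trans.
  { apply Rmult_le_compat_l; [now apply Rmult_le_pos|exact T]. }
  replace (Cmod (b i) * Cmod (nome tau) ^ n i * (4 * (N * (2 * PI * Cmod h)) ^ 2 * exp (N * (2 * PI * Cmod h))))%R
    with (Cmod h * Cmod h * (4 * (2 * PI) ^ 2) * (N * (N * Cmod (b i)))
      * (Cmod (nome tau) ^ n i * exp (N * (2 * PI * Cmod h))))%R by ring.
  replace (Cmod h * (Cmod h * 1) * (4 * (2 * PI * (2 * PI * 1))) * (N * (N * Cmod (b i)) * r ^ n i))%R
    with (Cmod h * Cmod h * (4 * (2 * PI) ^ 2) * (N * (N * Cmod (b i))) * r ^ n i)%R by ring.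
  apply Rmult_le_compat_l; [|exact Q].
  pose proof (pow2_ge_0 (2 * PI)).
  apply Rmult_le_pos; [apply Rmult_le_pos; [nra|lra]|].
  apply Rmult_le_pos; [easy|now apply Rmult_le_pos].
Qed.

(** Decay at the cusp at infinity. *)
Lemma qsum_decay b n (r : R) :
  disc_summable b n -> (forall i, (1 <= n i)%nat) -> (0 < r < 1)%R ->
  exists K, (0 <= K)%R /\ forall tau, (0 < Im tau)%R -> (Cmod (nome tau) <= r)%R ->
    (Cmod (qsum b n tau) <= K * Cmod (nome tau))%R.
Proof.
  intros H Hn Hr. destruct (H r ltac:(lra)) as [P [M HM]].
  assert (HM0 : (0 <= M)%R) by (apply (HM nil); constructor).
  exists (M / r)%R. split; [apply Rmult_le_pos; [easy|left; apply Rinv_0_lt_compat; lra]|].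
  intros tau Ht Hq.
  pose proof (Cmod_ge_0 (nome tau)) as Hq0.
  replace (M / r * Cmod (nome tau))%R with (Cmod (nome tau) / r * M)%R by (field; lra).
  eapply (has_sum_bound _ _ _ _ (qsum_correct b n tau H Ht)).
  2:{ intros l Hl. rewrite (rsum_scal (Cmod (nome tau) / r) (fun i => (Cmod (b i) * r ^ n i)%R)).
      apply Rmult_le_compat_l; [|now apply HM].
      apply Rmult_le_pos; [easy|left; apply Rinv_0_lt_compat; lra]. }
  intros i. rewrite Cmod_mult, Cmod_pow. specialize (Hn i).
  destruct (n i) as [|k]; [lia|].
  replace (Cmod (nome tau) / r * (Cmod (b i) * r ^ S k))%R
    with (Cmod (b i) * (Cmod (nome tau) * r ^ k))%R by (simpl; field; lra).
  apply Rmult_le_compat_l; [apply Cmod_ge_0|]. simpl.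
  apply Rmult_le_compat_l; [easy|]. apply pow_incr. lra.
Qed.

End QSum.

(** * Partial fractions of the cotangent *)

Lemma Copp_involutive (z : C) : - - z = z.
Proof. ring. Qed.

Definition csin (z : C) : C := (Cexp (Ci * z) - Cexp (- (Ci * z))) / (2 * Ci).
Definition ccos (z : C) : C := (Cexp (Ci * z) + Cexp (- (Ci * z))) / 2.

Lemma Ci_sqr : Ci * Ci = - (1).
Proof. unfold Ci, RtoC, Cmult, Copp; simpl. f_equal; ring. Qed.

Lemma C2_neq_0 : RtoC 2 <> 0.
Proof. intros E. apply RtoC_inj in E. lra. Qed.

(** Discharges the nonvanishing side conditions of [field]. *)
Ltac nz :=
  repeat match goal with |- _ /\ _ => split end; try easy;
  try apply Ci_nz; try apply C2_neq_0; try apply Cexp_neq_0;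
  try (let E := fresh in intros E; apply RtoC_inj in E; lra).

Lemma Cexp_i_PI : Cexp (Ci * RtoC PI) = - (1).
Proof.
  unfold Cexp, Ci, RtoC, Cmult, Copp; simpl.
  match goal with |- context [exp ?x] => replace x with 0%R by ring end.
  match goal with |- context [cos ?x] => replace x with PI by ring end.
  rewrite exp_0, cos_PI, sin_PI. f_equal; ring.
Qed.

Lemma Cexp_i_PI2 : Cexp (Ci * RtoC (PI / 2)) = Ci.
Proof.
  unfold Cexp, Ci, RtoC, Cmult, Copp; simpl.
  match goal with |- context [exp ?x] => replace x with 0%R by ring end.
  match goal with |- context [cos ?x] => replace x with (PI / 2)%R by ring end.
  rewrite exp_0, cos_PI2, sin_PI2. f_equal; ring.
Qed.

Lemma csin_add_PI (z : C) : csin (z + RtoC PI) = - csin z.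
Proof.
  unfold csin. rewrite Cmult_plus_distr_l, !Cexp_opp, Cexp_plus, Cexp_i_PI.
  field. all: nz.
Qed.

Lemma ccos_add_PI (z : C) : ccos (z + RtoC PI) = - ccos z.
Proof.
  unfold ccos. rewrite Cmult_plus_distr_l, !Cexp_opp, Cexp_plus, Cexp_i_PI.
  field. all: nz.
Qed.

Lemma csin_add_PI2 (z : C) : csin (z + RtoC (PI / 2)) = ccos z.
Proof.
  unfold csin, ccos. rewrite Cmult_plus_distr_l, !Cexp_opp, Cexp_plus, Cexp_i_PI2.
  set (e := Cexp (Ci * z)). assert (He : e <> 0) by apply Cexp_neq_0.
  transitivity ((e * Ci * Ci - / e) / (2 * (Ci * Ci))).
  - field. all: nz.
  - replace (e * Ci * Ci) with (e * (Ci * Ci)) by ring. rewrite Ci_sqr. field. all: nz.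
Qed.

Lemma ccos_add_PI2 (z : C) : ccos (z + RtoC (PI / 2)) = - csin z.
Proof.
  rewrite <- csin_add_PI2, <- csin_add_PI, <- Cplus_assoc, <- RtoC_plus.
  now replace (PI / 2 + PI / 2)%R with PI by lra.
Qed.

Lemma csin_opp (z : C) : csin (- z) = - csin z.
Proof.
  unfold csin. replace (Ci * - z) with (- (Ci * z)) by ring.
  replace (- - (Ci * z)) with (Ci * z) by ring. field. all: nz.
Qed.

Lemma ccos_opp (z : C) : ccos (- z) = ccos z.
Proof.
  unfold ccos. replace (Ci * - z) with (- (Ci * z)) by ring.
  replace (- - (Ci * z)) with (Ci * z) by ring. field. all: nz.
Qed.

Lemma csin_plus (a b : C) : csin (a + b) = csin a * ccos b + ccos a * csin b.
Proof.
  unfold csin, ccos. rewrite Cmult_plus_distr_l, Copp_plus_distr, !Cexp_plus.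
  field. all: nz.
Qed.

Lemma csin_sqr_ccos_sqr (z : C) : csin z * csin z + ccos z * ccos z = 1.
Proof.
  unfold csin, ccos. rewrite !Cexp_opp.
  set (e := Cexp (Ci * z)). assert (He : e <> 0) by apply Cexp_neq_0.
  transitivity ((e - / e) * (e - / e) / (4 * (Ci * Ci)) + (e + / e) * (e + / e) / 4).
  - field. all: nz.
  - rewrite Ci_sqr. field. all: nz.
Qed.

Lemma csin_Re_Im (x y : R) : csin (x, y) = ((sin x * cosh y)%R, (cos x * sinh y)%R).
Proof.
  assert (E : (Cexp (Ci * (x, y)) - Cexp (- (Ci * (x, y)))) =
    2 * Ci * ((sin x * cosh y)%R, (cos x * sinh y)%R)).
  { unfold Cexp, cosh, sinh, Ci, RtoC, Cminus, Cplus, Copp, Cmult; simpl.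
    replace (0 * x - 1 * y)%R with (- y)%R by ring.
    replace (0 * y + 1 * x)%R with x by ring.
    rewrite Ropp_involutive, cos_neg, sin_neg. f_equal; field. }
  unfold csin. rewrite E. field. all: nz.
Qed.

Lemma sinh_ge (y : R) : (0 <= y)%R -> (y <= sinh y)%R.
Proof.
  intros Hy. destruct (MVT_gen sinh 0 y cosh) as [c [Hc E]].
  - intros x _. apply is_derive_Reals, derivable_pt_lim_sinh.
  - intros x _. apply derivable_continuous_pt, derivable_pt_sinh.
  - rewrite sinh_0 in E.
    assert (1 <= cosh c)%R; [|nra].
    unfold cosh. rewrite exp_Ropp. pose proof (exp_pos c).
    pose proof (Rle_0_sqr (exp c - 1)). unfold Rsqr in *.
    apply (Rmult_le_reg_l (2 * exp c)); [lra|].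
    replace (2 * exp c * ((exp c + / exp c) / 2))%R with (exp c * exp c + 1)%R by (field; lra).
    lra.
Qed.

Lemma sinh_sqr_ge (y : R) : (y * y <= sinh y * sinh y)%R.
Proof.
  destruct (Rle_lt_dec 0 y) as [H|H].
  - pose proof (sinh_ge y H). nra.
  - pose proof (sinh_ge (- y) ltac:(lra)) as B.
    replace (sinh (- y)) with (- sinh y)%R in B
      by (unfold sinh; rewrite Ropp_involutive; field).
    nra.
Qed.

Lemma sin_sqr_ge (x : R) : (Rabs x <= 2)%R -> (x * x / 16 <= sin x * sin x)%R.
Proof.
  assert (P : forall u, (0 <= u <= 2)%R -> (u / 4 <= sin u)%R).
  { intros u Hu. pose proof PI2_1.
    destruct (SIN u) as [L _]; [lra|lra|].
    eapply Rle_trans; [|exact L]. unfold sin_lb, sin_approx, sin_term. simpl.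
    assert (Hu2 : (0 <= u * u <= 4)%R) by nra.
    assert (HU : (u * (1 / 4) <= u * (1 - u * u / 6 + u * u * (u * u) / 120 - u * u * (u * u) * (u * u) / 5040))%R).
    { apply Rmult_le_compat_l; [lra|]. set (v := (u * u)%R) in *.
      assert (v * v * v <= 4 * (v * v))%R by nra. assert (0 <= v * v)%R by nra. lra. }
    lra. }
  intros Hx. apply Rabs_le_between in Hx. destruct (Rle_lt_dec 0 x) as [h|h].
  - pose proof (P x ltac:(lra)). nra.
  - pose proof (P (- x)%R ltac:(lra)) as B. rewrite sin_neg in B. nra.
Qed.

(** The squared modulus is [sin(x)^2 + sinh(y)^2], and [sin(x)] dominates [x / 4] on a strip
    slightly wider than a period. *)
Lemma csin_lower (z : C) : (Rabs (Re z) <= 2)%R -> (Cmod z <= 4 * Cmod (csin z))%R.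
Proof.
  destruct z as [x y]. simpl Re. intros Hx.
  apply Rsqr_incr_0; [| |]; try (pose proof (Cmod_ge_0 (csin (x, y))); lra); [|apply Cmod_ge_0].
  unfold Rsqr. pose proof (Cmod2_alt (x, y)) as E1. pose proof (Cmod2_alt (csin (x, y))) as E2.
  rewrite csin_Re_Im in *. simpl in E1, E2. rewrite !Rmult_1_r in *.
  rewrite E1. clear E1. set (c := Cmod ((sin x * cosh y)%R, (cos x * sinh y)%R)) in E2 |- *.
  replace (4 * c * (4 * c))%R with (16 * (c * c))%R by ring. rewrite E2.
  pose proof (sin_sqr_ge x Hx). pose proof (sinh_sqr_ge y).
  pose proof (sin2_cos2 x) as Hsc. unfold Rsqr in Hsc.
  assert (Hch : (cosh y * cosh y = 1 + sinh y * sinh y)%R).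
  { unfold cosh, sinh. rewrite exp_Ropp. pose proof (exp_pos y). field. lra. }
  replace (sin x * cosh y * (sin x * cosh y) + cos x * sinh y * (cos x * sinh y))%R
    with (sin x * sin x * (cosh y * cosh y) + cos x * cos x * (sinh y * sinh y))%R by ring.
  rewrite Hch.
  replace (sin x * sin x * (1 + sinh y * sinh y) + cos x * cos x * (sinh y * sinh y))%R
    with (sin x * sin x + (sin x * sin x + cos x * cos x) * (sinh y * sinh y))%R by ring.
  rewrite Hsc. nra.
Qed.

Lemma csin_neq_0 (z : C) : Im z <> 0%R -> csin z <> 0.
Proof.
  intros Hz E. unfold csin in E.
  assert (E' : Cexp (Ci * z) = Cexp (- (Ci * z))).
  { apply Ceq_minus. replace (Cexp (Ci * z) - Cexp (- (Ci * z)))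
      with ((Cexp (Ci * z) - Cexp (- (Ci * z))) / (2 * Ci) * (2 * Ci))
      by (field; nz). rewrite E. ring. }
  assert (E2 : exp (Re (Ci * z)) = exp (Re (- (Ci * z)))) by (rewrite <- !Cmod_Cexp; congruence).
  apply exp_inv in E2. rewrite re_opp in E2. apply Hz. destruct z as [x y]. simpl in *. lra.
Qed.

Lemma csin_linear (z : C) : (Cmod (csin z - z) <= 4 * Cmod z ^ 2 * exp (Cmod z))%R.
Proof.
  replace (csin z - z) with
    (((Cexp (Ci * z) - 1 - Ci * z) - (Cexp (- (Ci * z)) - 1 - - (Ci * z))) / (2 * Ci))
    by (unfold csin; field; nz).
  assert (H2 : 2 * Ci <> 0) by (apply Cmult_neq_0; [apply C2_neq_0|apply Ci_nz]).
  rewrite Cmod_div, Cmod_mult, Cmod_Ci, Cmod_R, Rabs_pos_eq by (easy || lra).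
  pose proof (Cexp_taylor_2 (Ci * z)) as A. pose proof (Cexp_taylor_2 (- (Ci * z))) as B.
  rewrite Cmod_opp in B. rewrite Cmod_mult, Cmod_Ci, Rmult_1_l in A, B.
  pose proof (Cmod_triangle (Cexp (Ci * z) - 1 - Ci * z) (- (Cexp (- (Ci * z)) - 1 - - (Ci * z)))) as T.
  rewrite Cmod_opp in T. unfold Cminus at 1. unfold Rdiv. lra.
Qed.

Lemma tendsto_comp {T : Type} {F : (T -> Prop) -> Prop} {FF : Filter F} (f : C -> C) u l m :
  cderiv f l m -> tendsto F u l -> tendsto F (fun k => f (u k)) (f l).
Proof.
  intros H Hu eps He. destruct (cderiv_lipschitz _ _ _ H) as [d [Hd B]].
  pose proof (Cmod_ge_0 m).
  assert (Hm : (0 < Rmin d (eps / (1 + Cmod m)))%R).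
  { apply Rmin_pos; [easy|]. apply Rdiv_lt_0_compat; lra. }
  generalize (Hu _ Hm). apply filter_imp. intros k hk.
  specialize (B (u k - l) (Rlt_le_trans _ _ _ hk (Rmin_l _ _))).
  replace (l + (u k - l)) with (u k) in B by ring.
  eapply Rle_lt_trans; [exact B|].
  pose proof (Rlt_le_trans _ _ _ hk (Rmin_r _ _)) as h2.
  apply (Rmult_lt_compat_l (1 + Cmod m)) in h2; [|lra].
  replace ((1 + Cmod m) * (eps / (1 + Cmod m)))%R with eps in h2 by (field; lra). easy.
Qed.

Lemma tendsto_inv {T : Type} {F : (T -> Prop) -> Prop} {FF : Filter F} u (l : C) :
  l <> 0 -> tendsto F u l -> tendsto F (fun k => / u k) (/ l).
Proof. intros Hl. apply (tendsto_comp Cinv _ _ _ (cderiv_inv l Hl)). Qed.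

Definition dyadic_angle (k : nat) : R := (PI / 2 ^ S k)%R.

Lemma dyadic_angle_pos k : (0 < dyadic_angle k)%R.
Proof. apply Rdiv_lt_0_compat; [apply PI_RGT_0|apply pow_lt; lra]. Qed.

Lemma dyadic_angle_small (d : R) : (0 < d)%R -> eventually (fun k => (dyadic_angle k < d)%R).
Proof.
  intros Hd.
  destruct (nfloor_ex (4 / d)%R) as [N [_ HN]]; [left; apply Rdiv_lt_0_compat; lra|].
  exists N. intros k Hk. unfold dyadic_angle.
  assert (B : (INR (S k) <= 2 ^ S k)%R).
  { generalize (S k). clear. intros k. induction k as [|k IH]; [simpl; lra|].
    rewrite S_INR. pose proof (pow_R1_Rle 2 k ltac:(lra)). simpl pow. lra. }
  apply le_INR in Hk. rewrite S_INR in B.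
  assert (P : (0 < 2 ^ S k)%R) by (apply pow_lt; lra).
  pose proof PI_4.
  apply (Rmult_lt_reg_r (2 ^ S k)); [easy|].
  replace (PI / 2 ^ S k * 2 ^ S k)%R with PI by (field; lra).
  assert (4 < d * (INR N + 1))%R.
  { apply (Rmult_lt_compat_l d) in HN; [|easy].
    replace (d * (4 / d))%R with 4%R in HN by (field; lra). easy. }
  nra.
Qed.

(** The ratio tends to that of the derivatives at 0. *)
Lemma tendsto_csin_ratio (a : C) : a <> 0 ->
  tendsto eventually (fun k => RtoC (dyadic_angle k) / csin (RtoC (dyadic_angle k) * a)) (/ a).
Proof.
  intros Ha.
  assert (L : tendsto eventually
    (fun k => csin (RtoC (dyadic_angle k) * a) / RtoC (dyadic_angle k)) a).
  { assert (L0 : tendsto eventually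
      (fun k => csin (RtoC (dyadic_angle k) * a) / RtoC (dyadic_angle k) - a) 0).
    { set (K := (4 * Cmod a ^ 2 * exp (Cmod a))%R).
      assert (HK : (0 <= K)%R).
      { pose proof (pow2_ge_0 (Cmod a)). pose proof (exp_pos (Cmod a)). unfold K. nra. }
      apply (tendsto_le_0 _ (fun k => (dyadic_angle k * K)%R)).
      - generalize (dyadic_angle_small 1 Rlt_0_1). apply filter_imp. intros k Hk.
        pose proof (dyadic_angle_pos k) as Hp. set (t := dyadic_angle k) in *.
        assert (Ht : RtoC t <> 0) by (intros E; apply RtoC_inj in E; lra).
        replace (csin (RtoC t * a) / RtoC t - a) with ((csin (RtoC t * a) - RtoC t * a) / RtoC t)
          by (field; easy).
        rewrite Cmod_div, Cmod_R, Rabs_pos_eq by (easy || lra).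
        pose proof (csin_linear (RtoC t * a)) as B.
        rewrite Cmod_mult, Cmod_R, Rabs_pos_eq in B by lra.
        apply (Rmult_le_reg_r t); [easy|].
        unfold Rdiv. rewrite Rmult_assoc, Rinv_l, Rmult_1_r by lra.
        eapply Rle_trans; [exact B|].
        replace (t * K * t)%R with (4 * (t * Cmod a) ^ 2 * exp (Cmod a))%R by (unfold K; ring).
        apply Rmult_le_compat_l; [pose proof (pow2_ge_0 (t * Cmod a)); lra|].
        apply exp_le_compat. pose proof (Cmod_ge_0 a). nra.
      - intros eps He.
        assert (Hd : (0 < eps / (1 + K))%R) by (apply Rdiv_lt_0_compat; lra).
        generalize (dyadic_angle_small _ Hd). apply filter_imp. intros k Hk.
        apply (Rmult_lt_compat_r (1 + K)) in Hk; [|lra].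
        replace (eps / (1 + K) * (1 + K))%R with eps in Hk by (field; lra).
        pose proof (dyadic_angle_pos k). nra. }
    pose proof (tendsto_plus _ _ _ _ L0 (tendsto_const a)) as L1.
    replace (0 + a) with a in L1 by ring. revert L1. apply tendsto_ext. intros k. simpl. ring. }
  pose proof (tendsto_inv _ _ Ha L) as L'. revert L'. apply tendsto_ext_loc.
  (* near the limit the quotient is nonzero, so its sine is nonzero and [field] applies *)
  generalize (L (Cmod a / 2)%R (Rdiv_lt_0_compat _ _ (proj1 (Cmod_gt_0 a) Ha) Rlt_0_2)).
  apply filter_imp. intros k Hk.
  pose proof (dyadic_angle_pos k) as Hp.
  assert (Ht : RtoC (dyadic_angle k) <> 0) by (intros E; apply RtoC_inj in E; lra).
  assert (Hs : csin (RtoC (dyadic_angle k) * a) <> 0).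
  { intros E. rewrite E in Hk. replace (0 / RtoC (dyadic_angle k) - a) with (- a) in Hk by (field; easy).
    rewrite Cmod_opp in Hk. pose proof (Cmod_ge_0 a). lra. }
  field. auto.
Qed.

(** A system of representatives modulo [2^(k+1)] centred at 0, so that it exhausts [Z]
    while the division points stay in the strip where [csin_lower] applies. *)
Definition dyadic_range (k : nat) : list Z :=
  map (fun i => (Z.of_nat i - 2 ^ Z.of_nat k)%Z) (seq 0 (2 ^ S k)).

Lemma NoDup_dyadic_range k : NoDup (dyadic_range k).
Proof. apply NoDup_map_inj; [intros x y; lia|apply seq_NoDup]. Qed.

Lemma two_pow_Z k : Z.of_nat (2 ^ k) = (2 ^ Z.of_nat k)%Z.
Proof. rewrite Nat2Z.inj_pow. reflexivity. Qed.

Lemma in_dyadic_range k j :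
  In j (dyadic_range k) <-> (- 2 ^ Z.of_nat k <= j < 2 ^ Z.of_nat k)%Z.
Proof.
  assert (E : Z.of_nat (2 ^ S k) = (2 * 2 ^ Z.of_nat k)%Z).
  { rewrite two_pow_Z, Nat2Z.inj_succ, Z.pow_succ_r; lia. }
  unfold dyadic_range. rewrite in_map_iff. split.
  - intros [i [<- Hi]]. apply in_seq in Hi. lia.
  - intros H. exists (Z.to_nat (j + 2 ^ Z.of_nat k)). split; [lia|]. apply in_seq. lia.
Qed.

Lemma dyadic_range_exhausts (j : Z) : eventually (fun k => In j (dyadic_range k)).
Proof.
  exists (Z.to_nat (Z.abs j) + 1)%nat. intros k Hk. apply in_dyadic_range.
  assert (Z.of_nat k < 2 ^ Z.of_nat k)%Z by (apply Z.pow_gt_lin_r; lia). lia.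
Qed.

Lemma IZR_two_pow k : IZR (2 ^ Z.of_nat k) = (2 ^ k)%R.
Proof. symmetry. apply pow_IZR. Qed.

Lemma seq_shift_add (m s n : nat) : map (fun i => (i + m)%nat) (seq s n) = seq (s + m) n.
Proof. revert s. induction n as [|n IH]; intros s; simpl; [easy|]. f_equal. apply IH. Qed.

(** Any function with period [PI] and a duplication formula telescopes over the
    dyadic division points of its period. *)
Lemma dyadic_distribution (g : C -> C) (c : C) :
  (forall a, csin (2 * a) <> 0 -> g a + g (a + RtoC (PI / 2)) = c * g (2 * a)) ->
  (forall a, g (a + RtoC PI) = g a) ->
  forall w k, csin (RtoC PI * w) <> 0 ->
  lsum (fun j => g (RtoC (dyadic_angle k) * (w + RtoC (IZR j)))) (dyadic_range k)
  = c ^ S k * g (RtoC PI * w).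
Proof.
  intros Hg Hp.
  assert (Hd : forall k b, csin (2 ^ k * b) <> 0 -> csin b <> 0).
  { induction k as [|k IH]; intros b Hb.
    - simpl in Hb. now rewrite Cmult_1_l in Hb.
    - apply IH. intros E. apply Hb. rewrite Cpow_S.
      replace (2 * 2 ^ k * b) with (2 ^ k * b + 2 ^ k * b) by ring.
      rewrite csin_plus, E. ring. }
  assert (Hi : forall i w, csin (RtoC PI * w) <> 0 -> csin (RtoC PI * (w + RtoC (INR i))) <> 0).
  { induction i as [|i IH]; intros w Hw.
    - simpl. now rewrite Cplus_0_r.
    - rewrite S_INR, RtoC_plus.
      replace (RtoC PI * (w + (RtoC (INR i) + 1))) with (RtoC PI * (w + RtoC (INR i)) + RtoC PI) by ring.
      rewrite csin_add_PI. intros E. apply (IH w Hw).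
      rewrite <- (Copp_involutive (csin _)), E. ring. }
  assert (S1 : forall k w, csin (RtoC PI * w) <> 0 ->
    lsum (fun i => g (RtoC (PI / 2 ^ k)%R * (w + RtoC (INR i)))) (seq 0 (2 ^ k)) = c ^ k * g (RtoC PI * w)).
  { induction k as [|k IH]; intros w Hw.
    - simpl. replace (PI / 1)%R with PI by field. rewrite !Cplus_0_r. ring.
    - replace (2 ^ S k)%nat with (2 ^ k + 2 ^ k)%nat by (simpl; lia).
      rewrite seq_app, lsum_app. simpl (0 + 2 ^ k)%nat.
      replace (seq (2 ^ k) (2 ^ k)) with (map (fun i => (i + 2 ^ k)%nat) (seq 0 (2 ^ k)))
        by apply (seq_shift_add (2 ^ k) 0 (2 ^ k)).
      rewrite lsum_map, <- lsum_plus.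
      assert (P : (0 < 2 ^ k)%R) by (apply pow_lt; lra).
      assert (P2 : RtoC (2 ^ k) <> 0) by (intros E; apply RtoC_inj in E; lra).
      transitivity (lsum (fun i => c * g (RtoC (PI / 2 ^ k)%R * (w + RtoC (INR i)))) (seq 0 (2 ^ k))).
      + apply lsum_ext. intros i _.
        replace (RtoC (PI / 2 ^ S k)%R * (w + RtoC (INR (i + 2 ^ k))))
          with (RtoC (PI / 2 ^ S k)%R * (w + RtoC (INR i)) + RtoC (PI / 2)).
        2:{ rewrite plus_INR, pow_INR. simpl (INR 2).
            replace (PI / 2)%R with (PI / 2 ^ S k * 2 ^ k)%R by (simpl; field; lra).
            rewrite (RtoC_plus (INR i)), (RtoC_mult (PI / 2 ^ S k)).
            replace (1 + 1)%R with 2%R by ring. ring. }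
        assert (E2 : 2 * (RtoC (PI / 2 ^ S k)%R * (w + RtoC (INR i)))
          = RtoC (PI / 2 ^ k)%R * (w + RtoC (INR i))).
        { replace (PI / 2 ^ k)%R with (2 * (PI / 2 ^ S k))%R by (simpl; field; lra).
          rewrite (RtoC_mult 2). ring. }
        rewrite Hg, E2; [easy|]. rewrite E2. apply (Hd k).
        replace (2 ^ k * (RtoC (PI / 2 ^ k)%R * (w + RtoC (INR i))))
          with (RtoC PI * (w + RtoC (INR i))); [now apply Hi|].
        rewrite RtoC_div, <- !RtoC_pow by lra. field. easy.
      + rewrite lsum_scal, IH by easy. simpl. ring. }
  assert (Hpn : forall n a, g (a - RtoC (INR n) * RtoC PI) = g a).
  { induction n as [|n IH]; intros a.
    - simpl. f_equal. ring.
    - rewrite <- (IH a), <- (Hp (a - _)). f_equal. rewrite S_INR, RtoC_plus. ring. }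
  assert (Hm : forall n w, csin (RtoC PI * w) <> 0 -> csin (RtoC PI * (w - RtoC (INR n))) <> 0).
  { induction n as [|n IH]; intros w Hw.
    - simpl. replace (w - 0) with w by ring. easy.
    - intros E. apply (IH w Hw).
      replace (RtoC PI * (w - RtoC (INR n))) with (RtoC PI * (w - RtoC (INR (S n))) + RtoC PI)
        by (rewrite S_INR, RtoC_plus; ring).
      rewrite csin_add_PI, E. ring. }
  intros w k Hw. unfold dyadic_range. rewrite lsum_map.
  transitivity (c ^ S k * g (RtoC PI * (w - RtoC (INR (2 ^ k))))).
  - rewrite <- S1 by now apply Hm.
    apply lsum_ext. intros i _. f_equal. unfold dyadic_angle. f_equal.
    rewrite minus_IZR, <- two_pow_Z, <- !INR_IZR_INZ, RtoC_minus. ring.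
  - f_equal. rewrite <- (Hpn (2 ^ k)%nat (RtoC PI * w)). f_equal. ring.
Qed.

(** Quadratic growth is what makes the series of [1 / (w + j)^2] converge absolutely. *)
Definition separated (w : C) (c : R) : Prop :=
  (0 < c)%R /\ forall j : Z, (c * (1 + IZR j * IZR j) <= Cmod (w + RtoC (IZR j)) ^ 2)%R.

(** A positive definite quadratic form dominates a multiple of [x^2 + y^2]. *)
Lemma lattice_lower_bound (tau : C) : Im tau <> 0%R ->
  exists c, (0 < c)%R /\ forall x y : R,
    (c * (x * x + y * y) <= Cmod (RtoC x * tau + RtoC y) ^ 2)%R.
Proof.
  intros Hv. destruct tau as [u v]. simpl in Hv.
  assert (Hs : (0 < 1 + u * u + v * v)%R) by nra.
  assert (Hvv : (0 < v * v)%R) by nra.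
  exists (v * v / (1 + u * u + v * v))%R. split; [now apply Rdiv_lt_0_compat|].
  intros x y. rewrite Cmod2_alt.
  replace (Re (RtoC x * (u, v) + RtoC y)) with (x * u + y)%R by (unfold RtoC; simpl; ring).
  replace (Im (RtoC x * (u, v) + RtoC y)) with (x * v)%R by (unfold RtoC; simpl; ring).
  apply (Rmult_le_reg_l (1 + u * u + v * v)); [easy|].
  replace ((1 + u * u + v * v) * (v * v / (1 + u * u + v * v) * (x * x + y * y)))%R
    with (v * v * (x * x + y * y))%R by (field; lra).
  apply Rminus_le_0.
  assert (Hk : (0 < 1 + u * u)%R) by nra.
  apply (Rmult_le_reg_l (1 + u * u)); [easy|]. rewrite Rmult_0_r.
  (* completing the square in y *)
  replace ((1 + u * u) * ((1 + u * u + v * v) * ((x * u + y) ^ 2 + (x * v) ^ 2) - v * v * (x * x + y * y)))%R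
    with (((1 + u * u) * y + x * u * (1 + u * u + v * v)) ^ 2 + (x * (v * v)) ^ 2)%R by ring.
  apply Rplus_le_le_0_compat; apply pow2_ge_0.
Qed.

Lemma nonreal_separated (w : C) : Im w <> 0%R -> exists c, separated w c.
Proof.
  intros H. destruct (lattice_lower_bound w H) as [c [Hc B]]. exists c. split; [easy|].
  intros j. specialize (B 1%R (IZR j)). rewrite Cmult_1_l in B. lra.
Qed.

Lemma half_integer_sqr_ge (j : Z) : ((1 + IZR j * IZR j) / 16 <= (IZR j + 1 / 2) * (IZR j + 1 / 2))%R.
Proof.
  assert (H : (0 <= 15 * (j * j) + 16 * j + 3)%Z).
  { assert (0 <= j * (j + 1))%Z by (destruct (Z_le_gt_dec 0 j); nia).
    destruct (Z_le_gt_dec (-3) j); nia. }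
  apply IZR_le in H. rewrite !plus_IZR, !mult_IZR in H. lra.
Qed.

Lemma half_separated : separated (RtoC (1 / 2)) (1 / 16).
Proof.
  split; [lra|]. intros j. rewrite <- RtoC_plus, Cmod_R, <- Rsqr_pow2, <- Rsqr_abs.
  unfold Rsqr. pose proof (half_integer_sqr_ge j). lra.
Qed.

Lemma separated_neq_0 w c j : separated w c -> w + RtoC (IZR j) <> 0.
Proof.
  intros [Hc H] E. specialize (H j). rewrite E, Cmod_0 in H. simpl in H. nra.
Qed.

Lemma summable_Z (g : Z -> R) : (forall j, (0 <= g j)%R) ->
  summable (fun n => g (Z.of_nat n)) -> summable (fun n => g (- Z.of_nat n)%Z) -> summable g.
Proof.
  intros P [_ [M HM]] [_ [M' HM']]. split; [easy|]. exists (M + M')%R. intros l Hl.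
  destruct (NoDup_nat_bound (map Z.abs_nat l)) as [n Hn].
  eapply Rle_trans; [apply (rsum_incl g l (map Z.of_nat (seq 0 (S n)) ++ map (fun i => (- Z.of_nat i)%Z) (seq 0 (S n)))); auto|].
  - intros j Hj. assert (Hi : In (Z.abs_nat j) (seq 0 (S n))) by (apply Hn, in_map; easy).
    apply in_app_iff. destruct (Z_le_gt_dec 0 j).
    + left. replace j with (Z.of_nat (Z.abs_nat j)) by lia. now apply in_map.
    + right. replace j with (- Z.of_nat (Z.abs_nat j))%Z by lia.
      now apply (in_map (fun i => (- Z.of_nat i)%Z)).
  - rewrite rsum_app, !rsum_map.
    apply Rplus_le_compat; [apply HM|apply HM']; apply seq_NoDup.
Qed.

Lemma summable_inv_sqr_nat : summable (fun n : nat => (/ (1 + INR n * INR n))%R).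
Proof.
  assert (P : forall n : nat, (0 < 1 + INR n * INR n)%R) by (intros n; nra).
  split; [intros n; left; apply Rinv_0_lt_compat, P|]. exists 3%R. intros l Hl.
  destruct (NoDup_nat_bound l) as [n Hn].
  eapply Rle_trans; [apply (rsum_incl _ l _ (fun n => Rlt_le _ _ (Rinv_0_lt_compat _ (P n))) Hl Hn)|].
  apply Rle_trans with (3 - 2 / INR (S n))%R.
  2:{ assert (0 < 2 / INR (S n))%R; [|lra]. apply Rdiv_lt_0_compat; [lra|]. apply lt_0_INR. lia. }
  clear. induction n as [|n IH]; [simpl; lra|].
  rewrite seq_S, rsum_app. simpl (0 + S n)%nat. unfold rsum at 2; cbn [fold_right].
  replace (3 - 2 / INR (S (S n)))%R
    with ((3 - 2 / INR (S n)) + (2 / INR (S n) - 2 / INR (S (S n))))%R by ring.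
  apply Rplus_le_compat; [exact IH|]. rewrite Rplus_0_r.
  rewrite !S_INR. set (x := INR n). assert (Hx : (0 <= x)%R) by apply pos_INR.
  replace (2 / (x + 1) - 2 / (x + 1 + 1))%R with (2 * / ((x + 1) * (x + 1 + 1)))%R by (field; lra).
  replace (/ (1 + (x + 1) * (x + 1)))%R with (2 * / (2 * (1 + (x + 1) * (x + 1))))%R by (field; nra).
  apply Rmult_le_compat_l; [lra|]. apply Rinv_le_contravar; nra.
Qed.

Lemma summable_inv_sqr_Z : summable (fun j : Z => (/ (1 + IZR j * IZR j))%R).
Proof.
  apply summable_Z.
  - intros j. left. apply Rinv_0_lt_compat. nra.
  - apply (summable_le _ _) with (2 := summable_inv_sqr_nat). intros n. rewrite INR_IZR_INZ.
    split; [left; apply Rinv_0_lt_compat; nra|lra].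
  - apply (summable_le _ _) with (2 := summable_inv_sqr_nat). intros n. rewrite INR_IZR_INZ, opp_IZR.
    replace (1 + - IZR (Z.of_nat n) * - IZR (Z.of_nat n))%R
      with (1 + IZR (Z.of_nat n) * IZR (Z.of_nat n))%R by ring.
    split; [left; apply Rinv_0_lt_compat; nra|lra].
Qed.

Lemma inv_product_bound (a b c c' u : R) :
  (0 < c)%R -> (0 < c')%R -> (0 < u)%R -> (0 < a)%R -> (0 < b)%R ->
  (c * u <= a ^ 2)%R -> (c' * u <= b ^ 2)%R ->
  (/ (a * b) <= (/ c + / c') * / u)%R.
Proof.
  intros Hc Hc' Hu Ha Hb H H'.
  assert (A : (/ a ^ 2 <= / (c * u))%R) by (apply Rinv_le_contravar; [nra|easy]).
  assert (B : (/ b ^ 2 <= / (c' * u))%R) by (apply Rinv_le_contravar; [nra|easy]).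
  rewrite Rinv_mult in A, B. rewrite Rmult_plus_distr_r.
  assert (S : (/ (a * b) <= / a ^ 2 + / b ^ 2)%R).
  { rewrite Rinv_mult, <- !pow_inv.
    pose proof (Rinv_0_lt_compat _ Ha). pose proof (Rinv_0_lt_compat _ Hb).
    simpl. pose proof (Rle_0_sqr (/ a - / b)). unfold Rsqr in *. nra. }
  lra.
Qed.

Lemma summable_separated w w' c c' : separated w c -> separated w' c' ->
  summable (fun j : Z => Cmod (/ ((w + RtoC (IZR j)) * (w' + RtoC (IZR j))))).
Proof.
  intros S S'. pose proof S as [Hc H]. pose proof S' as [Hc' H'].
  apply (summable_le _ (fun j => ((/ c + / c') * / (1 + IZR j * IZR j))%R)).
  - intros j. split; [apply Cmod_ge_0|].
    assert (A : w + RtoC (IZR j) <> 0) by (eapply separated_neq_0; eauto).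
    assert (B : w' + RtoC (IZR j) <> 0) by (eapply separated_neq_0; eauto).
    rewrite Cmod_inv, Cmod_mult by (apply Cmult_neq_0; easy).
    apply inv_product_bound; auto; try (apply Cmod_gt_0; easy). nra.
  - apply summable_scal; [|apply summable_inv_sqr_Z].
    pose proof (Rinv_0_lt_compat _ Hc). pose proof (Rinv_0_lt_compat _ Hc'). lra.
Qed.

Lemma PI_le : (PI <= 3.24)%R.
Proof.
  destruct (PI_2_3_7_ineq 0) as [_ H]. simpl in H.
  unfold tg_alt, PI_2_3_7_tg, Ratan_seq in H. simpl in H. lra.
Qed.

Lemma dyadic_window (w : C) :
  eventually (fun k => forall j, In j (dyadic_range k) ->
    (Rabs (Re (RtoC (dyadic_angle k) * (w + RtoC (IZR j)))) <= 2)%R).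
Proof.
  pose proof (Rabs_pos (Re w)) as Hw.
  assert (Hd : (0 < 0.38 / (1 + Rabs (Re w)))%R) by (apply Rdiv_lt_0_compat; lra).
  generalize (dyadic_angle_small _ Hd). apply filter_imp. intros k Hk j Hj.
  apply in_dyadic_range in Hj. destruct Hj as [Hj1 Hj2]. apply Z.lt_le_incl in Hj2.
  apply IZR_le in Hj1. apply IZR_le in Hj2. rewrite opp_IZR in Hj1. rewrite IZR_two_pow in *.
  rewrite re_scal_l, re_plus. simpl (Re (RtoC _)).
  set (t := dyadic_angle k) in *. assert (Ht : (0 < t)%R) by apply dyadic_angle_pos.
  assert (E : (t * 2 ^ k = PI / 2)%R).
  { unfold t, dyadic_angle. simpl. field. apply pow_nonzero. lra. }
  assert (T1 : (t * Rabs (Re w) <= 0.38)%R).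
  { apply (Rmult_lt_compat_r (1 + Rabs (Re w))) in Hk; [|lra].
    replace (0.38 / (1 + Rabs (Re w)) * (1 + Rabs (Re w)))%R with 0.38%R in Hk by (field; lra). nra. }
  assert (T2 : (Rabs (t * IZR j) <= PI / 2)%R) by (apply Rabs_le; nra).
  rewrite Rmult_plus_distr_l. eapply Rle_trans; [apply Rabs_triang|].
  rewrite Rabs_mult, (Rabs_pos_eq t) by lra. pose proof PI_le. lra.
Qed.

(** The scaled division values converge to the terms of the series and are dominated
    by them, so the finite sums converge to the sum of the series. *)
Lemma partial_fractions_core w w' c c' (P : C) :
  separated w c -> separated w' c' ->
  tendsto eventually (fun k => lsum (fun j =>
    RtoC (dyadic_angle k) / csin (RtoC (dyadic_angle k) * (w + RtoC (IZR j))) *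
    (RtoC (dyadic_angle k) / csin (RtoC (dyadic_angle k) * (w' + RtoC (IZR j)))))
    (dyadic_range k)) P ->
  has_sum (fun j : Z => / ((w + RtoC (IZR j)) * (w' + RtoC (IZR j)))) P.
Proof.
  intros S S' L. pose proof S as [Hc H]. pose proof S' as [Hc' H'].
  pose proof (summable_separated _ _ _ _ S S') as Hsum.
  destruct (summable_has_sum _ _ (fun j => Rle_refl _) Hsum) as [s Hs].
  enough (EP : s = P) by (rewrite <- EP; exact Hs).
  set (u := fun k j => if in_dec Z.eq_dec j (dyadic_range k) then
    RtoC (dyadic_angle k) / csin (RtoC (dyadic_angle k) * (w + RtoC (IZR j))) *
    (RtoC (dyadic_angle k) / csin (RtoC (dyadic_angle k) * (w' + RtoC (IZR j)))) else 0).
  refine (tendsto_unique (F := eventually) _ s P _ L).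
  apply (has_sum_tannery (F := eventually) u (fun j => / ((w + RtoC (IZR j)) * (w' + RtoC (IZR j)))) (fun j => (16 * Cmod (/ ((w + RtoC (IZR j)) * (w' + RtoC (IZR j)))))%R) _ s).
  - apply summable_scal; [lra|easy].
  - generalize (filter_and _ _ (dyadic_window w) (dyadic_window w')). apply filter_imp.
    intros k [W W'] j. unfold u. destruct (in_dec Z.eq_dec j (dyadic_range k)) as [Hj|_].
    2:{ rewrite Cmod_0. apply Rmult_le_pos; [lra|apply Cmod_ge_0]. }
    specialize (W j Hj). specialize (W' j Hj).
    set (t := dyadic_angle k) in *. assert (Ht : (0 < t)%R) by apply dyadic_angle_pos.
    assert (B : forall v : C, v <> 0 -> (Rabs (Re (RtoC t * v)) <= 2)%R ->
      (Cmod (RtoC t / csin (RtoC t * v)) <= 4 * / Cmod v)%R).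
    { intros v Hv Hr. pose proof (csin_lower _ Hr) as Lo.
      rewrite Cmod_mult, Cmod_R, Rabs_pos_eq in Lo by lra.
      assert (Hvp : (0 < Cmod v)%R) by (apply Cmod_gt_0; easy).
      assert (Hs0 : (0 < Cmod (csin (RtoC t * v)))%R) by nra.
      assert (Hsn : csin (RtoC t * v) <> 0) by (apply Cmod_gt_0; exact Hs0).
      rewrite Cmod_div, Cmod_R, (Rabs_pos_eq t) by (exact Hsn || lra).
      apply (Rmult_le_reg_r (Cmod (csin (RtoC t * v)))); [easy|].
      apply (Rmult_le_reg_r (Cmod v)); [easy|].
      replace (t / Cmod (csin (RtoC t * v)) * Cmod (csin (RtoC t * v)) * Cmod v)%R
        with (t * Cmod v)%R by (field; lra).
      replace (4 * / Cmod v * Cmod (csin (RtoC t * v)) * Cmod v)%R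
        with (4 * Cmod (csin (RtoC t * v)))%R by (field; lra). easy. }
    assert (A1 : w + RtoC (IZR j) <> 0) by (eapply separated_neq_0; eauto).
    assert (A2 : w' + RtoC (IZR j) <> 0) by (eapply separated_neq_0; eauto).
    rewrite Cmod_mult, Cmod_inv, (Cmod_mult (w + _)) by (apply Cmult_neq_0; easy).
    rewrite Rinv_mult.
    replace (16 * (/ Cmod (w + RtoC (IZR j)) * / Cmod (w' + RtoC (IZR j))))%R
      with ((4 * / Cmod (w + RtoC (IZR j))) * (4 * / Cmod (w' + RtoC (IZR j))))%R by ring.
    apply Rmult_le_compat; try apply Cmod_ge_0; apply B; easy.
  - intros j. pose proof (Cmod_ge_0 (/ ((w + RtoC (IZR j)) * (w' + RtoC (IZR j))))). lra.
  - intros j.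
    assert (A1 : w + RtoC (IZR j) <> 0) by (eapply separated_neq_0; eauto).
    assert (A2 : w' + RtoC (IZR j) <> 0) by (eapply separated_neq_0; eauto).
    replace (/ ((w + RtoC (IZR j)) * (w' + RtoC (IZR j))))
      with (/ (w + RtoC (IZR j)) * / (w' + RtoC (IZR j))) by (field; auto).
    pose proof (tendsto_mult _ _ _ _ (tendsto_csin_ratio _ A1) (tendsto_csin_ratio _ A2)) as L1.
    revert L1. apply tendsto_ext_loc.
    generalize (dyadic_range_exhausts j). apply filter_imp. intros k Hk. unfold u.
    destruct (in_dec Z.eq_dec j (dyadic_range k)); easy.
  - apply filter_forall. intros k.
    match goal with |- has_sum _ (lsum ?f _) => rewrite (lsum_ext f (u k)) end.
    + apply has_sum_finite; [apply NoDup_dyadic_range|]. intros j Hj. unfold u.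
      destruct (in_dec Z.eq_dec j (dyadic_range k)); easy.
    + intros j Hj. unfold u. destruct (in_dec Z.eq_dec j (dyadic_range k)); easy.
  - exact Hs.
Qed.

Definition ccot (z : C) : C := ccos z / csin z.

Lemma ccot_distribution w k : csin (RtoC PI * w) <> 0 ->
  lsum (fun j => ccot (RtoC (dyadic_angle k) * (w + RtoC (IZR j)))) (dyadic_range k)
  = 2 ^ S k * ccot (RtoC PI * w).
Proof.
  apply (dyadic_distribution ccot 2).
  - intros a Ha. unfold ccot. rewrite ccos_add_PI2, csin_add_PI2.
    replace (2 * a) with (a + a) in * by ring.
    replace (ccos (a + a)) with (ccos a * ccos a - csin a * csin a).
    2:{ rewrite <- (csin_add_PI2 (a + a)), <- Cplus_assoc, csin_plus, csin_add_PI2, ccos_add_PI2. ring. }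
    rewrite csin_plus in *.
    assert (csin a <> 0) by (intros E; apply Ha; rewrite E; ring).
    assert (ccos a <> 0) by (intros E; apply Ha; rewrite E; ring).
    field. repeat split; auto; nz.
  - intros a. unfold ccot. rewrite ccos_add_PI, csin_add_PI.
    destruct (classic (csin a = 0)) as [E|E].
    + rewrite E. replace (- 0) with (RtoC 0) by ring. unfold Cdiv.
      replace (/ 0) with (RtoC 0); [ring|].
      unfold Cinv, RtoC; simpl. f_equal; unfold Rdiv; ring.
    + field. easy.
Qed.

Lemma csin_inv_sqr_distribution w k : csin (RtoC PI * w) <> 0 ->
  lsum (fun j => / csin (RtoC (dyadic_angle k) * (w + RtoC (IZR j))) ^ 2) (dyadic_range k)
  = 4 ^ S k * / csin (RtoC PI * w) ^ 2.
Proof.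
  apply (dyadic_distribution (fun z => / csin z ^ 2) 4).
  - intros a Ha. rewrite csin_add_PI2.
    replace (2 * a) with (a + a) in * by ring. rewrite csin_plus in *.
    assert (csin a <> 0) by (intros E; apply Ha; rewrite E; ring).
    assert (ccos a <> 0) by (intros E; apply Ha; rewrite E; ring).
    transitivity ((csin a * csin a + ccos a * ccos a) * / (csin a ^ 2 * ccos a ^ 2)).
    + field. auto.
    + rewrite csin_sqr_ccos_sqr. field. repeat split; auto; nz.
  - intros a. rewrite csin_add_PI. f_equal. ring.
Qed.

Lemma dyadic_angle_pow k : RtoC (dyadic_angle k) * 2 ^ S k = RtoC PI.
Proof.
  rewrite <- RtoC_pow, <- RtoC_mult. f_equal. unfold dyadic_angle. field.
  apply pow_nonzero. lra.
Qed.

(** Lipschitz's formula in its trigonometric form. *)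
Lemma partial_fractions_inv_sqr w c : separated w c -> csin (RtoC PI * w) <> 0 ->
  has_sum (fun j : Z => / ((w + RtoC (IZR j)) * (w + RtoC (IZR j))))
    (RtoC PI ^ 2 / csin (RtoC PI * w) ^ 2).
Proof.
  intros Sw Hw. apply (partial_fractions_core w w c c); auto.
  eapply tendsto_ext; [|apply tendsto_const]. intros k. simpl.
  transitivity (lsum (fun j => RtoC (dyadic_angle k) ^ 2 *
    / csin (RtoC (dyadic_angle k) * (w + RtoC (IZR j))) ^ 2) (dyadic_range k)).
  - rewrite lsum_scal, csin_inv_sqr_distribution by easy.
    set (X := csin (RtoC PI * w)) in *. rewrite <- (dyadic_angle_pow k).
    replace (4 ^ S k) with ((2 ^ S k) ^ 2); [field; easy|].
    rewrite <- Cpow_mult_r, Nat.mul_comm, Cpow_mult_r. f_equal. rewrite <- RtoC_pow. f_equal. ring.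
  - apply lsum_ext. intros j _. unfold Cdiv. set (x := csin _).
    replace (/ x ^ 2) with (/ x * / x); [ring|].
    destruct (classic (x = 0)) as [E|E].
    + rewrite E. unfold Cinv, Cmult, RtoC; simpl. f_equal; unfold Rdiv; ring.
    + field. easy.
Qed.

(** A difference of cotangents is a sine of the difference over a product of sines,
    which reduces the product of two inverse sines to the duplication of the cotangent. *)
Lemma partial_fractions_cot w w' c c' : separated w c -> separated w' c' -> w' - w <> 0 ->
  csin (RtoC PI * w) <> 0 -> csin (RtoC PI * w') <> 0 ->
  has_sum (fun j : Z => / ((w + RtoC (IZR j)) * (w' + RtoC (IZR j))))
    (RtoC PI * (ccot (RtoC PI * w) - ccot (RtoC PI * w')) / (w' - w)).
Proof.
  intros Sw Sw' Hd Hw Hw'. apply (partial_fractions_core w w' c c'); auto.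
  pose proof (tendsto_scal (RtoC PI * (ccot (RtoC PI * w) - ccot (RtoC PI * w'))) _ _
    (tendsto_csin_ratio _ Hd)) as L.
  revert L. apply tendsto_ext_loc.
  assert (N : eventually (fun k => csin (RtoC (dyadic_angle k) * (w' - w)) <> 0)).
  { assert (Hp : (0 < Cmod (w' - w))%R) by (apply Cmod_gt_0; easy).
    assert (Hq : (0 < 2 / Cmod (w' - w))%R) by (apply Rdiv_lt_0_compat; lra).
    generalize (dyadic_angle_small _ Hq). apply filter_imp. intros k Hk E.
    pose proof (dyadic_angle_pos k) as Ht.
    pose proof (csin_lower (RtoC (dyadic_angle k) * (w' - w))) as Lo.
    rewrite E, Cmod_0, Cmod_mult, Cmod_R, (Rabs_pos_eq (dyadic_angle k)) in Lo by lra.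
    enough (dyadic_angle k * Cmod (w' - w) <= 4 * 0)%R by nra. apply Lo.
    eapply Rle_trans; [apply re_le_Cmod|]. rewrite Cmod_mult, Cmod_R, Rabs_pos_eq by lra.
    apply (Rmult_lt_compat_r (Cmod (w' - w))) in Hk; [|lra].
    replace (2 / Cmod (w' - w) * Cmod (w' - w))%R with 2%R in Hk by (field; lra). lra. }
  generalize (filter_and _ _ N (filter_and _ _ (dyadic_window w) (dyadic_window w'))).
  apply filter_imp. intros k [Nk [W W']].
  set (t := RtoC (dyadic_angle k)) in *.
  assert (Ht : (0 < dyadic_angle k)%R) by apply dyadic_angle_pos.
  assert (Htn : t <> 0) by (unfold t; intros E; apply RtoC_inj in E; lra).
  transitivity (lsum (fun j => t * t / csin (t * (w' - w)) *
    (ccot (t * (w + RtoC (IZR j))) + - (1) * ccot (t * (w' + RtoC (IZR j))))) (dyadic_range k)).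
  - rewrite lsum_scal, lsum_plus, lsum_scal. unfold t.
    rewrite !ccot_distribution by easy. fold t.
    set (X := ccot (RtoC PI * w)). set (Y := ccot (RtoC PI * w')).
    rewrite <- (dyadic_angle_pow k). fold t. field. easy.
  - apply lsum_ext. intros j Hj. unfold ccot.
    assert (Z : forall v d, separated v d -> (Rabs (Re (t * (v + RtoC (IZR j)))) <= 2)%R ->
      csin (t * (v + RtoC (IZR j))) <> 0).
    { intros v d Sv Hr E. pose proof (csin_lower _ Hr) as Lo. rewrite E, Cmod_0 in Lo.
      assert (Hp : (0 < Cmod (t * (v + RtoC (IZR j))))%R).
      { apply Cmod_gt_0, Cmult_neq_0; [easy|]. eapply separated_neq_0; eauto. }
      lra. }
    pose proof (Z w c Sw (W j Hj)) as Z1. pose proof (Z w' c' Sw' (W' j Hj)) as Z2.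
    assert (E : csin (t * (w' - w)) = csin (t * (w' + RtoC (IZR j))) * ccos (t * (w + RtoC (IZR j)))
      - ccos (t * (w' + RtoC (IZR j))) * csin (t * (w + RtoC (IZR j)))).
    { replace (t * (w' - w)) with (t * (w' + RtoC (IZR j)) + - (t * (w + RtoC (IZR j)))) by ring.
      rewrite csin_plus, ccos_opp, csin_opp. ring. }
    rewrite E in *. field. auto.
Qed.

(** * The weight two Eisenstein series *)

Lemma has_sum_telescope (g : Z -> C) (s : C) :
  has_sum (fun j => g j - g (j + 1)%Z) s ->
  tendsto eventually (fun N => g (- Z.of_nat N)%Z - g (Z.of_nat N + 1)%Z) s.
Proof.
  intros H.
  assert (L : forall N n, lsum (fun j => g j - g (j + 1)%Z)
    (map (fun i => (Z.of_nat i - Z.of_nat N)%Z) (seq 0 n)) = g (- Z.of_nat N)%Z - g (Z.of_nat n - Z.of_nat N)%Z).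
  { intros N. induction n as [|n IH].
    - simpl. ring.
    - rewrite seq_S, map_app, lsum_app, IH. simpl lsum.
      replace (Z.of_nat n - Z.of_nat N + 1)%Z with (Z.of_nat (S n) - Z.of_nat N)%Z by lia. ring. }
  assert (T := has_sum_tendsto (fun j => g j - g (j + 1)%Z) s
    (fun N => map (fun i => (Z.of_nat i - Z.of_nat N)%Z) (seq 0 (2 * N + 1)))).
  refine (tendsto_ext _ _ _ _ (T _ _ H)).
  - intros N. cbv beta. rewrite L. do 2 f_equal. lia.
  - intros N. apply NoDup_map_inj; [intros x y; lia|apply seq_NoDup].
  - intros j. exists (Z.abs_nat j). intros N HN. apply in_map_iff.
    exists (Z.to_nat (j + Z.of_nat N)). split; [lia|]. apply in_seq. lia.
Qed.

Lemma inv_separated_tendsto (v : C) (c : R) (J : nat -> Z) :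
  separated v c -> (forall N, (Z.of_nat N <= Z.abs (J N))%Z) ->
  tendsto eventually (fun N => / (v + RtoC (IZR (J N)))) 0.
Proof.
  intros Sv HJ. pose proof Sv as [Hc B].
  apply (tendsto_le_0 _ (fun N => (/ (Rmin c 1 * (INR N + 1) / 2))%R)).
  - exists O. intros N _.
    assert (Hn : v + RtoC (IZR (J N)) <> 0) by (eapply separated_neq_0; eauto).
    rewrite Cmod_inv by easy.
    assert (Hm : (0 < Rmin c 1)%R) by (apply Rmin_pos; lra).
    assert (Hc' : (Rmin c 1 <= c)%R) by apply Rmin_l.
    assert (Hc1 : (Rmin c 1 <= 1)%R) by apply Rmin_r.
    set (m := Rmin c 1) in *.
    pose proof (pos_INR N).
    apply Rinv_le_contravar; [apply Rdiv_lt_0_compat; [nra|lra]|].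
    specialize (B (J N)). specialize (HJ N).
    assert (HJ2 : (Z.of_nat N * Z.of_nat N <= J N * J N)%Z) by nia.
    apply IZR_le in HJ2. rewrite !mult_IZR, <- INR_IZR_INZ in HJ2.
    apply Rsqr_incr_0; [|apply Rmult_le_pos; [nra|lra]|apply Cmod_ge_0].
    unfold Rsqr. rewrite <- (Rmult_1_r (Cmod _)) at 2. change (Cmod (v + RtoC (IZR (J N))) * (Cmod (v + RtoC (IZR (J N))) * 1))%R with (Cmod (v + RtoC (IZR (J N))) ^ 2)%R.
    eapply Rle_trans; [|exact B].
    apply Rle_trans with (m * (1 + INR N * INR N))%R; [|nra].
    assert (Q1 : ((INR N + 1) * (INR N + 1) <= 2 * (1 + INR N * INR N))%R)
      by (pose proof (Rle_0_sqr (INR N - 1)) as Q; unfold Rsqr in Q; lra).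
    assert (Q2 : (0 <= (INR N + 1) * (INR N + 1))%R) by nra.
    assert (Q3 : (m * ((INR N + 1) * (INR N + 1)) <= 2 * (1 + INR N * INR N))%R).
    { set (Y := ((INR N + 1) * (INR N + 1))%R) in *. nra. }
    replace (m * (INR N + 1) / 2 * (m * (INR N + 1) / 2))%R
      with (m / 4 * (m * ((INR N + 1) * (INR N + 1))))%R by field.
    replace (m * (1 + INR N * INR N))%R with (m / 4 * (4 * (1 + INR N * INR N)))%R by field.
    apply Rmult_le_compat_l; lra.
  - intros eps He.
    assert (Hm : (0 < Rmin c 1)%R) by (apply Rmin_pos; lra). set (m := Rmin c 1) in *.
    assert (Hme : (0 < m * eps)%R) by now apply Rmult_lt_0_compat.
    destruct (nfloor_ex (2 / (m * eps))%R) as [N0 [_ HN]].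
    { left; apply Rdiv_lt_0_compat; lra. }
    exists N0. intros N HN0. apply le_INR in HN0. pose proof (pos_INR N).
    assert (E : (2 < m * eps * (INR N + 1))%R).
    { apply (Rmult_lt_compat_l (m * eps)) in HN; [|nra].
      replace (m * eps * (2 / (m * eps)))%R with 2%R in HN by (field; nra).
      eapply Rlt_le_trans; [exact HN|]. apply Rmult_le_compat_l; nra. }
    apply (Rmult_lt_reg_l (m * (INR N + 1) / 2)); [apply Rdiv_lt_0_compat; [nra|lra]|].
    rewrite Rinv_r; [lra|]. apply Rgt_not_eq, Rdiv_lt_0_compat; [nra|lra].
Qed.

Lemma half_separated_neg : separated (RtoC (- (1 / 2))) (1 / 16).
Proof.
  split; [lra|]. intros j. destruct half_separated as [_ H]. specialize (H (- j)%Z).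
  rewrite opp_IZR in H. replace (RtoC (- (1 / 2)) + RtoC (IZR j)) with (- (RtoC (1 / 2) + RtoC (- IZR j))).
  - rewrite Cmod_opp. replace (- IZR j * - IZR j)%R with (IZR j * IZR j)%R in H by ring. exact H.
  - rewrite !RtoC_opp. ring.
Qed.

Lemma IZR_neq_0 (m : Z) : m <> 0%Z -> IZR m <> 0%R.
Proof. intros H E. apply H. now apply eq_IZR_R0. Qed.

Lemma RtoC_IZR_neq_0 (m : Z) : m <> 0%Z -> RtoC (IZR m) <> 0.
Proof. intros H E. apply RtoC_inj in E. now apply (IZR_neq_0 m H). Qed.

Lemma Im_IZR_mul (m : Z) (tau : C) (x : R) :
  m <> 0%Z -> Im tau <> 0%R -> Im (RtoC (IZR m) * tau + RtoC x) <> 0%R.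
Proof.
  intros Hm Ht. rewrite im_plus, im_scal_l. simpl (Im (RtoC x)). rewrite Rplus_0_r.
  apply Rmult_integral_contrapositive_currified; [now apply IZR_neq_0|easy].
Qed.

Lemma shifted_row_separated (tau : C) (m : Z) (x : R) :
  Im tau <> 0%R -> x = (1 / 2)%R \/ x = (- (1 / 2))%R ->
  exists c, separated (RtoC (IZR m) * tau + RtoC x) c.
Proof.
  intros Ht Hx. destruct (Z.eq_dec m 0) as [->|Hm].
  - exists (1 / 16)%R. replace (RtoC (IZR 0) * tau + RtoC x) with (RtoC x) by ring.
    destruct Hx as [-> | ->]; [apply half_separated|apply half_separated_neg].
  - apply nonreal_separated. now apply Im_IZR_mul.
Qed.

(** The correction term that makes the lattice sum absolutely convergent does
    not contribute to a sum along a row. *)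
Lemma row_correction_sum (tau : C) (m : Z) : Im tau <> 0%R ->
  has_sum (fun n : Z => / ((RtoC (IZR m) * tau + RtoC (- (1 / 2)) + RtoC (IZR n)) *
     (RtoC (IZR m) * tau + RtoC (1 / 2) + RtoC (IZR n)))) 0.
Proof.
  intros Ht.
  destruct (shifted_row_separated tau m (- (1 / 2)) Ht (or_intror eq_refl)) as [c Sc].
  destruct (shifted_row_separated tau m (1 / 2) Ht (or_introl eq_refl)) as [c' Sc'].
  destruct (summable_has_sum _ _ (fun j => Rle_refl _) (summable_separated _ _ _ _ Sc Sc')) as [s Hs].
  enough (E : s = 0) by (rewrite <- E; exact Hs).
  set (g := fun j : Z => / (RtoC (IZR m) * tau + RtoC (- (1 / 2)) + RtoC (IZR j))).
  assert (Hg : has_sum (fun j => g j - g (j + 1)%Z) s).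
  { revert Hs. apply has_sum_ext. intros j. unfold g.
    assert (E : RtoC (IZR m) * tau + RtoC (- (1 / 2)) + RtoC (IZR (j + 1))
      = RtoC (IZR m) * tau + RtoC (1 / 2) + RtoC (IZR j)).
    { rewrite <- !Cplus_assoc, <- !RtoC_plus, plus_IZR. f_equal. f_equal. lra. }
    rewrite E.
    assert (A1 := separated_neq_0 _ _ j Sc). assert (A2 := separated_neq_0 _ _ j Sc').
    set (x := RtoC (IZR m) * tau + RtoC (- (1 / 2)) + RtoC (IZR j)) in *.
    replace (RtoC (IZR m) * tau + RtoC (1 / 2) + RtoC (IZR j)) with (x + 1) in *.
    - field. auto.
    - unfold x. replace (RtoC (1 / 2)) with (1 + RtoC (- (1 / 2))) by (rewrite <- RtoC_plus; f_equal; lra).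
      ring. }
  apply has_sum_telescope in Hg.
  refine (tendsto_unique (F := eventually) _ s 0 Hg _).
  replace (RtoC 0) with (0 - 0) by ring.
  apply tendsto_minus.
  - apply (inv_separated_tendsto _ c (fun N => (- Z.of_nat N)%Z)); [easy|intros N; lia].
  - apply (inv_separated_tendsto _ c (fun N => (Z.of_nat N + 1)%Z)); [easy|intros N; lia].
Qed.

Lemma csin_PI2 : csin (RtoC PI * RtoC (1 / 2)) = 1.
Proof.
  rewrite <- RtoC_mult. replace (PI * (1 / 2))%R with (PI / 2)%R by field.
  unfold RtoC at 1. rewrite csin_Re_Im, sin_PI2, cos_PI2, cosh_0, sinh_0.
  unfold RtoC. f_equal; ring.
Qed.

Lemma has_sum_split_parity (f : Z -> C) s t :
  has_sum (fun j => f (2 * j)%Z) s -> has_sum (fun j => f (2 * j + 1)%Z) t -> has_sum f (s + t).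
Proof.
  intros H H'.
  assert (A : has_sum (fun j => if Z.even j then f j else 0) s).
  { apply (has_sum_support (fun j => (2 * j)%Z)); [intros x y; lia| |].
    - intros j Hj. destruct (Z.even j) eqn:E; [|easy].
      apply Z.even_spec in E. destruct E as [i ->]. now elim (Hj i).
    - revert H. apply has_sum_ext. intros j. now rewrite Z.even_mul. }
  assert (B : has_sum (fun j => if Z.even j then 0 else f j) t).
  { apply (has_sum_support (fun j => (2 * j + 1)%Z)); [intros x y; lia| |].
    - intros j Hj. destruct (Z.even j) eqn:E; [easy|].
      assert (O : Z.odd j = true) by (rewrite <- Z.negb_even, E; easy).
      apply Z.odd_spec in O. destruct O as [i ->]. now elim (Hj i).
    - revert H'. apply has_sum_ext. intros j. now rewrite Z.even_add, Z.even_mul. }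
  pose proof (has_sum_plus _ _ _ _ A B) as P. revert P. apply has_sum_ext.
  intros j. simpl. destruct (Z.even j); ring.
Qed.

Lemma summable_inv_sqr_nonzero :
  summable (fun n : Z => Cmod (if Z.eq_dec n 0 then 0 else / (RtoC (IZR n) * RtoC (IZR n)))).
Proof.
  apply (summable_le _ (fun j => (2 * / (1 + IZR j * IZR j))%R)).
  - intros j. split; [apply Cmod_ge_0|].
    destruct (Z.eq_dec j 0) as [->|Hj].
    + rewrite Cmod_0. apply Rmult_le_pos; [lra|]. left. apply Rinv_0_lt_compat. nra.
    + rewrite <- RtoC_mult, Cmod_inv, Cmod_R.
      2:{ rewrite RtoC_mult. apply Cmult_neq_0; now apply RtoC_IZR_neq_0. }
      assert (1 <= IZR j * IZR j)%R by (rewrite <- mult_IZR; apply IZR_le; nia).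
      rewrite Rabs_pos_eq by lra.
      apply (Rmult_le_reg_l (IZR j * IZR j)); [lra|].
      apply (Rmult_le_reg_r (1 + IZR j * IZR j)); [lra|].
      replace (IZR j * IZR j * / (IZR j * IZR j) * (1 + IZR j * IZR j))%R
        with (1 + IZR j * IZR j)%R by (field; intros E; rewrite E in H; lra).
      replace (IZR j * IZR j * (2 * / (1 + IZR j * IZR j)) * (1 + IZR j * IZR j))%R
        with (2 * (IZR j * IZR j))%R by (field; lra). lra.
  - apply summable_scal; [lra|apply summable_inv_sqr_Z].
Qed.

(** Euler's evaluation of zeta(2), from the partial fractions at 1/2: the odd
    integers carry three quarters of the sum. *)
Lemma zeta_2_sum :
  has_sum (fun n : Z => if Z.eq_dec n 0 then 0 else / (RtoC (IZR n) * RtoC (IZR n))) (RtoC PI ^ 2 / 3).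
Proof.
  destruct (summable_has_sum _ _ (fun j => Rle_refl _) summable_inv_sqr_nonzero) as [s Hs].
  enough (E : s = RtoC PI ^ 2 / 3) by (rewrite <- E; exact Hs).
  assert (Ho := partial_fractions_inv_sqr _ _ half_separated).
  rewrite csin_PI2 in Ho. specialize (Ho C1_nz).
  assert (H : s = / 4 * s + / 4 * (RtoC PI ^ 2 / 1 ^ 2)).
  { apply (has_sum_unique _ _ _ Hs). apply has_sum_split_parity.
    - apply (has_sum_scal (/ 4)) in Hs. revert Hs. apply has_sum_ext. intros j.
      destruct (Z.eq_dec j 0) as [->|Hj].
      + destruct (Z.eq_dec (2 * 0) 0); [ring|easy].
      + destruct (Z.eq_dec (2 * j) 0); [lia|]. rewrite mult_IZR, RtoC_mult.
        assert (RtoC (IZR j) <> 0) by now apply RtoC_IZR_neq_0. field. repeat split; nz.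
    - apply (has_sum_scal (/ 4)) in Ho. revert Ho. apply has_sum_ext. intros j.
      destruct (Z.eq_dec (2 * j + 1) 0); [lia|]. rewrite plus_IZR, mult_IZR.
      assert (A := separated_neq_0 _ _ j half_separated).
      replace (RtoC (2 * IZR j + 1)) with (2 * (RtoC (1 / 2) + RtoC (IZR j))).
      + field. repeat split; nz.
      + rewrite <- RtoC_plus, <- RtoC_mult. f_equal. lra. }
  replace s with (4 / 3 * (s - / 4 * s)) by (field; nz).
  rewrite H at 1. field. all: nz.
Qed.

Definition row_sum (tau : C) (m : Z) : C :=
  if Z.eq_dec m 0 then RtoC PI ^ 2 / 3
  else RtoC PI ^ 2 / csin (RtoC PI * (RtoC (IZR m) * tau)) ^ 2.

Definition lattice_point (tau : C) (m n : Z) : C := RtoC (IZR m) * tau + RtoC (IZR n).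

Definition inv_sqr_term (tau : C) (m n : Z) : C :=
  if Z.eq_dec m 0 then (if Z.eq_dec n 0 then 0 else / (lattice_point tau m n * lattice_point tau m n))
  else / (lattice_point tau m n * lattice_point tau m n).

Lemma inv_sqr_term_row (tau : C) (m : Z) : Im tau <> 0%R ->
  has_sum (inv_sqr_term tau m) (row_sum tau m).
Proof.
  intros Ht. unfold inv_sqr_term, row_sum. destruct (Z.eq_dec m 0) as [->|Hm].
  - refine (has_sum_ext _ _ _ _ zeta_2_sum). intros n. unfold lattice_point.
    destruct (Z.eq_dec n 0); [easy|]. do 2 f_equal; ring.
  - assert (Hi : Im (RtoC (IZR m) * tau) <> 0%R).
    { replace (RtoC (IZR m) * tau) with (RtoC (IZR m) * tau + RtoC 0) by ring. now apply Im_IZR_mul. }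
    destruct (nonreal_separated _ Hi) as [c Sc].
    apply (partial_fractions_inv_sqr _ c Sc). apply csin_neq_0.
    rewrite im_scal_l. apply Rmult_integral_contrapositive_currified; [|easy].
    apply Rgt_not_eq, PI_RGT_0.
Qed.

Lemma Im_opp_inv (tau : C) : tau <> 0 -> Im (- / tau) = (Im tau / Cmod tau ^ 2)%R.
Proof.
  intros Ht. destruct tau as [x y]. rewrite Cmod2_alt. unfold Cinv, Copp; simpl.
  assert (x * x + y * y <> 0)%R.
  { intros E. apply Ht. unfold RtoC. f_equal; nra. }
  field. intros E; apply H; rewrite <- E; ring.
Qed.

Lemma Im_pos_neq_0 (tau : C) : (0 < Im tau)%R -> tau <> 0.
Proof. intros H E. rewrite E in H. simpl in H. lra. Qed.

Lemma Im_opp_inv_pos (tau : C) : (0 < Im tau)%R -> (0 < Im (- / tau))%R.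
Proof.
  intros H. pose proof (Im_pos_neq_0 _ H) as Ht. rewrite Im_opp_inv by easy.
  apply Rdiv_lt_0_compat; [easy|]. apply pow_lt. now apply Cmod_gt_0.
Qed.

(** The inversion of [tau] exchanges rows and columns. *)
Lemma inv_sqr_term_inversion (tau : C) (m n : Z) : (0 < Im tau)%R ->
  inv_sqr_term tau m n = / (tau * tau) * inv_sqr_term (- / tau) n (- m)%Z.
Proof.
  intros Ht. pose proof (Im_pos_neq_0 _ Ht) as H0.
  assert (E : lattice_point tau m n = - tau * lattice_point (- / tau) n (- m)).
  { unfold lattice_point. rewrite opp_IZR, RtoC_opp. field. easy. }
  unfold inv_sqr_term. rewrite E.
  assert (N : (m <> 0 \/ n <> 0)%Z -> lattice_point (- / tau) n (- m) <> 0).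
  { intros Hmn Z. rewrite Z in E. unfold lattice_point in E.
    assert (Ei : Im (RtoC (IZR m) * tau + RtoC (IZR n)) = 0%R) by (rewrite E; simpl; ring).
    rewrite im_plus, im_scal_l in Ei. simpl (Im (RtoC _)) in Ei. rewrite Rplus_0_r in Ei.
    apply Rmult_integral in Ei. destruct Ei as [Ei|Ei]; [|lra].
    apply eq_IZR_R0 in Ei. subst m. rewrite Cmult_0_l, Cplus_0_l in E.
    replace (- tau * 0) with (RtoC 0) in E by ring. apply RtoC_inj in E. apply eq_IZR_R0 in E. lia. }
  destruct (Z.eq_dec m 0), (Z.eq_dec n 0), (Z.eq_dec (- m) 0); try lia;
    try (assert (A := N ltac:(lia)); field; split; easy); ring.
Qed.

(** In a column the correction term, as a function of [m], has its poles at half-integers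
    divided by [tau]. *)
Definition half_point (tau : C) (n : Z) : C := (RtoC (IZR n) - RtoC (1 / 2)) / tau.

Lemma Im_half_point (tau : C) (n : Z) : (0 < Im tau)%R -> Im (half_point tau n) <> 0%R.
Proof.
  intros H. unfold half_point.
  replace ((RtoC (IZR n) - RtoC (1 / 2)) / tau) with (RtoC (1 / 2 - IZR n) * - / tau)
    by (rewrite RtoC_minus; field; now apply Im_pos_neq_0).
  rewrite im_scal_l. pose proof (Im_opp_inv_pos _ H).
  apply Rmult_integral_contrapositive_currified; [|lra].
  intros E. assert (E2 : (1 - 2 * IZR n = 0)%R) by lra.
  rewrite <- (mult_IZR 2), <- (minus_IZR 1) in E2. apply eq_IZR_R0 in E2. lia.
Qed.

Definition column_correction (tau : C) (n : Z) : C :=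
  RtoC PI / tau * ccot (RtoC PI * half_point tau n).

(** Along a column the correction term does contribute: partial fractions give a
    difference of cotangents, which telescopes in the column index. *)
Lemma column_correction_sum (tau : C) (n : Z) : (0 < Im tau)%R ->
  has_sum (fun m : Z => / ((RtoC (IZR m) * tau + RtoC (- (1 / 2)) + RtoC (IZR n)) *
     (RtoC (IZR m) * tau + RtoC (1 / 2) + RtoC (IZR n))))
    (column_correction tau n - column_correction tau (n + 1)).
Proof.
  intros Ht. pose proof (Im_pos_neq_0 _ Ht) as H0.
  pose proof (Im_half_point tau n Ht) as I1. pose proof (Im_half_point tau (n + 1) Ht) as I2.
  destruct (nonreal_separated _ I1) as [c Sc]. destruct (nonreal_separated _ I2) as [c' Sc'].
  assert (Hd : half_point tau (n + 1) - half_point tau n = / tau).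
  { unfold half_point. rewrite plus_IZR, RtoC_plus. field. easy. }
  assert (Pn : PI <> 0%R) by (apply Rgt_not_eq, PI_RGT_0).
  assert (P := partial_fractions_cot _ _ _ _ Sc Sc').
  rewrite Hd in P.
  assert (Hti : / tau <> 0).
  { intros E. apply C1_nz. rewrite <- (Cinv_r tau H0), E. ring. }
  specialize (P Hti).
  assert (C1 : csin (RtoC PI * half_point tau n) <> 0).
  { apply csin_neq_0. rewrite im_scal_l. now apply Rmult_integral_contrapositive_currified. }
  assert (C2 : csin (RtoC PI * half_point tau (n + 1)) <> 0).
  { apply csin_neq_0. rewrite im_scal_l. now apply Rmult_integral_contrapositive_currified. }
  specialize (P C1 C2). apply (has_sum_scal (/ (tau * tau))) in P.
  replace (column_correction tau n - column_correction tau (n + 1)) with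
    (/ (tau * tau) * (RtoC PI * (ccot (RtoC PI * half_point tau n) - ccot (RtoC PI * half_point tau (n + 1))) / / tau)).
  2:{ unfold column_correction. field. easy. }
  revert P. apply has_sum_ext. intros m.
  assert (A1 := separated_neq_0 _ _ m Sc). assert (A2 := separated_neq_0 _ _ m Sc').
  replace (RtoC (IZR m) * tau + RtoC (- (1 / 2)) + RtoC (IZR n))
    with (tau * (half_point tau n + RtoC (IZR m))).
  2:{ unfold half_point. rewrite RtoC_opp. field. easy. }
  replace (RtoC (IZR m) * tau + RtoC (1 / 2) + RtoC (IZR n))
    with (tau * (half_point tau (n + 1) + RtoC (IZR m))).
  2:{ unfold half_point. rewrite plus_IZR, RtoC_plus.
      replace (RtoC 1) with (RtoC (1 / 2) + RtoC (1 / 2)) by (rewrite <- RtoC_plus; f_equal; lra).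
      field. easy. }
  field. auto.
Qed.

Lemma ccot_PI_nome (z : C) : (0 < Im z)%R ->
  ccot (- (RtoC PI * z)) = Ci * (1 + nome z) / (1 - nome z).
Proof.
  intros Hz.
  assert (N : nome z <> 1).
  { intros E. pose proof (Cmod_nome_lt_1 z Hz) as B. rewrite E, Cmod_1 in B. lra. }
  set (e := Cexp (Ci * (RtoC PI * z))).
  assert (He : e <> 0) by apply Cexp_neq_0.
  assert (E : nome z = e * e).
  { unfold nome, e. rewrite <- Cexp_plus. f_equal. rewrite RtoC_mult. ring. }
  rewrite E in *.
  assert (Hm : 1 - e * e <> 0).
  { intros E'. apply N. symmetry. now apply Ceq_minus. }
  unfold ccot. rewrite ccos_opp, csin_opp. unfold ccos, csin. rewrite !Cexp_opp. fold e.
  transitivity (Ci * ((e + / e) / (/ e - e))).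
  - field. repeat split; nz.
    replace (e * e - 1) with (- (1 - e * e)) by ring. intros E'.
    apply Hm. rewrite <- (Copp_involutive (1 - e * e)), E'. ring.
  - field. repeat split; nz.
Qed.

(** The cotangent tends to [i] or [-i] away from the real axis: this limit is the
    anomaly of the Eisenstein series. *)
Lemma column_correction_limit (tau : C) : (0 < Im tau)%R ->
  tendsto eventually (fun N => column_correction tau (- Z.of_nat N) - column_correction tau (Z.of_nat N + 1))
    (- (2 * RtoC PI * Ci / tau)).
Proof.
  intros Ht. pose proof (Im_pos_neq_0 _ Ht) as H0. pose proof (Im_opp_inv_pos _ Ht) as Hi.
  set (z := fun N : nat => RtoC (INR N + 1 / 2) * - / tau).
  assert (Hz : forall N, (0 < Im (z N))%R).
  { intros N. unfold z. rewrite im_scal_l. pose proof (pos_INR N). apply Rmult_lt_0_compat; lra. }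
  assert (Ln : tendsto eventually (fun N => nome (z N)) 0).
  { set (a := (2 * PI * Im (- / tau))%R).
    assert (Ha : (0 < a)%R) by (pose proof PI_RGT_0; unfold a; nra).
    apply (tendsto_le_0 _ (fun N => (/ (a * (INR N + 1 / 2)))%R)).
    - exists O. intros N _. rewrite Cmod_nome. unfold z. rewrite im_scal_l.
      replace (- (2 * PI * ((INR N + 1 / 2) * Im (- / tau))))%R
        with (- (a * (INR N + 1 / 2)))%R by (unfold a; ring).
      pose proof (pos_INR N).
      assert (0 < a * (INR N + 1 / 2))%R by nra.
      rewrite exp_Ropp. apply Rinv_le_contravar; [easy|].
      pose proof (exp_ineq1_le (a * (INR N + 1 / 2))). lra.
    - intros eps He. destruct (nfloor_ex (/ (a * eps))%R) as [N0 [_ HN]].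
      { left. apply Rinv_0_lt_compat. now apply Rmult_lt_0_compat. }
      assert (Hae : (0 < a * eps)%R) by now apply Rmult_lt_0_compat.
      exists (S N0). intros N HN0. apply le_INR in HN0. rewrite S_INR in HN0.
      assert (HaN : (0 < a * (INR N + 1 / 2))%R)
        by (apply Rmult_lt_0_compat; [easy|pose proof (pos_INR N); lra]).
      apply (Rmult_lt_reg_l (a * (INR N + 1 / 2))); [easy|].
      rewrite Rinv_r by lra.
      apply (Rmult_lt_compat_l (a * eps)) in HN; [|easy]. rewrite Rinv_r in HN by lra.
      eapply Rlt_le_trans; [exact HN|].
      replace (a * (INR N + 1 / 2) * eps)%R with (a * eps * (INR N + 1 / 2))%R by ring.
      apply Rmult_le_compat_l; lra. }
  assert (Lc : tendsto eventually (fun N => ccot (- (RtoC PI * z N))) Ci).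
  { assert (L1 : tendsto eventually (fun N => Ci * (1 + nome (z N)) * / (1 - nome (z N))) (Ci * (1 + 0) * / (1 - 0))).
    { apply tendsto_mult.
      - apply tendsto_scal. apply tendsto_plus; [apply tendsto_const|easy].
      - apply tendsto_inv; [intros E; apply C1_nz; rewrite <- E; ring|].
        apply tendsto_minus; [apply tendsto_const|easy]. }
    replace (Ci * (1 + 0) * / (1 - 0)) with Ci in L1 by (field; nz).
    revert L1. apply tendsto_ext. intros N. now rewrite ccot_PI_nome. }
  apply (tendsto_scal (- (2 * RtoC PI / tau))) in Lc.
  replace (- (2 * RtoC PI * Ci / tau)) with (- (2 * RtoC PI / tau) * Ci) by (field; easy).
  revert Lc. apply tendsto_ext. intros N. unfold column_correction.
  replace (half_point tau (Z.of_nat N + 1)) with (- z N).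
  2:{ unfold half_point, z. rewrite plus_IZR, <- INR_IZR_INZ, !RtoC_plus.
      replace (RtoC 1) with (RtoC (1 / 2) + RtoC (1 / 2)) by (rewrite <- RtoC_plus; f_equal; lra).
      field. easy. }
  replace (half_point tau (- Z.of_nat N)) with (z N).
  2:{ unfold half_point, z. rewrite opp_IZR, <- INR_IZR_INZ, RtoC_opp, RtoC_plus. field. easy. }
  replace (RtoC PI * - z N) with (- (RtoC PI * z N)) by ring.
  unfold ccot. rewrite !ccos_opp, !csin_opp.
  assert (Hs : csin (RtoC PI * z N) <> 0).
  { apply csin_neq_0. rewrite im_scal_l. apply Rmult_integral_contrapositive_currified;
      [apply Rgt_not_eq, PI_RGT_0|apply Rgt_not_eq, Hz]. }
  field. repeat split; easy.
Qed.

(** Subtracting [1 / ((z - 1/2) (z + 1/2))] leaves terms of order [|z|^-4], and the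
    subtracted terms telescope along rows. *)
Definition corrected_term (tau : C) (p : Z * Z) : C :=
  inv_sqr_term tau (fst p) (snd p) -
  / ((RtoC (IZR (fst p)) * tau + RtoC (- (1 / 2)) + RtoC (IZR (snd p))) *
     (RtoC (IZR (fst p)) * tau + RtoC (1 / 2) + RtoC (IZR (snd p)))).

Lemma mult_ge_of_sqr_ge (a b x : R) :
  (0 <= a)%R -> (0 <= b)%R -> (0 <= x)%R -> (x <= a ^ 2)%R -> (x <= b ^ 2)%R -> (x <= a * b)%R.
Proof.
  intros Ha Hb Hx A B. apply Rsqr_incr_0; [|easy|now apply Rmult_le_pos].
  unfold Rsqr. replace (a * b * (a * b))%R with (a ^ 2 * b ^ 2)%R by ring.
  apply Rmult_le_compat; easy.
Qed.

(** The majorant is a product of one function of [m] and one of [n], because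
    [(1 + m^2) (1 + n^2)] is at most [(1 + m^2 + n^2)^2]. *)
Lemma corrected_term_summable (tau : C) : (0 < Im tau)%R ->
  summable (fun p => Cmod (corrected_term tau p)).
Proof.
  intros Ht. assert (Hi : Im tau <> 0%R) by lra.
  destruct (lattice_lower_bound tau Hi) as [c [Hc B]].
  set (K := (8 / (c * c) + 4)%R).
  assert (Hcc : (0 < c * c)%R) by nra.
  assert (HK : (0 < 8 / (c * c))%R) by (apply Rdiv_lt_0_compat; lra).
  apply (summable_le _ (fun p => (K * (/ (1 + IZR (fst p) * IZR (fst p)) * / (1 + IZR (snd p) * IZR (snd p))))%R)).
  2:{ apply summable_scal; [unfold K; lra|].
      apply (summable_prod (fun j => (/ (1 + IZR j * IZR j))%R) (fun j => (/ (1 + IZR j * IZR j))%R));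
        apply summable_inv_sqr_Z. }
  intros [m n]. cbn [fst snd]. split; [apply Cmod_ge_0|].
  set (x := IZR m). set (y := IZR n).
  assert (Hx : (0 <= x * x)%R) by nra. assert (Hy : (0 <= y * y)%R) by nra.
  destruct (classic (m = 0%Z /\ n = 0%Z)) as [[-> ->]|Hmn].
  - unfold corrected_term, inv_sqr_term. cbn [fst snd].
    destruct (Z.eq_dec 0 0) as [_|]; [|easy].
    replace (0 - / _) with (RtoC 4).
    + rewrite Cmod_R, Rabs_pos_eq by lra. unfold x, y, K. rewrite Rmult_0_l, Rplus_0_r, Rinv_1. lra.
    + replace (RtoC 0 * tau + RtoC (- (1 / 2)) + RtoC 0) with (- RtoC (1 / 2)) by (rewrite RtoC_opp; ring).
      replace (RtoC 0 * tau + RtoC (1 / 2) + RtoC 0) with (RtoC (1 / 2)) by ring.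
      rewrite <- RtoC_opp, <- RtoC_mult, <- RtoC_inv by lra.
      rewrite <- RtoC_minus. f_equal. field.
  - set (u := (1 + x * x + y * y)%R). assert (Hu : (1 <= u)%R) by (unfold u; lra).
    set (z := lattice_point tau m n).
    assert (Hz : (c / 2 * u <= Cmod z ^ 2)%R).
    { eapply Rle_trans; [|apply B].
      assert (1 <= x * x + y * y)%R.
      { unfold x, y. rewrite <- !mult_IZR, <- plus_IZR. apply IZR_le.
        assert (m <> 0 \/ n <> 0)%Z by lia. nia. }
      unfold u, x, y in *. nra. }
    assert (Hh : forall v, v = (1 / 2)%R \/ v = (- (1 / 2))%R ->
      (c / 16 * u <= Cmod (RtoC (IZR m) * tau + RtoC v + RtoC (IZR n)) ^ 2)%R).
    { intros v Hv. rewrite <- Cplus_assoc, <- RtoC_plus. eapply Rle_trans; [|apply B]. fold x y.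
      assert ((1 + y * y) / 16 <= (v + y) * (v + y))%R.
      { pose proof (half_integer_sqr_ge n) as E1. pose proof (half_integer_sqr_ge (- n)) as E2.
        rewrite opp_IZR in E2. fold y in E1, E2. destruct Hv as [-> | ->]; lra. }
      unfold u. nra. }
    pose proof (Hh _ (or_intror eq_refl)) as H1. pose proof (Hh _ (or_introl eq_refl)) as H2.
    assert (D : corrected_term tau (m, n) = inv_sqr_term tau m n -
      / ((RtoC (IZR m) * tau + RtoC (- (1 / 2)) + RtoC (IZR n)) *
         (RtoC (IZR m) * tau + RtoC (1 / 2) + RtoC (IZR n)))) by reflexivity.
    assert (I : inv_sqr_term tau m n = / (z * z)).
    { unfold inv_sqr_term. fold z. destruct (Z.eq_dec m 0); [|easy]. destruct (Z.eq_dec n 0); [|easy].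
      elim Hmn. auto. }
    rewrite D, I.
    set (a := RtoC (IZR m) * tau + RtoC (- (1 / 2)) + RtoC (IZR n)) in *.
    set (b := RtoC (IZR m) * tau + RtoC (1 / 2) + RtoC (IZR n)) in *.
    assert (Hcu : (0 < c * u)%R) by nra.
    assert (N : forall w d, (0 < d)%R -> (c / d * u <= Cmod w ^ 2)%R -> w <> 0).
    { intros w d Hd Hw E. rewrite E, Cmod_0 in Hw. simpl in Hw.
      assert (0 < c / d * u)%R by (unfold Rdiv; pose proof (Rinv_0_lt_compat d Hd); nra). lra. }
    assert (Nz : z <> 0) by (apply (N z 2%R); [lra|easy]).
    assert (Na : a <> 0) by (apply (N a 16%R); [lra|easy]).
    assert (Nb : b <> 0) by (apply (N b 16%R); [lra|easy]).
    assert (Ea : a = z - RtoC (1 / 2)) by (unfold a, z, lattice_point; rewrite RtoC_opp; ring).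
    assert (Eb : b = z + RtoC (1 / 2)) by (unfold b, z, lattice_point; ring).
    assert (E : / (z * z) - / (a * b) = - RtoC (1 / 4) / (z * z * (a * b))).
    { replace (RtoC (1 / 4)) with (z * z - a * b); [field; auto|].
      rewrite Ea, Eb. replace (1 / 4)%R with (1 / 2 * (1 / 2))%R by field. rewrite RtoC_mult. ring. }
    rewrite E, Cmod_div by (repeat apply Cmult_neq_0; easy).
    rewrite Cmod_opp, Cmod_R, !Cmod_mult, Rabs_pos_eq by lra.
    assert (P : (c / 16 * u <= Cmod a * Cmod b)%R).
    { apply mult_ge_of_sqr_ge; try apply Cmod_ge_0; try easy. lra. }
    assert (Q : (c / 2 * u * (c / 16 * u) <= Cmod z * Cmod z * (Cmod a * Cmod b))%R).
    { apply Rmult_le_compat; lra. }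
    apply Rle_trans with (1 / 4 / (c / 2 * u * (c / 16 * u)))%R.
    { apply Rmult_le_compat_l; [lra|]. apply Rinv_le_contravar; [|exact Q].
      apply Rmult_lt_0_compat; lra. }
    replace (1 / 4 / (c / 2 * u * (c / 16 * u)))%R with (8 / (c * c) * / (u * u))%R by (field; lra).
    rewrite <- Rinv_mult.
    assert (U : (/ (u * u) <= / ((1 + x * x) * (1 + y * y)))%R).
    { apply Rinv_le_contravar; unfold u; nra. }
    assert (U0 : (0 < / ((1 + x * x) * (1 + y * y)))%R) by (apply Rinv_0_lt_compat; nra).
    unfold K. nra.
Qed.

(** The anomaly of the conditionally convergent weight two Eisenstein series:
    both orders of summation of the corrected series agree, and only the
    correction remembers the order. *)
Lemma row_sums_inversion (tau s s' : C) : (0 < Im tau)%R ->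
  has_sum (row_sum tau) s -> has_sum (row_sum (- / tau)) s' ->
  / (tau * tau) * s' - s = - (2 * RtoC PI * Ci / tau).
Proof.
  intros Ht Hs Hs'. assert (Hi : Im tau <> 0%R) by lra.
  pose proof (Im_opp_inv_pos _ Ht) as Ht'.
  destruct (summable_has_sum _ _ (fun p => Rle_refl _) (corrected_term_summable tau Ht)) as [S HS].
  assert (ES : S = s).
  { apply (has_sum_unique (row_sum tau)); [|easy].
    apply (has_sum_fubini _ _ _ HS). intros m.
    replace (row_sum tau m) with (row_sum tau m - 0) by ring.
    exact (has_sum_minus _ _ _ _ (inv_sqr_term_row tau m Hi) (row_correction_sum tau m Hi)). }
  subst S.
  assert (HC : has_sum (fun n => / (tau * tau) * row_sum (- / tau) n
      - (column_correction tau n - column_correction tau (n + 1)%Z)) s).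
  { apply (has_sum_fubini _ _ _ (has_sum_swap _ _ HS)). intros n.
    unfold corrected_term. cbn [fst snd].
    refine (has_sum_minus _ _ _ _ _ (column_correction_sum tau n Ht)).
    assert (R1 : has_sum (fun m : Z => inv_sqr_term (- / tau) n (- m)%Z) (row_sum (- / tau) n)).
    { apply (has_sum_reindex (fun m : Z => (- m)%Z) (fun m : Z => (- m)%Z) (inv_sqr_term (- / tau) n));
        [intros; lia|intros; lia|]. apply inv_sqr_term_row. lra. }
    apply (has_sum_scal (/ (tau * tau))) in R1. revert R1. apply has_sum_ext. intros m.
    symmetry. now apply inv_sqr_term_inversion. }
  pose proof (has_sum_minus _ _ _ _ (has_sum_scal (/ (tau * tau)) _ _ Hs') HC) as T.
  assert (T' : has_sum (fun n => column_correction tau n - column_correction tau (n + 1)%Z)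
    (/ (tau * tau) * s' - s)).
  { revert T. apply has_sum_ext. intros n. simpl. ring. }
  apply has_sum_telescope in T'.
  exact (tendsto_unique (F := eventually) _ _ _ T' (column_correction_limit tau Ht)).
Qed.

Lemma has_sum_nat_cons (f : nat -> C) t : has_sum (fun n => f (S n)) t -> has_sum f (f O + t).
Proof.
  intros H.
  assert (A : has_sum (fun n => match n with O => f O | S _ => 0 end) (f O)).
  { assert (E : lsum (fun n => match n with O => f O | S _ => 0 end) (O :: nil) = f O) by (simpl; ring).
    refine (eq_ind _ (fun x => has_sum _ x) _ _ E).
    apply has_sum_finite; [repeat constructor; easy|].
    intros [|n] Hn; [elim Hn; now left|easy]. }
  assert (B : has_sum (fun n => match n with O => 0 | S k => f n end) t).
  { apply (has_sum_support S); [intros x y; congruence| |exact H].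
    intros [|n] Hn; [easy|]. now elim (Hn n). }
  pose proof (has_sum_plus _ _ _ _ A B) as P. revert P. apply has_sum_ext.
  intros [|n]; ring.
Qed.

Lemma has_sum_Z_split (f : Z -> C) t t' :
  has_sum (fun n : nat => f (Z.of_nat (S n))) t ->
  has_sum (fun n : nat => f (- Z.of_nat (S n))%Z) t' -> has_sum f (f 0%Z + t + t').
Proof.
  intros H H'.
  assert (A : has_sum (fun j => if Z.eq_dec j 0 then f 0%Z else 0) (f 0%Z)).
  { assert (E : lsum (fun j => if Z.eq_dec j 0 then f 0%Z else 0) (0%Z :: nil) = f 0%Z) by (simpl; ring).
    refine (eq_ind _ (fun x => has_sum _ x) _ _ E).
    apply has_sum_finite; [repeat constructor; easy|]. intros j Hj.
    destruct (Z.eq_dec j 0) as [->|]; [elim Hj; now left|easy]. }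
  assert (B : has_sum (fun j => if Z_lt_dec 0 j then f j else 0) t).
  { apply (has_sum_support (fun n => Z.of_nat (S n))); [intros x y; lia| |].
    - intros j Hj. destruct (Z_lt_dec 0 j); [|easy]. elim (Hj (Z.to_nat (j - 1))). lia.
    - revert H. apply has_sum_ext. intros n. destruct (Z_lt_dec 0 (Z.of_nat (S n))); [easy|lia]. }
  assert (D : has_sum (fun j => if Z_lt_dec j 0 then f j else 0) t').
  { apply (has_sum_support (fun n => (- Z.of_nat (S n))%Z)); [intros x y; lia| |].
    - intros j Hj. destruct (Z_lt_dec j 0); [|easy]. elim (Hj (Z.to_nat (- j - 1))). lia.
    - revert H'. apply has_sum_ext. intros n. destruct (Z_lt_dec (- Z.of_nat (S n)) 0); [easy|lia]. }
  pose proof (has_sum_plus _ _ _ _ (has_sum_plus _ _ _ _ A B) D) as P. revert P.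
  apply has_sum_ext. intros j. simpl.
  destruct (Z.eq_dec j 0) as [E|E], (Z_lt_dec 0 j), (Z_lt_dec j 0); try lia; try (subst j; ring); ring.
Qed.

Lemma summable_geometric (r : R) : (0 <= r < 1)%R -> summable (fun n : nat => (r ^ n)%R).
Proof.
  intros H. apply ex_series_summable; [intros n; apply pow_le; lra|].
  apply ex_series_geom. rewrite Rabs_pos_eq; lra.
Qed.

Lemma summable_arith_geometric (r : R) : (0 <= r < 1)%R ->
  summable (fun n : nat => (INR (S n) * r ^ n)%R).
Proof.
  intros H. set (rho := ((1 + r) / 2)%R). assert (Hrho : (r < rho < 1)%R) by (unfold rho; lra).
  apply (summable_le _ (fun n => ((rho / (rho - r) + 1) * rho ^ n)%R)).
  - intros n. pose proof (pos_INR (S n)). assert (0 <= r ^ n)%R by (apply pow_le; lra).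
    split; [now apply Rmult_le_pos|].
    pose proof (linear_geometric_bound r rho n ltac:(lra)) as L.
    assert (r ^ n <= rho ^ n)%R by (apply pow_incr; lra).
    rewrite S_INR, !Rmult_plus_distr_r, !Rmult_1_l.
    apply Rplus_le_compat; [|easy].
    apply (Rmult_le_reg_l (rho - r)); [lra|].
    replace ((rho - r) * (rho / (rho - r) * rho ^ n))%R with (rho ^ S n)%R by (simpl; field; lra).
    lra.
  - apply summable_scal; [|apply summable_geometric; lra].
    assert (0 < rho / (rho - r))%R by (apply Rdiv_lt_0_compat; lra). lra.
Qed.

Lemma has_sum_geometric (q : C) : (Cmod q < 1)%R -> has_sum (fun n => q ^ n) (/ (1 - q)).
Proof.
  intros H. pose proof (Cmod_ge_0 q).
  assert (N : 1 - q <> 0).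
  { intros E. apply Ceq_minus in E. rewrite <- E, Cmod_1 in H. lra. }
  destruct (summable_has_sum (fun n => q ^ n) _ (fun n => Req_le _ _ (Cmod_pow q n))
    (summable_geometric (Cmod q) ltac:(lra))) as [s Hs].
  enough (E : s = / (1 - q)) by (rewrite <- E; exact Hs).
  assert (E : s = 1 + q * s).
  { apply (has_sum_unique _ _ _ Hs). apply (has_sum_nat_cons (fun n => q ^ n)). simpl.
    now apply has_sum_scal. }
  transitivity ((s - q * s) / (1 - q)); [field; easy|]. rewrite E at 1. field. easy.
Qed.

Lemma has_sum_arith_geometric (q : C) : (Cmod q < 1)%R ->
  has_sum (fun n => RtoC (INR (S n)) * q ^ n) (/ ((1 - q) * (1 - q))).
Proof.
  intros H. pose proof (Cmod_ge_0 q).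
  assert (N : 1 - q <> 0).
  { intros E. apply Ceq_minus in E. rewrite <- E, Cmod_1 in H. lra. }
  destruct (summable_has_sum (fun n => RtoC (INR (S n)) * q ^ n) (fun n => (INR (S n) * Cmod q ^ n)%R))
    as [s Hs].
  { intros n. rewrite Cmod_mult, Cmod_pow, Cmod_R, Rabs_pos_eq by apply pos_INR. lra. }
  { apply summable_arith_geometric. lra. }
  enough (E : s = / ((1 - q) * (1 - q))) by (rewrite <- E; exact Hs).
  assert (E : s = 1 + (q * s + q * / (1 - q))).
  { apply (has_sum_unique _ _ _ Hs).
    replace (1 + (q * s + q * / (1 - q))) with (RtoC (INR 1) * q ^ 0 + (q * s + q * / (1 - q)))
      by (simpl; ring).
    apply (has_sum_nat_cons (fun n => RtoC (INR (S n)) * q ^ n)).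
    pose proof (has_sum_plus _ _ _ _ (has_sum_scal q _ _ Hs) (has_sum_scal q _ _ (has_sum_geometric q H))) as P.
    revert P. apply has_sum_ext. intros n. rewrite (S_INR (S n)), RtoC_plus. simpl. ring. }
  transitivity ((s - q * s) / (1 - q)); [field; easy|]. rewrite E at 1. field. easy.
Qed.

(** The double Lambert series [sum w(d) q^(m d)] over positive [m] and [d]. *)
Definition lambert (w : nat -> C) (tau : C) : C :=
  qsum (fun p : nat * nat => w (S (snd p))) (fun p => (S (fst p) * S (snd p))%nat) tau.

Lemma lambert_disc_summable (w : nat * nat -> C) :
  (forall p, (Cmod (w p) <= INR (S (fst p)) * INR (S (snd p)))%R) ->
  disc_summable w (fun p : nat * nat => (S (fst p) * S (snd p))%nat).
Proof.
  intros Hw r Hr.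
  apply (summable_le _ (fun p => ((INR (S (fst p)) * r ^ fst p) * (INR (S (snd p)) * r ^ snd p))%R)).
  - intros [m d]. specialize (Hw (m, d)). cbn [fst snd] in *.
    pose proof (Cmod_ge_0 (w (m, d))).
    assert (P : (0 <= r ^ (S m * S d) <= r ^ m * r ^ d)%R).
    { split; [apply pow_le; lra|]. rewrite <- pow_add.
      replace (S m * S d)%nat with (m + d + (1 + m * d))%nat by lia.
      rewrite (pow_add r (m + d)). rewrite <- (Rmult_1_r (r ^ (m + d))) at 2.
      apply Rmult_le_compat_l; [apply pow_le; lra|].
      rewrite <- (pow1 (1 + m * d)). apply pow_incr. lra. }
    split; [apply Rmult_le_pos; easy|].
    replace (INR (S m) * r ^ m * (INR (S d) * r ^ d))%R with (INR (S m) * INR (S d) * (r ^ m * r ^ d))%R by ring.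
    apply Rmult_le_compat; easy.
  - exact (summable_prod _ _ (summable_arith_geometric r Hr) (summable_arith_geometric r Hr)).
Qed.

Lemma INR_S_ge_1 n : (1 <= INR (S n))%R.
Proof. rewrite S_INR. pose proof (pos_INR n). lra. Qed.

Lemma csin_sqr_nome (z : C) : (0 < Im z)%R ->
  RtoC PI ^ 2 / csin (RtoC PI * z) ^ 2 = - (4) * RtoC PI ^ 2 * (nome z * / ((1 - nome z) * (1 - nome z))).
Proof.
  intros Hz.
  assert (N : nome z <> 1).
  { intros E. pose proof (Cmod_nome_lt_1 z Hz) as B. rewrite E, Cmod_1 in B. lra. }
  set (e := Cexp (Ci * (RtoC PI * z))).
  assert (He : e <> 0) by apply Cexp_neq_0.
  assert (E : nome z = e * e).
  { unfold nome, e. rewrite <- Cexp_plus. f_equal. rewrite RtoC_mult. ring. }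
  rewrite E in *.
  assert (Hm : 1 - e * e <> 0).
  { intros E'. apply N. symmetry. now apply Ceq_minus. }
  assert (Es : csin (RtoC PI * z) ^ 2 = - ((1 - e * e) * (1 - e * e)) / (4 * (e * e))).
  { unfold csin. rewrite Cexp_opp. fold e.
    transitivity ((e - / e) * (e - / e) / (4 * (Ci * Ci))).
    - field. repeat split; nz.
    - rewrite Ci_sqr. field. repeat split; nz. }
  rewrite Es. field. repeat split; nz.
Qed.

Lemma row_sum_opp tau m : row_sum tau (- m) = row_sum tau m.
Proof.
  unfold row_sum. destruct (Z.eq_dec (- m) 0), (Z.eq_dec m 0); try lia; [easy|].
  rewrite opp_IZR, RtoC_opp. replace (RtoC PI * (- RtoC (IZR m) * tau)) with (- (RtoC PI * (RtoC (IZR m) * tau))) by ring.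
  rewrite csin_opp. f_equal. ring.
Qed.

(** The sum of all rows is the [q]-expansion of the Eisenstein series, by Lipschitz's
    formula in each row. *)
Lemma row_sum_total (tau : C) : (0 < Im tau)%R ->
  has_sum (row_sum tau) (RtoC PI ^ 2 / 3 - 8 * RtoC PI ^ 2 * lambert (fun d => RtoC (INR d)) tau).
Proof.
  intros Ht.
  assert (Hd : disc_summable (fun p : nat * nat => RtoC (INR (S (snd p)))) (fun p => (S (fst p) * S (snd p))%nat)).
  { apply lambert_disc_summable. intros [m d]. cbn [fst snd].
    rewrite Cmod_R, Rabs_pos_eq by apply pos_INR.
    pose proof (INR_S_ge_1 m). pose proof (INR_S_ge_1 d). nra. }
  assert (HG := qsum_correct _ _ tau Hd Ht).
  assert (HR : has_sum (fun m => nome (RtoC (INR (S m)) * tau) * / ((1 - nome (RtoC (INR (S m)) * tau)) * (1 - nome (RtoC (INR (S m)) * tau))))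
     (lambert (fun d => RtoC (INR d)) tau)).
  { apply (has_sum_fubini _ _ _ HG). intros m. cbn [fst snd].
    rewrite nome_mul_nat. set (Q := nome tau ^ S m).
    assert (HQ : (Cmod Q < 1)%R).
    { unfold Q. rewrite <- nome_mul_nat. apply Cmod_nome_lt_1. rewrite im_scal_l.
      pose proof (INR_S_ge_1 m). nra. }
    pose proof (has_sum_scal Q _ _ (has_sum_arith_geometric Q HQ)) as P.
    revert P. apply has_sum_ext. intros d. rewrite Cpow_mult_r. fold Q. simpl. ring. }
  apply (has_sum_scal (- (4) * RtoC PI ^ 2)) in HR.
  assert (Hpos : has_sum (fun m : nat => row_sum tau (Z.of_nat (S m))) (- (4) * RtoC PI ^ 2 * lambert (fun d => RtoC (INR d)) tau)).
  { revert HR. apply has_sum_ext. intros m. unfold row_sum.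
    destruct (Z.eq_dec (Z.of_nat (S m)) 0); [lia|]. rewrite <- INR_IZR_INZ.
    symmetry. apply csin_sqr_nome. rewrite im_scal_l. pose proof (INR_S_ge_1 m). nra. }
  assert (Hneg : has_sum (fun m : nat => row_sum tau (- Z.of_nat (S m))) (- (4) * RtoC PI ^ 2 * lambert (fun d => RtoC (INR d)) tau)).
  { revert Hpos. apply has_sum_ext. intros m. now rewrite row_sum_opp. }
  pose proof (has_sum_Z_split _ _ _ Hpos Hneg) as P.
  replace (row_sum tau 0) with (RtoC PI ^ 2 / 3) in P by (unfold row_sum; destruct (Z.eq_dec 0 0); easy).
  replace (RtoC PI ^ 2 / 3 - 8 * RtoC PI ^ 2 * lambert (fun d => RtoC (INR d)) tau) with
    (RtoC PI ^ 2 / 3 + - (4) * RtoC PI ^ 2 * lambert (fun d => RtoC (INR d)) tau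
      + - (4) * RtoC PI ^ 2 * lambert (fun d => RtoC (INR d)) tau) by ring.
  exact P.
Qed.

(** The quasi-modularity of [E_2 = 1 - 24 sum d q^(m d)]. *)
Lemma eisenstein_2_inversion (tau : C) : (0 < Im tau)%R ->
  / (tau * tau) * (1 - 24 * lambert (fun d => RtoC (INR d)) (- / tau))
  - (1 - 24 * lambert (fun d => RtoC (INR d)) tau) = - (6 * Ci / (RtoC PI * tau)).
Proof.
  intros Ht. pose proof (Im_pos_neq_0 _ Ht).
  assert (Hp : RtoC PI <> 0) by (intros E; apply RtoC_inj in E; pose proof PI_RGT_0; lra).
  pose proof (row_sums_inversion tau _ _ Ht (row_sum_total _ Ht) (row_sum_total _ (Im_opp_inv_pos _ Ht))) as E.
  apply (f_equal (fun x => 3 / RtoC PI ^ 2 * x)) in E.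
  transitivity (3 / RtoC PI ^ 2 * - (2 * RtoC PI * Ci / tau)); [|field; auto].
  rewrite <- E. field. auto.
Qed.

(** * The eta function *)

Lemma cderiv_nome (z : C) : cderiv nome z (RtoC (2 * PI) * Ci * nome z).
Proof.
  unfold nome at 1.
  eapply cderiv_eq; [|apply (cderiv_comp Cexp (fun t => RtoC (2 * PI) * Ci * t) z)].
  3:{ apply (cderiv_scal (RtoC (2 * PI) * Ci) (fun t => t)). apply cderiv_id. }
  2:{ apply cderiv_Cexp. }
  unfold nome. ring.
Qed.

Lemma tendsto_nome_cusp : tendsto eventually (fun N => nome (Ci * RtoC (INR N + 1))) 0.
Proof.
  apply (tendsto_le_0 _ (fun N => (/ (INR N + 1))%R)).
  - exists O. intros N _. rewrite Cmod_nome.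
    replace (Im (Ci * RtoC (INR N + 1))) with (INR N + 1)%R by (unfold Ci, RtoC; simpl; ring).
    pose proof (pos_INR N). rewrite exp_Ropp. apply Rinv_le_contravar; [lra|].
    pose proof (exp_ineq1_le (2 * PI * (INR N + 1))). pose proof PI2_1. nra.
  - intros eps He. destruct (nfloor_ex (/ eps)%R) as [N0 [_ HN]].
    { left. now apply Rinv_0_lt_compat. }
    exists N0. intros N HN0. apply le_INR in HN0. pose proof (pos_INR N).
    rewrite <- (Rinv_inv eps). apply Rinv_lt_contravar; [|lra].
    apply Rmult_lt_0_compat; [now apply Rinv_0_lt_compat|lra].
Qed.

Lemma Im_Ci_RtoC (t : R) : Im (Ci * RtoC t) = t.
Proof. unfold Ci, RtoC; simpl; ring. Qed.

Lemma qsum_cusp {I : Type} (b : I -> C) (n : I -> nat) :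
  disc_summable b n -> (forall i, (1 <= n i)%nat) ->
  tendsto eventually (fun N => qsum b n (Ci * RtoC (INR N + 1))) 0.
Proof.
  intros H Hn. destruct (qsum_decay b n (1 / 2) H Hn ltac:(lra)) as [K [HK B]].
  pose proof tendsto_nome_cusp as L.
  assert (L2 := tendsto_scal (RtoC K) _ _ L).
  apply (tendsto_le_0 _ (fun N => (K * Cmod (nome (Ci * RtoC (INR N + 1))))%R)).
  - generalize (L (1 / 2)%R ltac:(lra)). apply filter_imp. intros N h.
    apply B; [rewrite Im_Ci_RtoC; pose proof (pos_INR N); lra|].
    replace (nome (Ci * RtoC (INR N + 1)) - 0) with (nome (Ci * RtoC (INR N + 1))) in h by ring. lra.
  - intros eps He. generalize (L2 eps He). apply filter_imp. intros N.
    replace (RtoC K * nome (Ci * RtoC (INR N + 1)) - RtoC K * 0)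
      with (RtoC K * nome (Ci * RtoC (INR N + 1))) by ring.
    rewrite Cmod_mult, Cmod_R, Rabs_pos_eq by easy. easy.
Qed.

(** The branch of [- log (1 - q)] that vanishes at infinity. *)
Definition log_series (tau : C) : C := qsum (fun d => / RtoC (INR (S d))) S tau.

Lemma RtoC_INR_S_neq_0 n : RtoC (INR (S n)) <> 0.
Proof. intros E. apply RtoC_inj in E. pose proof (INR_S_ge_1 n). lra. Qed.

Lemma Cmod_inv_INR_S n : (Cmod (/ RtoC (INR (S n))) <= 1)%R.
Proof.
  pose proof (INR_S_ge_1 n).
  rewrite Cmod_inv, Cmod_R, Rabs_pos_eq by (apply RtoC_INR_S_neq_0 || lra).
  rewrite <- Rinv_1. apply Rinv_le_contravar; lra.
Qed.

Lemma log_series_disc_summable : disc_summable (fun d => / RtoC (INR (S d))) S.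
Proof.
  apply (disc_summable_le _ (fun _ => 1)).
  - intros d. rewrite Cmod_1. apply Cmod_inv_INR_S.
  - intros r Hr. apply (summable_le _ (fun d => (r ^ d)%R)); [|now apply summable_geometric].
    intros d. rewrite Cmod_1, Rmult_1_l. simpl. assert (0 <= r ^ d)%R by (apply pow_le; lra). nra.
Qed.

Lemma nome_neq_1 (z : C) : (0 < Im z)%R -> 1 - nome z <> 0.
Proof.
  intros Hz E. apply Ceq_minus in E. pose proof (Cmod_nome_lt_1 z Hz) as B.
  rewrite <- E, Cmod_1 in B. lra.
Qed.

Lemma cderiv_log_series (z : C) : (0 < Im z)%R ->
  cderiv log_series z (RtoC (2 * PI) * Ci * (nome z / (1 - nome z))).
Proof.
  intros Hz. pose proof (Cmod_nome_lt_1 z Hz) as B.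
  eapply cderiv_eq; [|apply (cderiv_qsum _ _ _ log_series_disc_summable Hz)].
  f_equal. apply Csum_unique.
  pose proof (has_sum_scal (nome z) _ _ (has_sum_geometric (nome z) ltac:(lra))) as P.
  revert P. apply has_sum_ext. intros d. rewrite Cinv_r by apply RtoC_INR_S_neq_0. simpl. ring.
Qed.

(** The product [exp(l) (1 - q)], with [l] the series, has a vanishing derivative and
    tends to 1 at infinity. *)
Lemma Cexp_log_series (z : C) : (0 < Im z)%R -> Cexp (- log_series z) = 1 - nome z.
Proof.
  intros Hz.
  set (h := fun t => Cexp (log_series t) * (1 - nome t)).
  assert (Hc : forall t, (0 < Im t)%R -> h t = h z).
  { intros t Ht. apply zero_deriv_const; try easy. clear t Ht. intros t Ht.
    eapply cderiv_eq; [|apply cderiv_mult].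
    2:{ apply (cderiv_comp Cexp log_series); [apply cderiv_Cexp|now apply cderiv_log_series]. }
    2:{ apply cderiv_minus; [apply cderiv_const|apply cderiv_nome]. }
    cbv beta. pose proof (nome_neq_1 t Ht). field. easy. }
  assert (L : tendsto eventually (fun N => h (Ci * RtoC (INR N + 1))) (Cexp 0 * (1 - 0))).
  { apply tendsto_mult.
    - apply (tendsto_comp Cexp _ _ _ (cderiv_Cexp 0)).
      apply qsum_cusp; [apply log_series_disc_summable|intros i; lia].
    - apply tendsto_minus; [apply tendsto_const|apply tendsto_nome_cusp]. }
  assert (L' : tendsto eventually (fun _ : nat => h z) (Cexp 0 * (1 - 0))).
  { revert L. apply tendsto_ext. intros N. apply Hc. rewrite Im_Ci_RtoC. pose proof (pos_INR N). lra. }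
  assert (E : h z = 1).
  { rewrite (tendsto_unique (F := eventually) _ _ _ (tendsto_const (h z)) L'), Cexp_0. ring. }
  unfold h in E. rewrite Cexp_opp. pose proof (Cexp_neq_0 (log_series z)).
  transitivity (/ Cexp (log_series z) * (Cexp (log_series z) * (1 - nome z))); [rewrite E; ring|].
  field. easy.
Qed.

Lemma C_Lim_seq_unique (u : nat -> C) (l : C) : tendsto eventually u l -> C_Lim_seq u = l.
Proof.
  intros H. unfold C_Lim_seq. destruct l as [x y].
  assert (E1 : is_lim_seq (fun n => Re (u n)) x).
  { apply is_lim_seq_spec. intros eps. generalize (H eps (cond_pos eps)). apply filter_imp.
    intros n h. eapply Rle_lt_trans; [|exact h]. exact (re_le_Cmod (u n - (x, y))). }
  assert (E2 : is_lim_seq (fun n => Im (u n)) y).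
  { apply is_lim_seq_spec. intros eps. generalize (H eps (cond_pos eps)). apply filter_imp.
    intros n h. eapply Rle_lt_trans; [|exact h]. exact (Rabs_Im_le (u n - (x, y))). }
  now rewrite (is_lim_seq_unique _ _ E1), (is_lim_seq_unique _ _ E2).
Qed.

Lemma tendsto_eventually_S (u : nat -> C) l :
  tendsto eventually (fun n => u (S n)) l -> tendsto eventually u l.
Proof.
  intros H eps He. destruct (H eps He) as [N HN]. exists (S N). intros [|n] Hn; [lia|].
  apply HN. lia.
Qed.

Lemma inv_weight_disc_summable :
  disc_summable (fun p : nat * nat => / RtoC (INR (S (snd p)))) (fun p => (S (fst p) * S (snd p))%nat).
Proof.
  apply lambert_disc_summable. intros [m d]. cbn [fst snd].
  pose proof (Cmod_inv_INR_S d). pose proof (INR_S_ge_1 m). pose proof (INR_S_ge_1 d). nra.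
Qed.

Lemma nat_weight_disc_summable :
  disc_summable (fun p : nat * nat => RtoC (INR (S (snd p)))) (fun p => (S (fst p) * S (snd p))%nat).
Proof.
  apply lambert_disc_summable. intros [m d]. cbn [fst snd].
  rewrite Cmod_R, Rabs_pos_eq by apply pos_INR.
  pose proof (INR_S_ge_1 m). pose proof (INR_S_ge_1 d). nra.
Qed.

Definition euler_log (tau : C) : C := lambert (fun d => / RtoC (INR d)) tau.

Lemma Im_mul_S n tau : (0 < Im tau)%R -> (0 < Im (RtoC (INR (S n)) * tau))%R.
Proof. intros H. rewrite im_scal_l. pose proof (INR_S_ge_1 n). nra. Qed.

Lemma euler_prod_tendsto (tau : C) : (0 < Im tau)%R ->
  tendsto eventually (euler_prod (nome tau)) (Cexp (- euler_log tau)).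
Proof.
  intros Ht.
  assert (HR : has_sum (fun m => log_series (RtoC (INR (S m)) * tau)) (euler_log tau)).
  { apply (has_sum_fubini _ _ _ (qsum_correct _ _ tau inv_weight_disc_summable Ht)).
    intros m. cbn [fst snd].
    refine (has_sum_ext _ _ _ _ (qsum_correct _ _ _ log_series_disc_summable (Im_mul_S m tau Ht))).
    intros d. now rewrite nome_mul_nat, Cpow_mult_r. }
  apply has_sum_nat_tendsto in HR.
  apply tendsto_eventually_S.
  apply tendsto_opp in HR. apply (tendsto_comp Cexp _ _ _ (cderiv_Cexp _)) in HR.
  revert HR. apply tendsto_ext. intros n. induction n as [|n IH].
  - rewrite sum_O, Cexp_log_series by now apply Im_mul_S.
    rewrite nome_mul_nat. simpl. ring.
  - rewrite sum_Sn. change plus with Cplus.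
    rewrite Copp_plus_distr, Cexp_plus, IH, Cexp_log_series by now apply Im_mul_S.
    rewrite nome_mul_nat. simpl. ring.
Qed.

(** A logarithm of [eta^2] whose derivative is the weight two Eisenstein series. *)
Definition eta_sqr_log (tau : C) : C := RtoC (2 * PI) * Ci * tau / 12 - 2 * euler_log tau.

Lemma eta_sqr (tau : C) : (0 < Im tau)%R -> eta tau ^ 2 = Cexp (eta_sqr_log tau).
Proof.
  intros Ht. unfold eta. rewrite (C_Lim_seq_unique _ _ (euler_prod_tendsto tau Ht)).
  rewrite Cpow_mult_l. simpl (_ ^ 2). rewrite !Cmult_1_r, <- !Cexp_plus. f_equal.
  unfold eta_sqr_log. field. all: nz.
Qed.

Lemma cderiv_eta_sqr_log (tau : C) : (0 < Im tau)%R ->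
  cderiv eta_sqr_log tau
    (RtoC (2 * PI) * Ci / 12 * (1 - 24 * lambert (fun d => RtoC (INR d)) tau)).
Proof.
  intros Ht. unfold eta_sqr_log.
  assert (E : qsum (fun p : nat * nat => RtoC (INR (S (fst p) * S (snd p))) * / RtoC (INR (S (snd p))))
    (fun p => (S (fst p) * S (snd p))%nat) tau = lambert (fun d => RtoC (INR d)) tau).
  { apply Csum_unique.
    refine (has_sum_ext _ _ _ _ (has_sum_swap _ _ (qsum_correct _ _ tau nat_weight_disc_summable Ht))).
    intros [m d]. cbn [fst snd]. rewrite mult_INR, RtoC_mult, (Nat.mul_comm (S d)).
    field. apply RtoC_INR_S_neq_0. }
  eapply cderiv_eq; [|apply cderiv_minus].
  2:{ apply (cderiv_ext (fun t => RtoC (2 * PI) * Ci / 12 * t)); [intros t; field; nz|].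
      apply (cderiv_scal _ (fun t => t)), cderiv_id. }
  2:{ apply cderiv_scal. apply (cderiv_qsum _ _ _ inv_weight_disc_summable Ht). }
  rewrite E. field. all: nz.
Qed.

(** The quotient of the two sides has a vanishing logarithmic derivative, by the
    quasi-modularity of [E_2], and its value at [i] is 1. *)
Lemma eta_sqr_inversion (tau : C) : (0 < Im tau)%R ->
  eta (- / tau) ^ 2 = - Ci * tau * eta tau ^ 2.
Proof.
  intros Ht. pose proof (Im_opp_inv_pos _ Ht) as Ht'.
  rewrite !eta_sqr by easy.
  set (h := fun t => Cexp (eta_sqr_log (- / t) - eta_sqr_log t) * / t).
  assert (Hc : h tau = h Ci).
  { apply zero_deriv_const; try easy; [|simpl; lra]. intros t Hi.
    pose proof (Im_pos_neq_0 _ Hi) as H0. pose proof (Im_opp_inv_pos _ Hi) as Hi'.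
    eapply cderiv_eq; [|apply cderiv_mult].
    2:{ apply (cderiv_comp Cexp (fun t => eta_sqr_log (- / t) - eta_sqr_log t)); [apply cderiv_Cexp|].
        apply cderiv_minus; [|now apply cderiv_eta_sqr_log].
        apply (cderiv_comp eta_sqr_log (fun t => - / t)); [now apply cderiv_eta_sqr_log|].
        apply (cderiv_ext (fun t => - (1) * / t)); [intros x; ring|].
        apply cderiv_scal. now apply cderiv_inv. }
    2:{ now apply cderiv_inv. }
    cbv beta. pose proof (eisenstein_2_inversion t Hi) as E.
    assert (Hp : RtoC PI <> 0) by (intros E'; apply RtoC_inj in E'; pose proof PI_RGT_0; lra).
    set (A := lambert _ (- / t)) in *. set (B := lambert _ t) in *.
    set (X := Cexp (eta_sqr_log (- / t) - eta_sqr_log t)).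
    transitivity (X * / t * (RtoC (2 * PI) * Ci / 12 * (/ (t * t) * (1 - 24 * A) - (1 - 24 * B)) - / t)).
    - field. all: nz.
    - rewrite E. rewrite (RtoC_mult 2).
      replace (2 * RtoC PI * Ci / 12 * - (6 * Ci / (RtoC PI * t))) with (- (Ci * Ci) / t)
        by (field; repeat split; nz).
      rewrite Ci_sqr. field. easy. }
  unfold h in Hc.
  assert (Ei : - / Ci = Ci) by (rewrite Ci_inv; ring).
  rewrite Ei in Hc.
  replace (eta_sqr_log Ci - eta_sqr_log Ci) with (RtoC 0) in Hc by ring.
  rewrite Cexp_0, Ci_inv in Hc. unfold Cminus in Hc. rewrite Cexp_plus, Cexp_opp in Hc.
  pose proof (Im_pos_neq_0 _ Ht). pose proof (Cexp_neq_0 (eta_sqr_log tau)).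
  transitivity (Cexp (eta_sqr_log (- / tau)) * / Cexp (eta_sqr_log tau) * / tau * (tau * Cexp (eta_sqr_log tau))).
  - field. auto.
  - rewrite Hc. ring.
Qed.

Lemma qsum_nome_eq {I : Type} (b : I -> C) (n : I -> nat) (z w : C) :
  nome z = nome w -> qsum b n z = qsum b n w.
Proof. intros E. unfold qsum. now rewrite E. Qed.

Lemma eta_sqr_add_1 (tau : C) : (0 < Im tau)%R ->
  eta (tau + 1) ^ 2 = nome (/ 12) * eta tau ^ 2.
Proof.
  intros Ht. rewrite !eta_sqr; [|easy|rewrite im_plus; simpl; lra].
  unfold nome at 1. rewrite <- Cexp_plus. f_equal. unfold eta_sqr_log, euler_log, lambert.
  rewrite (qsum_nome_eq _ _ (tau + 1) tau (nome_add_1 tau)). field. all: nz.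
Qed.

Lemma eta_sqr_add_nat (n : nat) (tau : C) : (0 < Im tau)%R ->
  eta (tau + RtoC (INR n)) ^ 2 = nome (/ 12) ^ n * eta tau ^ 2.
Proof.
  intros Ht. induction n as [|n IH].
  - simpl INR. rewrite Cplus_0_r. simpl. ring.
  - rewrite S_INR, RtoC_plus, Cplus_assoc, eta_sqr_add_1, IH; [simpl Cpow; ring|].
    rewrite im_plus. simpl (Im (RtoC _)). lra.
Qed.

Lemma Im_mul_pos (k : R) (tau : C) : (0 < k)%R -> (0 < Im tau)%R -> (0 < Im (RtoC k * tau))%R.
Proof. intros Hk H. rewrite im_scal_l. nra. Qed.

(** * Modularity of [phi] *)

(** An Atkin-Lehner law of weight four, centred at the cusp [r] so that the involutions
    used here have one shape, whatever their cusp. *)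
Definition involution_law (f : C -> C) (r N : R) : Prop :=
  forall w, (0 < Im w)%R -> f (RtoC r - / (RtoC N * w)) = RtoC N ^ 2 * w ^ 4 * f (RtoC r + w).

Lemma phi_law_0 : involution_law phi 0 6.
Proof.
  intros w Hw. pose proof (Im_pos_neq_0 _ Hw) as H0. unfold phi.
  assert (I6 := Im_mul_pos 6 w ltac:(lra) Hw).
  assert (I3 := Im_mul_pos 3 w ltac:(lra) Hw).
  assert (I2 := Im_mul_pos 2 w ltac:(lra) Hw).
  replace (RtoC 0 - / (6 * w)) with (- / (6 * w)) by ring.
  replace (2 * - / (6 * w)) with (- / (3 * w)) by (field; repeat split; nz).
  replace (3 * - / (6 * w)) with (- / (2 * w)) by (field; repeat split; nz).
  replace (6 * - / (6 * w)) with (- / w) by (field; repeat split; nz).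
  rewrite !eta_sqr_inversion by easy. rewrite !Cplus_0_l.
  transitivity ((Ci * Ci) * (Ci * Ci) * (36 * w ^ 4) * (eta w ^ 2 * eta (2 * w) ^ 2 * eta (3 * w) ^ 2 * eta (6 * w) ^ 2)).
  - ring.
  - rewrite Ci_sqr. ring.
Qed.

(** Each of the four arguments of [eta] is carried to another one by an explicit word
    in the inversion and the translations. The roots of unity cancel. *)
Lemma phi_law_third : involution_law phi (1 / 3) 18.
Proof.
  intros w Hw. pose proof (Im_pos_neq_0 _ Hw) as H0. unfold phi.
  set (tau := RtoC (1 / 3) + w).
  assert (T3 : RtoC (1 / 3) = 1 / 3) by (rewrite RtoC_div by lra; easy).
  assert (Ew : w = tau - 1 / 3) by (unfold tau; rewrite T3; ring).
  assert (Ht : (0 < Im tau)%R) by (unfold tau; rewrite im_plus; simpl (Im (RtoC _)); lra).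
  pose proof (Im_pos_neq_0 _ Ht) as H1.
  set (zeta := nome (/ 12)). assert (Hzeta : zeta <> 0) by apply nome_neq_0.
  assert (I6 := Im_mul_pos 6 w ltac:(lra) Hw).
  assert (I3 := Im_mul_pos 3 w ltac:(lra) Hw).
  assert (J2 := Im_mul_pos 2 tau ltac:(lra) Ht).
  assert (Jt := Im_opp_inv_pos _ Ht).
  assert (Im_sub : forall z (x : R), (0 < Im z)%R -> (0 < Im (z + RtoC x))%R).
  { intros z x Hz. rewrite im_plus. simpl (Im (RtoC _)). lra. }
  set (x := RtoC (1 / 3) - / (18 * w)).
  assert (E6 : eta (6 * x) ^ 2 * zeta = zeta ^ 2 * (- Ci * (3 * w)) * eta (3 * tau) ^ 2).
  { replace (6 * x) with (- / (3 * w) + RtoC (INR 2)) by (unfold x; rewrite T3; replace (INR 2) with 2%R by (simpl; ring); field; repeat split; nz).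
    rewrite eta_sqr_add_nat, eta_sqr_inversion by (try apply Im_opp_inv_pos; easy).
    replace (3 * tau) with (3 * w + 1) by (rewrite Ew; field; nz).
    rewrite eta_sqr_add_1 by easy. fold zeta. ring. }
  assert (E3 : eta (3 * x) ^ 2 * zeta ^ 2 = zeta * (- Ci * (6 * w)) * eta (6 * tau) ^ 2).
  { replace (3 * x) with (- / (6 * w) + 1) by (unfold x; rewrite T3; simpl; field; repeat split; nz).
    rewrite eta_sqr_add_1, eta_sqr_inversion by (try apply Im_opp_inv_pos; easy).
    replace (6 * tau) with (6 * w + RtoC (INR 2)) by (rewrite Ew; replace (INR 2) with 2%R by (simpl; ring); field; nz).
    rewrite eta_sqr_add_nat by easy. fold zeta. ring. }
  assert (E2 : eta (2 * x) ^ 2 = zeta ^ 4 * - (3 * w) * eta tau ^ 2).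
  { set (y := - / tau + RtoC (INR 3)).
    assert (Hy : (0 < Im y)%R) by (apply Im_sub; easy).
    assert (Ey : y = 3 * w / tau) by (unfold y; rewrite Ew; replace (INR 3) with 3%R by (simpl; ring); field; easy).
    replace (2 * x) with (- / y + 1).
    2:{ rewrite Ey. transitivity (1 - tau / (3 * w)); [field; repeat split; nz|].
        unfold x, tau. rewrite T3. field. repeat split; nz. }
    rewrite eta_sqr_add_1, eta_sqr_inversion by (try apply Im_opp_inv_pos; easy).
    unfold y at 2. rewrite eta_sqr_add_nat, eta_sqr_inversion by easy.
    fold zeta. rewrite Ey. transitivity (zeta ^ 4 * (Ci * Ci) * (3 * w) * eta tau ^ 2); [field; easy|].
    rewrite Ci_sqr. ring. }
  assert (E1 : eta x ^ 2 * zeta ^ 4 = (6 * w) * eta (2 * tau) ^ 2).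
  { set (v := 2 * tau + RtoC (-1)).
    assert (Hv : (0 < Im v)%R) by (apply Im_sub; easy).
    pose proof (Im_pos_neq_0 _ Hv) as Hv0. pose proof (Im_opp_inv_pos _ Hv) as Jv.
    set (y := - / v + RtoC (-3)).
    assert (Hy : (0 < Im y)%R) by (apply Im_sub; easy).
    assert (Ey : y = - (6 * w) / v) by (unfold y, v in *; rewrite Ew; field; easy).
    replace x with (- / y).
    2:{ rewrite Ey. transitivity (v / (6 * w)); [field; repeat split; nz|].
        unfold x, v, tau. rewrite T3. field. all: nz. }
    rewrite eta_sqr_inversion by easy.
    assert (F1 : eta (- / v) ^ 2 = zeta ^ 3 * eta y ^ 2).
    { replace (- / v) with (y + RtoC (INR 3)) by (unfold y; rewrite <- Cplus_assoc, <- RtoC_plus; simpl; replace (-3 + (1 + 1 + 1))%R with 0%R by ring; ring).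
      now rewrite eta_sqr_add_nat. }
    assert (F2 : eta (2 * tau) ^ 2 = zeta * eta v ^ 2).
    { replace (2 * tau) with (v + 1) by (unfold v; ring). now rewrite eta_sqr_add_1. }
    rewrite eta_sqr_inversion in F1 by easy.
    rewrite F2. transitivity (- Ci * y * (zeta * (zeta ^ 3 * eta y ^ 2))); [ring|].
    rewrite <- F1, Ey. transitivity (- (Ci * Ci) * (6 * w) * (zeta * eta v ^ 2)); [field; easy|].
    rewrite Ci_sqr. ring. }
  assert (Z : zeta ^ 7 <> 0) by now apply Cpow_nz.
  transitivity ((eta x ^ 2 * zeta ^ 4) * eta (2 * x) ^ 2 * (eta (3 * x) ^ 2 * zeta ^ 2) * (eta (6 * x) ^ 2 * zeta) / zeta ^ 7).
  { field. easy. }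
  rewrite E1, E2, E3, E6.
  transitivity (- (Ci * Ci) * RtoC 18 ^ 2 * w ^ 4 *
    (eta tau ^ 2 * eta (2 * tau) ^ 2 * eta (3 * tau) ^ 2 * eta (6 * tau) ^ 2)).
  - field. easy.
  - rewrite Ci_sqr. ring.
Qed.

Lemma phi_add_1 (tau : C) : (0 < Im tau)%R -> phi (tau + 1) = phi tau.
Proof.
  intros Ht. unfold phi.
  replace (2 * (tau + 1)) with (2 * tau + RtoC (INR 2)) by (replace (INR 2) with 2%R by (simpl; ring); ring).
  replace (3 * (tau + 1)) with (3 * tau + RtoC (INR 3)) by (replace (INR 3) with 3%R by (simpl; ring); ring).
  replace (6 * (tau + 1)) with (6 * tau + RtoC (INR 6)) by (replace (INR 6) with 6%R by (simpl; ring); ring).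
  assert (I6 := Im_mul_pos 6 tau ltac:(lra) Ht).
  assert (I3 := Im_mul_pos 3 tau ltac:(lra) Ht).
  assert (I2 := Im_mul_pos 2 tau ltac:(lra) Ht).
  rewrite eta_sqr_add_1, !eta_sqr_add_nat by easy.
  assert (E : nome (/ 12) ^ 12 = 1).
  { rewrite <- nome_mul_nat. rewrite <- nome_1. f_equal. replace (INR 12) with 12%R by (simpl; ring). field. all: nz. }
  set (zeta := nome (/ 12)) in *.
  transitivity (zeta ^ 12 * (eta tau ^ 2 * eta (2 * tau) ^ 2 * eta (3 * tau) ^ 2 * eta (6 * tau) ^ 2)); [ring|].
  rewrite E. ring.
Qed.

(** * Values of L-functions as boundary values of Eichler integrals *)

Lemma at_right_0_intro (P : R -> Prop) (d : R) :
  (0 < d)%R -> (forall t, (0 < t < d)%R -> P t) -> at_right 0 P.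
Proof.
  intros Hd H. exists (mkposreal d Hd). intros t Ht H0. apply H. split; [easy|].
  change (Rabs (t + - 0) < d)%R in Ht. rewrite Ropp_0, Rplus_0_r in Ht.
  pose proof (Rle_abs t). lra.
Qed.

Lemma at_right_0_pos : at_right 0 (fun t => (0 < t)%R).
Proof. apply (at_right_0_intro _ 1); [lra|]. intros t Ht. lra. Qed.

Lemma tendsto_at_right_0_id : tendsto (at_right 0) RtoC 0.
Proof.
  intros eps He. apply (at_right_0_intro _ eps He). intros t Ht.
  rewrite <- RtoC_minus, Cmod_R, Rabs_pos_eq; lra.
Qed.

Lemma filterlim_tendsto {T : Type} {F : (T -> Prop) -> Prop} {FF : Filter F} (u : T -> C) (l : C) :
  filterlim (U := C_UniformSpace) u F (locally (T := C_UniformSpace) l) -> tendsto F u l.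
Proof.
  intros H eps He.
  specialize (H (fun z => (Cmod (z - l) < eps)%R)). apply H.
  exists (mkposreal _ (half_pos _ He)). intros z [h1 h2].
  eapply Rle_lt_trans; [apply Cmod_le_Re_Im|].
  change (Rabs (Re z - Re l) < eps / 2)%R in h1. change (Rabs (Im z - Im l) < eps / 2)%R in h2.
  unfold Cminus. rewrite re_plus, im_plus, re_opp, im_opp. unfold Rminus in h1, h2. lra.
Qed.

Lemma Re_sum_n (u : nat -> C) n : Re (sum_n u n) = sum_n (fun k => Re (u k)) n.
Proof.
  induction n as [|n IH]; [now rewrite !sum_O|]. rewrite !sum_Sn. now rewrite <- IH.
Qed.

Lemma Im_sum_n (u : nat -> C) n : Im (sum_n u n) = sum_n (fun k => Im (u k)) n.
Proof.
  induction n as [|n IH]; [now rewrite !sum_O|]. rewrite !sum_Sn. now rewrite <- IH.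
Qed.

Lemma C_Series_unique (u : nat -> C) (l : C) :
  tendsto eventually (fun n => sum_n u n) l -> C_Series u = l.
Proof.
  intros H. unfold C_Series. destruct l as [x y].
  assert (E1 : is_lim_seq (sum_n (fun n => Re (u n))) x).
  { apply is_lim_seq_spec. intros eps. generalize (H eps (cond_pos eps)). apply filter_imp.
    intros n h. rewrite <- Re_sum_n. eapply Rle_lt_trans; [|exact h].
    exact (re_le_Cmod (sum_n u n - (x, y))). }
  assert (E2 : is_lim_seq (sum_n (fun n => Im (u n))) y).
  { apply is_lim_seq_spec. intros eps. generalize (H eps (cond_pos eps)). apply filter_imp.
    intros n h. rewrite <- Im_sum_n. eapply Rle_lt_trans; [|exact h].
    exact (Rabs_Im_le (sum_n u n - (x, y))). }
  now rewrite (is_series_unique _ _ E1), (is_series_unique _ _ E2).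
Qed.

(** For [j = 3] this is the Eichler integral of a form of weight four; lowering [j] is
    differentiation, up to the factor [2 pi i]. *)
Definition eichler (b : nat -> C) (j : nat) : C -> C :=
  qsum (fun k => b (S k) / RtoC (INR (S k)) ^ j) S.

Definition disc_coefs (b : nat -> C) : Prop := disc_summable (fun k => b (S k)) S.

Lemma Cmod_INR_S_pow n j : (1 <= Cmod (RtoC (INR (S n)) ^ j))%R.
Proof.
  rewrite Cmod_pow, Cmod_R, Rabs_pos_eq by apply pos_INR. apply pow_R1_Rle, INR_S_ge_1.
Qed.

Lemma eichler_disc_summable b j : disc_coefs b ->
  disc_summable (fun k => b (S k) / RtoC (INR (S k)) ^ j) S.
Proof.
  apply disc_summable_le. intros k. pose proof (Cmod_INR_S_pow k j).
  rewrite Cmod_div by (apply Cpow_nz, RtoC_INR_S_neq_0).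
  pose proof (Cmod_ge_0 (b (S k))).
  rewrite <- (Rmult_1_r (Cmod (b (S k)))) at 2. apply Rmult_le_compat_l; [easy|].
  rewrite <- Rinv_1. apply Rinv_le_contravar; lra.
Qed.

Lemma qsum_ext {I : Type} (b b' : I -> C) (n : I -> nat) tau :
  disc_summable b' n -> (0 < Im tau)%R -> (forall i, b i = b' i) -> qsum b n tau = qsum b' n tau.
Proof.
  intros H Ht E. apply Csum_unique.
  refine (has_sum_ext _ _ _ _ (qsum_correct _ _ _ H Ht)). intros i. now rewrite E.
Qed.

Lemma cderiv_eichler b j tau : disc_coefs b -> (0 < Im tau)%R ->
  cderiv (eichler b (S j)) tau (RtoC (2 * PI) * Ci * eichler b j tau).
Proof.
  intros Hb Ht.
  eapply cderiv_eq; [|apply (cderiv_qsum _ _ _ (eichler_disc_summable b (S j) Hb) Ht)].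
  f_equal. apply qsum_ext; [now apply eichler_disc_summable|easy|].
  intros k. simpl. pose proof (RtoC_INR_S_neq_0 k) as N.
  assert (RtoC (INR (S k)) ^ j <> 0) by now apply Cpow_nz.
  simpl in N. field. auto.
Qed.

Lemma q_series_eichler b tau : disc_coefs b -> (0 < Im tau)%R -> q_series b tau = eichler b 0 tau.
Proof.
  intros Hb Ht. unfold q_series. apply C_Series_unique, has_sum_nat_tendsto.
  refine (has_sum_ext _ _ _ _ (qsum_correct _ _ _ (eichler_disc_summable b 0 Hb) Ht)).
  intros k. simpl (_ ^ 0). unfold Cdiv. replace (/ 1) with (RtoC 1) by (field; nz). ring.
Qed.

Lemma exp_neg_cube (x : R) : (0 < x)%R -> (exp (- x) <= 27 / x ^ 3)%R.
Proof.
  intros Hx. rewrite exp_Ropp.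
  assert (E : (x ^ 3 / 27 <= exp x)%R).
  { replace (exp x) with (exp (x / 3) ^ 3)%R.
    - replace (x ^ 3 / 27)%R with ((x / 3) ^ 3)%R by field. apply pow_incr.
      pose proof (exp_ineq1_le (x / 3)). lra.
    - replace x with (x / 3 + x / 3 + x / 3)%R at 2 by field. rewrite !exp_plus. ring. }
  assert (P : (0 < x ^ 3)%R) by now apply pow_lt.
  replace (27 / x ^ 3)%R with (/ (x ^ 3 / 27))%R by (field; lra).
  apply Rinv_le_contravar; lra.
Qed.

Lemma qsum_decay_infinity {I : Type} (b : I -> C) (n : I -> nat) (j : nat) (z : R -> C) :
  disc_summable b n -> (forall i, (1 <= n i)%nat) -> (j <= 2)%nat -> (forall t, Im (z t) = t) ->
  tendsto (Rbar_locally p_infty) (fun t => (Ci * RtoC t) ^ j * qsum b n (z t)) 0.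
Proof.
  intros H Hn Hj Hz. destruct (qsum_decay b n (exp (- (2 * PI))) H Hn) as [K [HK B]].
  { split; [apply exp_pos|]. rewrite <- exp_0. apply exp_increasing. pose proof PI_RGT_0. lra. }
  apply (tendsto_le_0 _ (fun t => (27 * K / t)%R)).
  - exists 1%R. intros t Ht. rewrite Cmod_mult, Cmod_pow, Cmod_mult, Cmod_Ci, Cmod_R, Rabs_pos_eq, Rmult_1_l by lra.
    assert (Hi : (0 < Im (z t))%R) by (rewrite Hz; lra).
    pose proof PI2_1 as HP.
    assert (B' := B (z t) Hi). rewrite Cmod_nome, Hz in B'.
    assert (B2 : (Cmod (qsum b n (z t)) <= K * exp (- (2 * PI * t)))%R).
    { apply B'. apply exp_le_compat. nra. }
    assert (E : (exp (- (2 * PI * t)) <= 27 / t ^ 3)%R).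
    { eapply Rle_trans; [apply (exp_neg_cube (2 * PI * t)); nra|].
      apply Rmult_le_compat_l; [lra|]. apply Rinv_le_contravar; [apply pow_lt; lra|].
      apply pow_incr. nra. }
    assert (Hp : (0 <= t ^ j <= t ^ 2)%R) by (split; [apply pow_le; lra|apply Rle_pow; [lra|easy]]).
    replace (27 * K / t)%R with (t ^ 2 * (K * (27 / t ^ 3)))%R by (field; lra).
    apply Rmult_le_compat; [easy|apply Cmod_ge_0|easy|].
    eapply Rle_trans; [exact B2|]. now apply Rmult_le_compat_l.
  - intros eps He. exists (Rmax 1 (27 * K / eps)). intros t Ht.
    pose proof (Rmax_l 1 (27 * K / eps)). pose proof (Rmax_r 1 (27 * K / eps)).
    assert (h : (27 * K / eps < t)%R) by lra.
    apply (Rmult_lt_compat_r eps) in h; [|easy].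
    unfold Rdiv in h. rewrite Rmult_assoc, Rinv_l, Rmult_1_r in h by lra.
    apply (Rmult_lt_reg_r t); [lra|]. unfold Rdiv. rewrite Rmult_assoc, Rinv_l by lra. lra.
Qed.

(** Improper integral over the imaginary axis of a function with an explicit
    complex primitive. *)
Lemma RInt_gen_imaginary_axis (f : R -> C) (A A1 A2 : C -> C) (A0 : C) :
  (forall tau, (0 < Im tau)%R -> cderiv A tau (A1 tau)) ->
  (forall tau, (0 < Im tau)%R -> cderiv A1 tau (A2 tau)) ->
  (forall t : R, (0 < t)%R -> f t = A1 (Ci * RtoC t) * Ci) ->
  tendsto (at_right 0) (fun t => A (Ci * RtoC t)) A0 ->
  tendsto (Rbar_locally p_infty) (fun t => A (Ci * RtoC t)) 0 ->
  RInt_gen (V := C_R_CompleteNormedModule) f (at_right 0) (Rbar_locally p_infty) = - A0.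
Proof.
  intros H1 H2 Hf L0 Li.
  assert (Hr : forall (g g1 : C -> C) t, (0 < t)%R -> cderiv g (Ci * RtoC t) (g1 (Ci * RtoC t)) ->
    is_derive (fun s : R => Re (g (Ci * RtoC s))) t (Re (g1 (Ci * RtoC t) * Ci)) /\
    is_derive (fun s : R => Im (g (Ci * RtoC s))) t (Im (g1 (Ci * RtoC t) * Ci))).
  { intros g g1 t Ht Hg.
    assert (E : forall s : R, 0 + RtoC s * Ci = Ci * RtoC s) by (intros s; ring).
    rewrite <- (E t) in Hg. destruct (cderiv_line g 0 Ci _ t Hg) as [a b]. rewrite E in a, b.
    split; [refine (is_derive_ext _ _ _ _ _ a)|refine (is_derive_ext _ _ _ _ _ b)];
      intros s; now rewrite E. }
  assert (HI : forall x y : R, (0 < x)%R -> (0 < y)%R ->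
    is_RInt (V := C_R_NormedModule) f x y (A (Ci * RtoC y) - A (Ci * RtoC x))).
  { intros x y Hx Hy.
    assert (Hpos : forall t, (Rmin x y <= t)%R -> (0 < t)%R).
    { intros t Ht. pose proof (Rmin_pos x y Hx Hy). lra. }
    apply (is_RInt_ext (V := C_R_NormedModule) (fun t => A1 (Ci * RtoC t) * Ci)).
    { intros t Ht. rewrite Hf; [easy|]. apply Hpos. lra. }
    assert (Hc : forall t, (0 < t)%R -> cderiv (fun z => A1 z * Ci) (Ci * RtoC t) (A2 (Ci * RtoC t) * Ci)).
    { intros t Ht. apply (cderiv_ext (fun z => Ci * A1 z)); [intros z; ring|].
      eapply cderiv_eq; [|apply cderiv_scal, H2; now rewrite Im_Ci_RtoC]. ring. }
    apply (is_RInt_fct_extend_pair (U := R_NormedModule) (V := R_NormedModule)).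
    - change (is_RInt (fun t : R => Re (A1 (Ci * RtoC t) * Ci)) x y
        (minus (Re (A (Ci * RtoC y))) (Re (A (Ci * RtoC x))))).
      apply (is_RInt_derive (V := R_CompleteNormedModule) (fun t : R => Re (A (Ci * RtoC t)))).
      + intros t [Ht _]. apply Hr; [auto|]. apply H1. rewrite Im_Ci_RtoC. auto.
      + intros t [Ht _]. apply (ex_derive_continuous (fun t : R => Re (A1 (Ci * RtoC t) * Ci))).
        exact (ex_intro _ _ (proj1 (Hr (fun z => A1 z * Ci) (fun z => A2 z * Ci) t (Hpos t Ht) (Hc t (Hpos t Ht))))).
    - change (is_RInt (fun t : R => Im (A1 (Ci * RtoC t) * Ci)) x y
        (minus (Im (A (Ci * RtoC y))) (Im (A (Ci * RtoC x))))).
      apply (is_RInt_derive (V := R_CompleteNormedModule) (fun t : R => Im (A (Ci * RtoC t)))).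
      + intros t [Ht _]. apply Hr; [auto|]. apply H1. rewrite Im_Ci_RtoC. auto.
      + intros t [Ht _]. apply (ex_derive_continuous (fun t : R => Im (A1 (Ci * RtoC t) * Ci))).
        exact (ex_intro _ _ (proj2 (Hr (fun z => A1 z * Ci) (fun z => A2 z * Ci) t (Hpos t Ht) (Hc t (Hpos t Ht))))). }
  apply is_RInt_gen_unique. intros P HP.
  assert (LP : filterlim (U := C_UniformSpace) (fun ab : R * R => A (Ci * RtoC (snd ab)) - A (Ci * RtoC (fst ab)))
    (filter_prod (at_right 0) (Rbar_locally p_infty)) (locally (T := C_UniformSpace) (- A0))).
  { apply tendsto_filterlim. replace (- A0) with (0 - A0) by ring. apply tendsto_minus.
    - intros eps He. exists (fun _ => True) (fun t : R => (Cmod (A (Ci * RtoC t)%C - 0) < eps)%R);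
        [apply filter_true|now apply Li|easy].
    - intros eps He. exists (fun t : R => (Cmod (A (Ci * RtoC t)%C - A0) < eps)%R) (fun _ => True);
        [now apply L0|apply filter_true|easy]. }
  assert (Q : filter_prod (at_right 0) (Rbar_locally p_infty) (fun ab => (0 < fst ab)%R /\ (0 < snd ab)%R)).
  { exists (fun t : R => (0 < t)%R) (fun t : R => (0 < t)%R); [apply at_right_0_pos| |easy].
    exists 0%R. easy. }
  specialize (LP P HP). unfold filtermap in LP. unfold filtermapi.
  generalize (filter_and _ _ LP Q). apply filter_imp. intros [x y] [h1 [h2 h3]].
  exists (A (Ci * RtoC y) - A (Ci * RtoC x)). split; [now apply HI|exact h1].
Qed.

Lemma cderiv_sqr (z : C) : cderiv (fun x => x * x) z (2 * z).
Proof.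
  eapply cderiv_eq; [|apply (cderiv_mult (fun x => x) (fun x => x)); apply cderiv_id]. ring.
Qed.

Section LValues.
Context (b : nat -> C) (Hb : disc_coefs b).

Let Hderiv j tau (Ht : (0 < Im tau)%R) := cderiv_eichler b j tau Hb Ht.

Lemma eichler_infinity (k j : nat) (z : R -> C) : (k <= 2)%nat -> (forall t, Im (z t) = t) ->
  tendsto (Rbar_locally p_infty) (fun t => (Ci * RtoC t) ^ k * eichler b j (z t)) 0.
Proof.
  intros Hk Hz. apply qsum_decay_infinity; [now apply eichler_disc_summable|intros i; lia|easy|easy].
Qed.

(** Abel's theorem for the Dirichlet series. *)
Lemma dirichlet_series_abel (s : nat) (e : C) :
  tendsto (at_right 0) (fun t => eichler b s (Ci * RtoC t)) e ->
  ex_series (fun k => Cmod (dirichlet_term b s k)) -> C_Series (dirichlet_term b s) = e.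
Proof.
  intros He Hex.
  assert (Hs : summable (fun k => Cmod (dirichlet_term b s k))).
  { apply ex_series_summable; [intros n; apply Cmod_ge_0|easy]. }
  destruct (summable_has_sum _ _ (fun k => Rle_refl _) Hs) as [v Hv].
  rewrite (C_Series_unique _ _ (has_sum_nat_tendsto _ _ Hv)).
  refine (tendsto_unique (F := at_right 0) _ _ _ _ He).
  apply (has_sum_tannery (F := at_right 0) (fun t k => dirichlet_term b s k * nome (Ci * RtoC t) ^ S k)
    (dirichlet_term b s) (fun k => Cmod (dirichlet_term b s k)) _ v).
  - exact Hs.
  - generalize at_right_0_pos. apply filter_imp. intros t Ht k.
    rewrite Cmod_mult, Cmod_pow. rewrite <- (Rmult_1_r (Cmod (dirichlet_term b s k))) at 2.
    apply Rmult_le_compat_l; [apply Cmod_ge_0|].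
    rewrite <- (pow1 (S k)). apply pow_incr. split; [apply Cmod_ge_0|].
    apply Rlt_le, Cmod_nome_lt_1. now rewrite Im_Ci_RtoC.
  - intros k. lra.
  - intros k.
    assert (L : tendsto (at_right 0) (fun t => dirichlet_term b s k * nome (RtoC (INR (S k)) * (Ci * RtoC t)))
      (dirichlet_term b s k * nome (RtoC (INR (S k)) * (Ci * 0)))).
    { apply tendsto_scal. apply (tendsto_comp nome _ _ _ (cderiv_nome _)).
      apply tendsto_scal, tendsto_scal, tendsto_at_right_0_id. }
    replace (RtoC (INR (S k)) * (Ci * 0)) with (RtoC 0) in L by ring.
    rewrite nome_0, Cmult_1_r in L. revert L. apply tendsto_ext. intros t. now rewrite nome_mul_nat.
  - generalize at_right_0_pos. apply filter_imp. intros t Ht.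
    apply (qsum_correct _ _ _ (eichler_disc_summable b s Hb)). now rewrite Im_Ci_RtoC.
  - exact Hv.
Qed.

(** Two integrations by parts in the Mellin integral give the primitive
    [- tau E_1 / c + E_2 / c^2], with [c = 2 pi i] and [E_j] the series with coefficients
    [b_n / n^j]; only its value at 0 contributes. *)
Lemma L_value_2_limit (e : C) :
  tendsto (at_right 0) (fun t => eichler b 2 (Ci * RtoC t)) e ->
  tendsto (at_right 0) (fun t => RtoC t * eichler b 1 (Ci * RtoC t)) 0 ->
  L_value b 2 = e.
Proof.
  intros L2 L1. unfold L_value.
  destruct (excluded_middle_informative _) as [Hex|_]; [now apply dirichlet_series_abel|].
  set (c := RtoC (2 * PI) * Ci).
  assert (Hp : RtoC (2 * PI) <> 0) by (intros E; apply RtoC_inj in E; pose proof PI_RGT_0; lra).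
  assert (Hc : c <> 0) by (apply Cmult_neq_0; [easy|apply Ci_nz]).
  unfold mellin_L.
  rewrite (RInt_gen_imaginary_axis _
    (fun tau => / (c * c) * eichler b 2 tau - / c * (tau * eichler b 1 tau))
    (fun tau => - (1) * (tau * eichler b 0 tau))
    (fun tau => - (1) * (1 * eichler b 0 tau + tau * (c * qsum (fun k => RtoC (INR (S k)) * (b (S k) / RtoC (INR (S k)) ^ 0)) S tau)))
    (/ (c * c) * e)).
  - simpl (fact _). simpl (INR 1). replace ((2 * PI) ^ 2 / 1)%R with ((2 * PI) ^ 2)%R by field.
    rewrite RtoC_pow. transitivity (- (RtoC (2 * PI) ^ 2 / (RtoC (2 * PI) ^ 2 * (Ci * Ci))) * e).
    + unfold c. field. split; [apply Ci_nz|easy].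
    + rewrite Ci_sqr. field. easy.
  - intros tau Ht. eapply cderiv_eq; [|apply cderiv_minus; apply cderiv_scal;
      [now apply Hderiv|apply cderiv_mult; [apply cderiv_id|now apply Hderiv]]].
    cbv beta. fold c. field. easy.
  - intros tau Ht. apply cderiv_scal, cderiv_mult; [apply cderiv_id|].
    apply (cderiv_qsum _ _ _ (eichler_disc_summable b 0 Hb) Ht).
  - intros t Ht. rewrite q_series_eichler by (rewrite ?Im_Ci_RtoC; easy).
    simpl (t ^ (2 - 1))%R. rewrite Rmult_1_r.
    transitivity (- (Ci * Ci) * RtoC t * eichler b 0 (Ci * RtoC t)); [rewrite Ci_sqr; ring|ring].
  - replace (/ (c * c) * e) with (/ (c * c) * e - / c * Ci * 0) by ring.
    apply tendsto_minus; [now apply tendsto_scal|].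
    apply (tendsto_scal (/ c * Ci)) in L1. revert L1. apply tendsto_ext. intros t. ring.
  - replace (RtoC 0) with (/ (c * c) * 0 - / c * 0) by ring.
    apply tendsto_minus; apply tendsto_scal.
    + generalize (eichler_infinity 0 2 _ ltac:(lia) Im_Ci_RtoC). apply tendsto_ext. intros t. simpl. ring.
    + generalize (eichler_infinity 1 1 _ ltac:(lia) Im_Ci_RtoC). apply tendsto_ext. intros t. simpl. ring.
Qed.

(** As for the argument 2, with the primitive
    [i (tau^2 E_1 / c - 2 tau E_2 / c^2 + 2 E_3 / c^3)]. *)
Lemma L_value_3_limit (e : C) :
  tendsto (at_right 0) (fun t => eichler b 3 (Ci * RtoC t)) e ->
  tendsto (at_right 0) (fun t => RtoC t * eichler b 2 (Ci * RtoC t)) 0 ->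
  tendsto (at_right 0) (fun t => RtoC t * eichler b 1 (Ci * RtoC t)) 0 ->
  L_value b 3 = e.
Proof.
  intros L3 L2 L1. unfold L_value.
  destruct (excluded_middle_informative _) as [Hex|_]; [now apply dirichlet_series_abel|].
  set (c := RtoC (2 * PI) * Ci).
  assert (Hp : RtoC (2 * PI) <> 0) by (intros E; apply RtoC_inj in E; pose proof PI_RGT_0; lra).
  assert (Hc : c <> 0) by (apply Cmult_neq_0; [easy|apply Ci_nz]).
  unfold mellin_L.
  rewrite (RInt_gen_imaginary_axis _
    (fun tau => Ci / c * (tau * tau * eichler b 1 tau) - 2 * Ci / (c * c) * (tau * eichler b 2 tau)
       + 2 * Ci / (c * c * c) * eichler b 3 tau)
    (fun tau => Ci * (tau * tau * eichler b 0 tau))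
    (fun tau => Ci * (2 * tau * eichler b 0 tau + tau * tau * (c * qsum (fun k => RtoC (INR (S k)) * (b (S k) / RtoC (INR (S k)) ^ 0)) S tau)))
    (2 * Ci / (c * c * c) * e)).
  - replace (INR (fact (3 - 1))) with 2%R by (simpl; ring).
    rewrite RtoC_div, RtoC_pow by lra.
    transitivity (- (RtoC (2 * PI) ^ 3 / (RtoC (2 * PI) ^ 3 * (Ci * Ci))) * e).
    + unfold c. field. repeat split; nz.
    + rewrite Ci_sqr. field. easy.
  - intros tau Ht. eapply cderiv_eq; [|apply cderiv_plus; [apply cderiv_minus|]; apply cderiv_scal;
      [apply (cderiv_mult (fun x => x * x)); [apply cderiv_sqr|now apply Hderiv]
      |apply cderiv_mult; [apply cderiv_id|now apply Hderiv]|now apply Hderiv]].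
    cbv beta. fold c. field. easy.
  - intros tau Ht. apply cderiv_scal, (cderiv_mult (fun x => x * x)); [apply cderiv_sqr|].
    apply (cderiv_qsum _ _ _ (eichler_disc_summable b 0 Hb) Ht).
  - intros t Ht. rewrite q_series_eichler by (rewrite ?Im_Ci_RtoC; easy).
    simpl (t ^ (3 - 1))%R. rewrite Rmult_1_r, RtoC_mult.
    transitivity ((Ci * Ci) * (Ci * Ci) * (RtoC t * RtoC t) * eichler b 0 (Ci * RtoC t)); [rewrite Ci_sqr; ring|ring].
  - replace (2 * Ci / (c * c * c) * e) with
      (Ci / c * (Ci * Ci * (0 * 0)) - 2 * Ci / (c * c) * (Ci * 0) + 2 * Ci / (c * c * c) * e) by ring.
    apply tendsto_plus; [apply tendsto_minus|]; apply tendsto_scal; [| |easy].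
    + apply (tendsto_scal (Ci * Ci)) in L1.
      assert (L1' := tendsto_mult _ _ _ _ tendsto_at_right_0_id L1).
      replace (Ci * Ci * (0 * 0)) with (0 * (Ci * Ci * 0)) by ring.
      revert L1'. apply tendsto_ext. intros t. ring.
    + apply (tendsto_scal Ci) in L2. revert L2. apply tendsto_ext. intros t. ring.
  - replace (RtoC 0) with (Ci / c * 0 - 2 * Ci / (c * c) * 0 + 2 * Ci / (c * c * c) * 0) by ring.
    apply tendsto_plus; [apply tendsto_minus|]; apply tendsto_scal.
    + generalize (eichler_infinity 2 1 _ ltac:(lia) Im_Ci_RtoC). apply tendsto_ext. intros t. simpl. ring.
    + generalize (eichler_infinity 1 2 _ ltac:(lia) Im_Ci_RtoC). apply tendsto_ext. intros t. simpl. ring.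
    + generalize (eichler_infinity 0 3 _ ltac:(lia) Im_Ci_RtoC). apply tendsto_ext. intros t. simpl. ring.
Qed.

End LValues.

(** * Period polynomials *)

Lemma tendsto_bounded (u : nat -> C) l : tendsto eventually u l ->
  exists M, (0 < M)%R /\ forall n, (Cmod (u n) <= M)%R.
Proof.
  intros H. destruct (H 1%R Rlt_0_1) as [N HN].
  pose proof (rsum_nonneg (fun n => Cmod (u n)) (seq 0 (S N)) (fun n => Cmod_ge_0 _)) as P.
  pose proof (Cmod_ge_0 l).
  exists (1 + Cmod l + rsum (fun n => Cmod (u n)) (seq 0 (S N)))%R. split; [lra|]. intros n.
  destruct (le_lt_dec n N) as [h|h].
  - assert (B : (rsum (fun n => Cmod (u n)) (n :: nil) <= rsum (fun n => Cmod (u n)) (seq 0 (S N)))%R).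
    { apply rsum_incl; [intros; apply Cmod_ge_0|repeat constructor; easy|].
      intros i [<-|[]]. apply in_seq. lia. }
    simpl rsum at 1 in B. lra.
  - pose proof (HN n ltac:(lia)) as H1. cbv beta in H1. pose proof (Cmod_diff_le (u n) l). lra.
Qed.

Lemma terms_bounded (u : nat -> C) (l : C) :
  tendsto eventually (fun n => sum_n u n) l -> exists M, forall n, (Cmod (u n) <= M)%R.
Proof.
  intros H. destruct (tendsto_bounded _ _ H) as [M [HM B]]. exists (M + M)%R. intros [|n].
  - pose proof (B O) as B0. rewrite sum_O in B0. lra.
  - pose proof (B n) as B0. pose proof (B (S n)) as B1. rewrite sum_Sn in B1.
    change plus with Cplus in B1.
    pose proof (Cmod_diff_le (u (S n)) (- sum_n u n)) as T. rewrite Cmod_opp in T.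
    replace (u (S n) - - sum_n u n) with (sum_n u n + u (S n)) in T by ring. lra.
Qed.

(** Convergence at points of the imaginary axis arbitrarily near 0 forces absolute
    convergence on the whole disc. *)
Lemma q_expansion_coefs (f : C -> C) (a : nat -> C) :
  is_q_expansion f a -> disc_coefs a /\ forall tau, (0 < Im tau)%R -> eichler a 0 tau = f tau.
Proof.
  intros Ha.
  assert (Hd : disc_coefs a).
  { intros r Hr. set (rho := ((1 + r) / 2)%R). assert (Hrho : (r < rho < 1)%R) by (unfold rho; lra).
    set (t := (- ln rho / (2 * PI))%R).
    assert (Hln : (ln rho < 0)%R) by (rewrite <- ln_1; apply ln_increasing; lra).
    pose proof PI_RGT_0 as Hpi.
    assert (Ht : (0 < Im (Ci * RtoC t))%R).
    { rewrite Im_Ci_RtoC. apply Rdiv_lt_0_compat; lra. }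
    assert (Hq : Cmod (nome (Ci * RtoC t)) = rho).
    { rewrite Cmod_nome, Im_Ci_RtoC. unfold t.
      replace (- (2 * PI * (- ln rho / (2 * PI))))%R with (ln rho) by (field; lra). apply exp_ln. lra. }
    pose proof (filterlim_tendsto _ _ (Ha _ Ht)) as L.
    destruct (terms_bounded _ _ L) as [M HM].
    apply (summable_le _ (fun k => (M * (r / rho) ^ k)%R)).
    - intros k. assert (P : (0 <= r ^ S k)%R) by (apply pow_le; lra).
      split; [apply Rmult_le_pos; [apply Cmod_ge_0|easy]|].
      specialize (HM k). rewrite Cmod_mult, Cmod_pow, Hq in HM.
      assert (Hpk : (0 < rho ^ S k)%R) by (apply pow_lt; lra).
      replace (r ^ S k)%R with ((r / rho) ^ S k * rho ^ S k)%R
        by (rewrite <- Rpow_mult_distr; f_equal; field; lra).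
      assert (Hx : (0 <= r / rho <= 1)%R).
      { split; [apply Rmult_le_pos; [lra|left; apply Rinv_0_lt_compat; lra]|].
        apply (Rmult_le_reg_r rho); [lra|]. unfold Rdiv. rewrite Rmult_assoc, Rinv_l by lra. lra. }
      assert (Hy : (0 <= (r / rho) ^ S k <= (r / rho) ^ k)%R).
      { split; [now apply pow_le|]. simpl. assert (0 <= (r / rho) ^ k)%R by now apply pow_le. nra. }
      pose proof (Cmod_ge_0 (a (S k))).
      replace (Cmod (a (S k)) * ((r / rho) ^ S k * rho ^ S k))%R
        with ((Cmod (a (S k)) * rho ^ S k) * (r / rho) ^ S k)%R by ring.
      apply Rmult_le_compat; try easy. apply Rmult_le_pos; lra.
    - apply summable_scal.
      + eapply Rle_trans; [apply Cmod_ge_0|apply (HM O)].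
      + apply summable_geometric. split; [apply Rmult_le_pos; [lra|left; apply Rinv_0_lt_compat; lra]|].
        apply (Rmult_lt_reg_r rho); [lra|]. unfold Rdiv. rewrite Rmult_assoc, Rinv_l by lra. lra. }
  split; [easy|]. intros tau Ht.
  pose proof (filterlim_tendsto _ _ (Ha _ Ht)) as L.
  refine (tendsto_unique (F := eventually) _ _ _ _ L).
  apply has_sum_nat_tendsto.
  refine (has_sum_ext _ _ _ _ (qsum_correct _ _ _ (eichler_disc_summable a 0 Hd) Ht)).
  intros k. simpl (_ ^ 0). unfold Cdiv. replace (/ 1) with (RtoC 1) by (field; nz). ring.
Qed.

Lemma quadratic_of_zero_third_deriv (K K1 K2 : C -> C) :
  (forall w, (0 < Im w)%R -> cderiv K w (K1 w)) ->
  (forall w, (0 < Im w)%R -> cderiv K1 w (K2 w)) ->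
  (forall w, (0 < Im w)%R -> cderiv K2 w 0) ->
  exists k0 k1 k2, forall w, (0 < Im w)%R ->
    K w = k0 + k1 * w + k2 * (w * w) /\ K1 w = k1 + 2 * k2 * w /\ K2 w = 2 * k2.
Proof.
  intros H0 H1 H2.
  assert (HC : (0 < Im Ci)%R) by (simpl; lra).
  set (k2 := K2 Ci / 2).
  assert (E2 : forall w, (0 < Im w)%R -> K2 w = 2 * k2).
  { intros w Hw. rewrite (zero_deriv_const K2 H2 w Ci Hw HC). unfold k2. field. all: nz. }
  set (k1 := K1 Ci - 2 * k2 * Ci).
  assert (E1 : forall w, (0 < Im w)%R -> K1 w = k1 + 2 * k2 * w).
  { intros w Hw.
    assert (E : K1 w - 2 * k2 * w = k1); [|rewrite <- E; ring].
    apply (zero_deriv_const (fun w => K1 w - 2 * k2 * w)); try easy. intros z Hz.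
    eapply cderiv_eq; [|apply cderiv_minus; [apply H1, Hz|apply (cderiv_scal _ (fun x => x)), cderiv_id]].
    rewrite E2 by easy. ring. }
  exists (K Ci - k1 * Ci - k2 * (Ci * Ci)), k1, k2. intros w Hw. repeat split; auto.
  assert (E : K w - k1 * w - k2 * (w * w) = K Ci - k1 * Ci - k2 * (Ci * Ci)); [|rewrite <- E; ring].
  apply (zero_deriv_const (fun w => K w - k1 * w - k2 * (w * w))); try easy. intros z Hz.
  eapply cderiv_eq; [|apply cderiv_minus; [apply cderiv_minus; [apply H0, Hz|apply (cderiv_scal _ (fun x => x)), cderiv_id]
    |apply (cderiv_scal _ (fun x => x * x)), cderiv_sqr]].
  rewrite E1 by easy. ring.
Qed.

Lemma quadratic_coefs (A B D : C) :
  (forall w, (0 < Im w)%R -> A + B * w + D * (w * w) = 0) -> A = 0 /\ B = 0 /\ D = 0.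
Proof.
  intros H.
  assert (H1 := H (Ci * RtoC 1) ltac:(rewrite Im_Ci_RtoC; lra)).
  assert (H2 := H (Ci * RtoC 2) ltac:(rewrite Im_Ci_RtoC; lra)).
  assert (H3 := H (Ci * RtoC 3) ltac:(rewrite Im_Ci_RtoC; lra)).
  assert (S : forall x : R, A + B * (Ci * RtoC x) + D * (Ci * RtoC x * (Ci * RtoC x))
    = A + B * (Ci * RtoC x) - D * (RtoC x * RtoC x)).
  { intros x. replace (Ci * RtoC x * (Ci * RtoC x)) with (Ci * Ci * (RtoC x * RtoC x)) by ring.
    rewrite Ci_sqr. ring. }
  rewrite S in H1, H2, H3.
  assert (HD : D = 0).
  { transitivity (- / 2 * ((A + B * (Ci * 3) - D * (3 * 3)) - 2 * (A + B * (Ci * 2) - D * (2 * 2))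
      + (A + B * (Ci * 1) - D * (1 * 1)))); [field; nz|]. rewrite H1, H2, H3. ring. }
  rewrite HD in *.
  assert (HB : B = 0).
  { transitivity (/ Ci * ((A + B * (Ci * 2) - 0 * (2 * 2)) - (A + B * (Ci * 1) - 0 * (1 * 1)))); [field; nz|].
    rewrite H1, H2. ring. }
  rewrite HB in *. repeat split. rewrite <- H1. ring.
Qed.

Section Bol.
Context (a : nat -> C) (Ha : disc_coefs a).

Let c : C := RtoC (2 * PI) * Ci.
Let F (j : nat) : C -> C := eichler a j.

Lemma two_pi_i_neq_0 : RtoC (2 * PI) * Ci <> 0.
Proof.
  apply Cmult_neq_0; [|apply Ci_nz]. intros E. apply RtoC_inj in E. pose proof PI_RGT_0. lra.
Qed.

Definition involute (r N : R) (w : C) : C := RtoC r - / (RtoC N * w).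

Lemma Im_involute r N w : (0 < N)%R -> (0 < Im w)%R -> (0 < Im (involute r N w))%R.
Proof.
  intros HN Hw. unfold involute, Cminus. rewrite im_plus. simpl (Im (RtoC r)). rewrite Rplus_0_l.
  apply Im_opp_inv_pos. now apply Im_mul_pos.
Qed.

Lemma cderiv_involute r N w : (0 < N)%R -> (0 < Im w)%R ->
  cderiv (involute r N) w (/ (RtoC N * (w * w))).
Proof.
  intros HN Hw. pose proof (Im_pos_neq_0 _ Hw) as H0.
  assert (HNC : RtoC N <> 0) by (intros E; apply RtoC_inj in E; lra).
  apply (cderiv_ext_loc (fun x => RtoC r - / RtoC N * / x)).
  - pose proof (proj1 (Cmod_gt_0 w) H0) as Hp.
    exists (Cmod w). split; [easy|]. intros h Hh. unfold involute.
    assert (w + h <> 0).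
    { intros E. replace h with (- w) in Hh.
      - rewrite Cmod_opp in Hh. lra.
      - rewrite <- (Cplus_0_r (- w)), <- E. ring. }
    field. auto.
  - eapply cderiv_eq; [|apply cderiv_minus; [apply cderiv_const|apply cderiv_scal, cderiv_inv, H0]].
    field. auto.
Qed.

Lemma cderiv_shift (f : C -> C) (r w l : C) :
  cderiv f (r + w) l -> cderiv (fun x => f (r + x)) w l.
Proof.
  intros H. eapply cderiv_eq; [|apply (cderiv_comp f (fun x => r + x) w l (0 + 1) H)].
  - ring.
  - apply cderiv_plus; [apply cderiv_const|apply cderiv_id].
Qed.

(** The three identities are one period relation for the Eichler integral and
    its first two derivatives: by Bol's identity the third derivative of the
    left side is the weight four law for the series itself. The two free
    coefficients are what the involution leaves of a quadratic polynomial. *)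
Definition period_relations (r N : R) (p0 p1 : C) : Prop :=
  forall w, (0 < Im w)%R ->
    RtoC N * (w * w) * F 3 (involute r N w) - F 3 (RtoC r + w)
      = p0 + p1 * w - RtoC N * p0 * (w * w) /\
    2 * RtoC N * w * F 3 (involute r N w) + c * F 2 (involute r N w) - c * F 2 (RtoC r + w)
      = p1 - 2 * RtoC N * p0 * w /\
    2 * RtoC N * F 3 (involute r N w) + 2 * c / w * F 2 (involute r N w)
      + c * c / (RtoC N * (w * w)) * F 1 (involute r N w) - c * c * F 1 (RtoC r + w)
      = - (2) * RtoC N * p0.

(** The defect is a quadratic polynomial because its third derivative vanishes.
    Applying the involution to the defect changes its sign, which ties the coefficient
    of [w^2] to the constant one. *)
Lemma period_relations_exist (r N : R) : (1 < N)%R -> involution_law (F 0) r N ->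
  exists p0 p1, period_relations r N p0 p1.
Proof.
  intros HN law.
  assert (HNC : RtoC N <> 0) by (intros E; apply RtoC_inj in E; lra).
  assert (Dg : forall j w, (0 < Im w)%R ->
    cderiv (fun w => F (S j) (involute r N w)) w (c * F j (involute r N w) * / (RtoC N * (w * w)))).
  { intros j w Hw. apply (cderiv_comp (F (S j)) (involute r N)); [|apply cderiv_involute; lra].
    apply cderiv_eichler; [easy|]. apply Im_involute; lra. }
  assert (Dr : forall j w, (0 < Im w)%R -> cderiv (fun w => F (S j) (RtoC r + w)) w (c * F j (RtoC r + w))).
  { intros j w Hw. apply cderiv_shift. apply cderiv_eichler; [easy|].
    rewrite im_plus. simpl (Im (RtoC r)). lra. }
  destruct (quadratic_of_zero_third_deriv
    (fun w => RtoC N * (w * w * F 3 (involute r N w)) - F 3 (RtoC r + w))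
    (fun w => 2 * RtoC N * (w * F 3 (involute r N w)) + c * F 2 (involute r N w) - c * F 2 (RtoC r + w))
    (fun w => 2 * RtoC N * F 3 (involute r N w) + 2 * c * (/ w * F 2 (involute r N w))
       + c * c / RtoC N * (/ w * / w * F 1 (involute r N w)) - c * c * F 1 (RtoC r + w)))
    as [k0 [k1 [k2 HK]]].
  - intros w Hw. pose proof (Im_pos_neq_0 _ Hw).
    eapply cderiv_eq; [|apply cderiv_minus; [apply cderiv_scal, (cderiv_mult (fun x => x * x));
      [apply cderiv_sqr|now apply Dg]|now apply Dr]].
    cbv beta. field. auto.
  - intros w Hw. pose proof (Im_pos_neq_0 _ Hw).
    eapply cderiv_eq; [|apply cderiv_minus; [apply cderiv_plus; apply cderiv_scal;
      [apply (cderiv_mult (fun x => x)); [apply cderiv_id|now apply Dg]|now apply Dg]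
      |apply cderiv_scal; now apply Dr]].
    cbv beta. field. auto.
  - intros w Hw. pose proof (Im_pos_neq_0 _ Hw) as H0.
    eapply cderiv_eq; [|apply cderiv_minus; [apply cderiv_plus; [apply cderiv_plus|]; apply cderiv_scal;
      [now apply Dg|apply cderiv_mult; [now apply cderiv_inv|now apply Dg]
      |apply (cderiv_mult (fun x => / x * / x)); [apply (cderiv_mult (fun x => / x) (fun x => / x)); now apply cderiv_inv|now apply Dg]]
      |apply cderiv_scal; now apply Dr]].
    cbv beta. specialize (law w Hw). fold (involute r N w) in law. rewrite law. field. auto.
  - assert (I : forall w, (0 < Im w)%R ->
      RtoC N * (w * w) * (k0 + k1 * - / (RtoC N * w) + k2 * (/ (RtoC N * w) * / (RtoC N * w)))
        = - (k0 + k1 * w + k2 * (w * w))).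
    { intros w Hw. pose proof (Im_pos_neq_0 _ Hw) as H0.
      assert (Hw' : (0 < Im (- / (RtoC N * w)))%R) by (apply Im_opp_inv_pos, Im_mul_pos; lra).
      pose proof (proj1 (HK w Hw)) as E1. pose proof (proj1 (HK _ Hw')) as E2.
      replace (- / (RtoC N * w) * - / (RtoC N * w)) with (/ (RtoC N * w) * / (RtoC N * w)) in E2 by ring.
      rewrite <- E1, <- E2.
      replace (involute r N (- / (RtoC N * w))) with (RtoC r + w) by (unfold involute; field; auto).
      replace (RtoC r + - / (RtoC N * w)) with (involute r N w) by (unfold involute; ring).
      field. auto. }
    assert (Q := quadratic_coefs (k0 + k2 / RtoC N) 0 (RtoC N * k0 + k2)).
    destruct Q as [_ [_ Q]].
    { intros w Hw. pose proof (Im_pos_neq_0 _ Hw) as H0.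
      transitivity (RtoC N * (w * w) * (k0 + k1 * - / (RtoC N * w) + k2 * (/ (RtoC N * w) * / (RtoC N * w)))
        + (k0 + k1 * w + k2 * (w * w))); [field; auto|]. rewrite I by easy. ring. }
    assert (Ek2 : k2 = - (RtoC N * k0)).
    { transitivity (RtoC N * k0 + k2 - RtoC N * k0); [ring|]. rewrite Q. ring. }
    exists k0, k1. intros w Hw. pose proof (Im_pos_neq_0 _ Hw) as H0.
    destruct (HK w Hw) as [E0 [E1 E2]]. rewrite Ek2 in *. repeat split.
    + transitivity (k0 + k1 * w + - (RtoC N * k0) * (w * w)); [rewrite <- E0; ring|ring].
    + transitivity (k1 + 2 * - (RtoC N * k0) * w); [rewrite <- E1; ring|ring].
    + transitivity (2 * - (RtoC N * k0)); [rewrite <- E2; field; auto|ring].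
Qed.

Lemma tendsto_at_right_0_inv (u : R -> C) (l : C) (N : R) : (0 < N)%R ->
  tendsto (Rbar_locally p_infty) u l -> tendsto (at_right 0) (fun t => u (/ (N * t))%R) l.
Proof.
  intros HN H eps He. destruct (H eps He) as [M HM].
  assert (Hm : (0 < 1 + Rabs M)%R) by (pose proof (Rabs_pos M); lra).
  apply (at_right_0_intro _ (/ (N * (1 + Rabs M)))).
  { apply Rinv_0_lt_compat. now apply Rmult_lt_0_compat. }
  intros t Ht. apply HM. pose proof (Rle_abs M).
  apply Rlt_trans with (1 + Rabs M)%R; [lra|].
  rewrite <- (Rinv_inv (1 + Rabs M)). apply Rinv_lt_contravar.
  - apply Rmult_lt_0_compat; [now apply Rmult_lt_0_compat|now apply Rinv_0_lt_compat].
  - destruct Ht as [_ Ht]. apply (Rmult_lt_compat_l N) in Ht; [|easy].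
    rewrite Rinv_mult, <- Rmult_assoc, Rinv_r, Rmult_1_l in Ht by lra. easy.
Qed.

(** As [w] tends to 0 along the imaginary direction, the involuted point tends to the
    cusp at infinity, where the series decays faster than any power of [w]. *)
Lemma period_boundary_values (r N : R) (p0 p1 : C) : (1 < N)%R -> period_relations r N p0 p1 ->
  tendsto (at_right 0) (fun t => F 3 (RtoC r + Ci * RtoC t)) (- p0) /\
  tendsto (at_right 0) (fun t => F 2 (RtoC r + Ci * RtoC t)) (- p1 / c) /\
  tendsto (at_right 0) (fun t => RtoC t * F 1 (RtoC r + Ci * RtoC t)) 0.
Proof.
  intros HN H.
  assert (HNC : RtoC N <> 0) by (intros E; apply RtoC_inj in E; lra).
  assert (Hc : c <> 0) by apply two_pi_i_neq_0.
  assert (D : forall k j, (k <= 2)%nat ->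
    tendsto (at_right 0) (fun t => (Ci * / (RtoC N * RtoC t)) ^ k * F j (involute r N (Ci * RtoC t))) 0).
  { intros k j Hk.
    assert (L := eichler_infinity a Ha k j (fun t => RtoC r + Ci * RtoC t) Hk).
    assert (L' : tendsto (Rbar_locally p_infty) (fun t => (Ci * RtoC t) ^ k * eichler a j (RtoC r + Ci * RtoC t)) 0).
    { apply L. intros t. rewrite im_plus, Im_Ci_RtoC. simpl. ring. }
    apply (tendsto_at_right_0_inv _ _ N ltac:(lra)) in L'. revert L'. apply tendsto_ext_loc.
    generalize at_right_0_pos. apply filter_imp. intros t Ht.
    assert (Htc : RtoC t <> 0) by (intros E; apply RtoC_inj in E; lra).
    rewrite RtoC_inv, RtoC_mult by (apply Rmult_integral_contrapositive_currified; lra).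
    f_equal. unfold F. f_equal. unfold involute.
    transitivity (RtoC r + (Ci * Ci) / (RtoC N * (Ci * RtoC t))); [field; repeat split; nz|].
    rewrite Ci_sqr. field. repeat split; nz. }
  assert (Lt := tendsto_at_right_0_id).
  assert (Pos : at_right 0 (fun t => (0 < t)%R)) by apply at_right_0_pos.
  assert (L0 : forall j, tendsto (at_right 0) (fun t => F j (involute r N (Ci * RtoC t))) 0).
  { intros j. generalize (D 0%nat j ltac:(lia)). apply tendsto_ext. intros t. simpl. ring. }
  assert (Lw : tendsto (at_right 0) (fun t => Ci * RtoC t) 0).
  { apply (tendsto_scal Ci) in Lt. now replace (Ci * 0) with (RtoC 0) in Lt by ring. }
  repeat split.
  - assert (L : tendsto (at_right 0) (fun t => RtoC N * (Ci * RtoC t * (Ci * RtoC t)) * F 3 (involute r N (Ci * RtoC t))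
      - (p0 + p1 * (Ci * RtoC t) - RtoC N * p0 * (Ci * RtoC t * (Ci * RtoC t))))
      (RtoC N * (0 * 0) * 0 - (p0 + p1 * 0 - RtoC N * p0 * (0 * 0)))).
    { apply tendsto_minus; [apply tendsto_mult; [apply tendsto_scal, tendsto_mult; easy|apply L0]|].
      apply tendsto_minus; [apply tendsto_plus; [apply tendsto_const|now apply tendsto_scal]|].
      apply tendsto_scal, tendsto_mult; easy. }
    replace (RtoC N * (0 * 0) * 0 - (p0 + p1 * 0 - RtoC N * p0 * (0 * 0))) with (- p0) in L by ring.
    revert L. apply tendsto_ext_loc. generalize Pos. apply filter_imp. intros t Ht.
    destruct (H (Ci * RtoC t)) as [E _]; [now rewrite Im_Ci_RtoC|]. rewrite <- E. ring.
  - assert (L : tendsto (at_right 0) (fun t => 2 * RtoC N / c * (Ci * RtoC t * F 3 (involute r N (Ci * RtoC t)))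
      + F 2 (involute r N (Ci * RtoC t)) - / c * (p1 - 2 * RtoC N * p0 * (Ci * RtoC t)))
      (2 * RtoC N / c * (0 * 0) + 0 - / c * (p1 - 2 * RtoC N * p0 * 0))).
    { apply tendsto_minus; [apply tendsto_plus; [apply tendsto_scal, tendsto_mult; [easy|apply L0]|apply L0]|].
      apply tendsto_scal, tendsto_minus; [apply tendsto_const|now apply tendsto_scal]. }
    replace (2 * RtoC N / c * (0 * 0) + 0 - / c * (p1 - 2 * RtoC N * p0 * 0)) with (- p1 / c) in L by (field; easy).
    revert L. apply tendsto_ext_loc. generalize Pos. apply filter_imp. intros t Ht.
    destruct (H (Ci * RtoC t)) as [_ [E _]]; [now rewrite Im_Ci_RtoC|]. rewrite <- E. field. easy.
  - assert (L : tendsto (at_right 0) (fun t => / (c * c) * (RtoC t * (2 * RtoC N * F 3 (involute r N (Ci * RtoC t)) + 2 * RtoC N * p0)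
      + 2 * c * / Ci * F 2 (involute r N (Ci * RtoC t))
      + c * c * / (Ci * Ci * Ci) * ((Ci * / (RtoC N * RtoC t)) ^ 1 * F 1 (involute r N (Ci * RtoC t)))))
      (/ (c * c) * (0 * (2 * RtoC N * 0 + 2 * RtoC N * p0) + 2 * c * / Ci * 0 + c * c * / (Ci * Ci * Ci) * 0))).
    { apply tendsto_scal, tendsto_plus; [apply tendsto_plus|].
      - apply tendsto_mult; [easy|]. apply tendsto_plus; [apply tendsto_scal, L0|apply tendsto_const].
      - apply tendsto_scal, L0.
      - apply tendsto_scal, D. lia. }
    replace (/ (c * c) * (0 * (2 * RtoC N * 0 + 2 * RtoC N * p0) + 2 * c * / Ci * 0 + c * c * / (Ci * Ci * Ci) * 0))
      with (RtoC 0) in L by ring.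
    revert L. apply tendsto_ext_loc. generalize Pos. apply filter_imp. intros t Ht.
    assert (Htc : RtoC t <> 0) by (intros E; apply RtoC_inj in E; lra).
    destruct (H (Ci * RtoC t)) as [_ [_ E]]; [now rewrite Im_Ci_RtoC|].
    transitivity (/ (c * c) * RtoC t * (2 * RtoC N * F 3 (involute r N (Ci * RtoC t))
      + 2 * c / (Ci * RtoC t) * F 2 (involute r N (Ci * RtoC t))
      + c * c / (RtoC N * (Ci * RtoC t * (Ci * RtoC t))) * F 1 (involute r N (Ci * RtoC t)) - (- (2) * RtoC N * p0))).
    + field. repeat split; nz.
    + rewrite <- E. field. repeat split; nz.
Qed.

End Bol.

(** * Theta series and the action of the second Hecke operator *)

Definition npow (tau : C) (j : Z) : C := nome (RtoC (IZR j) * tau).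

Lemma npow_add tau i j : npow tau (i + j) = npow tau i * npow tau j.
Proof. unfold npow. rewrite <- nome_plus, plus_IZR, RtoC_plus. f_equal. ring. Qed.

Lemma npow_nat tau n : npow tau (Z.of_nat n) = nome tau ^ n.
Proof. unfold npow. now rewrite <- INR_IZR_INZ, nome_mul_nat. Qed.

Lemma npow_0 tau : npow tau 0 = 1.
Proof. exact (npow_nat tau 0). Qed.

Lemma npow_double tau j : npow (2 * tau) j = npow tau (2 * j).
Proof. unfold npow. rewrite mult_IZR, RtoC_mult. f_equal. ring. Qed.

Lemma npow_int_shift tau (j m : Z) (x : R) : (IZR j * x = IZR m)%R ->
  npow (tau + RtoC x) j = npow tau j.
Proof.
  intros E. unfold npow. rewrite Cmult_plus_distr_l, <- RtoC_mult, E, nome_plus.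
  assert (H : nome (RtoC (IZR m)) = 1); [|rewrite H; ring].
  destruct (Z_le_gt_dec 0 m) as [h|h].
  - rewrite <- (Z2Nat.id m h), <- INR_IZR_INZ, <- (Cmult_1_r (RtoC _)), nome_mul_nat, nome_1. apply Cpow_1_l.
  - replace m with (- Z.of_nat (Z.to_nat (- m)))%Z by lia.
    rewrite opp_IZR, RtoC_opp, nome_opp, <- INR_IZR_INZ, <- (Cmult_1_r (RtoC _)), nome_mul_nat, nome_1, Cpow_1_l.
    field. all: nz.
Qed.

Lemma Cmod_npow tau j : (0 < Cmod (npow tau j))%R.
Proof. apply Cmod_gt_0, nome_neq_0. Qed.

Lemma Cmod_npow_lt_1 tau j : (0 < Im tau)%R -> (0 < j)%Z -> (Cmod (npow tau j) < 1)%R.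
Proof.
  intros Ht Hj. apply Cmod_nome_lt_1. rewrite im_scal_l. apply IZR_lt in Hj. nra.
Qed.

Lemma euler_factor_neq_0 tau n : (0 < Im tau)%R -> 1 - nome tau ^ S n <> 0.
Proof.
  intros Ht E. apply Ceq_minus in E.
  assert (B := Cmod_npow_lt_1 tau (Z.of_nat (S n)) Ht ltac:(lia)).
  rewrite npow_nat, <- E, Cmod_1 in B. lra.
Qed.

Lemma euler_prod_neq_0 tau n : (0 < Im tau)%R -> euler_prod (nome tau) n <> 0.
Proof.
  intros Ht. induction n as [|n IH]; [apply C1_nz|].
  cbn [euler_prod]. apply Cmult_neq_0; [easy|now apply euler_factor_neq_0].
Qed.

(** The inverses of the partial Euler products, continued by zero so that their
    recurrence holds at every integer index. *)
Definition inv_euler (tau : C) (i : Z) : C :=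
  if Z_lt_dec i 0 then 0 else / euler_prod (nome tau) (Z.to_nat i).

Lemma inv_euler_step tau i : (0 < Im tau)%R ->
  inv_euler tau i = (1 - npow tau (i + 1)) * inv_euler tau (i + 1).
Proof.
  intros Ht. unfold inv_euler.
  destruct (Z_lt_dec i 0), (Z_lt_dec (i + 1) 0); try lia.
  - ring.
  - replace (i + 1)%Z with 0%Z by lia. rewrite npow_0. ring.
  - replace (Z.to_nat (i + 1)) with (S (Z.to_nat i)) by lia. cbn [euler_prod].
    replace (npow tau (i + 1)) with (nome tau ^ S (Z.to_nat i)) by (rewrite <- npow_nat; f_equal; lia).
    pose proof (euler_prod_neq_0 tau (Z.to_nat i) Ht). pose proof (euler_factor_neq_0 tau (Z.to_nat i) Ht).
    field. auto.
Qed.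

(** The coefficient of [z^k] in the finite triple product: [q^(k^2)] times the
    [q^2]-binomial coefficient of [2 N] and [N + k]. *)
Definition triple_coef (tau : C) (N : nat) (k : Z) : C :=
  euler_prod (nome (2 * tau)) (2 * N) * inv_euler (2 * tau) (Z.of_nat N - k)
  * inv_euler (2 * tau) (Z.of_nat N + k) * npow tau (k * k).

(** The two Pascal rules of the [q]-binomial coefficients, combined. *)
Lemma triple_coef_step tau N k : (0 < Im tau)%R ->
  triple_coef tau (S N) k =
    (1 + npow tau (4 * Z.of_nat N + 2)) * triple_coef tau N k
    + npow tau (2 * Z.of_nat N + 1) * (triple_coef tau N (k - 1) + triple_coef tau N (k + 1)).
Proof.
  intros Ht. assert (H2 := Im_mul_pos 2 tau ltac:(lra) Ht).
  set (i := (Z.of_nat N - k)%Z). set (j := (Z.of_nat N + k)%Z).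
  unfold triple_coef.
  replace (Z.of_nat (S N) - k)%Z with (i + 1)%Z by lia.
  replace (Z.of_nat (S N) + k)%Z with (j + 1)%Z by lia.
  replace (Z.of_nat N - (k - 1))%Z with (i + 1)%Z by lia.
  replace (Z.of_nat N + (k - 1))%Z with (j - 1)%Z by lia.
  replace (Z.of_nat N - (k + 1))%Z with (i - 1)%Z by lia.
  replace (Z.of_nat N + (k + 1))%Z with (j + 1)%Z by lia. fold i j.
  rewrite (inv_euler_step (2 * tau) (i - 1) H2), (inv_euler_step (2 * tau) (j - 1) H2).
  replace (i - 1 + 1)%Z with i by lia. replace (j - 1 + 1)%Z with j by lia.
  rewrite (inv_euler_step (2 * tau) i H2), (inv_euler_step (2 * tau) j H2).
  rewrite !npow_add, !npow_double.
  replace (2 * S N)%nat with (S (S (2 * N))) by lia. cbn [euler_prod].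
  rewrite <- !npow_nat, !npow_double.
  set (u := npow tau (2 * i)). set (v := npow tau (2 * j)). set (s := npow tau (k * k)).
  set (w := npow tau (2 * 1)).
  replace (npow tau (2 * Z.of_nat (S (2 * N)))) with (u * v * w)
    by (unfold u, v, w; rewrite <- !npow_add; f_equal; lia).
  replace (npow tau (2 * Z.of_nat (S (S (2 * N))))) with (u * v * w * w)
    by (unfold u, v, w; rewrite <- !npow_add; f_equal; lia).
  replace (npow tau (4 * Z.of_nat N) * npow tau 2) with (u * v * w)
    by (unfold u, v, w; rewrite <- !npow_add; f_equal; lia).
  set (g := inv_euler (2 * tau) (i + 1)). set (h := inv_euler (2 * tau) (j + 1)).
  set (E := euler_prod _ _).
  assert (A1 : npow tau (2 * Z.of_nat N) * npow tau 1 * npow tau ((k - 1) * (k - 1)) = u * w * s)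
    by (unfold u, w, s; rewrite <- !npow_add; f_equal; lia).
  assert (A2 : npow tau (2 * Z.of_nat N) * npow tau 1 * npow tau ((k + 1) * (k + 1)) = v * w * s)
    by (unfold v, w, s; rewrite <- !npow_add; f_equal; lia).
  transitivity ((1 + u * v * w) * (E * ((1 - u * w) * g) * ((1 - v * w) * h) * s)
    + (E * g * ((1 - v) * ((1 - v * w) * h))
         * (npow tau (2 * Z.of_nat N) * npow tau 1 * npow tau ((k - 1) * (k - 1)))
       + E * ((1 - u) * ((1 - u * w) * g)) * h
         * (npow tau (2 * Z.of_nat N) * npow tau 1 * npow tau ((k + 1) * (k + 1))))).
  - rewrite A1, A2. ring.
  - ring.
Qed.

Fixpoint triple_prod (tau zeta : C) (N : nat) : C :=
  match N with
  | O => 1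
  | S n => triple_prod tau zeta n * (1 + nome zeta * npow tau (2 * Z.of_nat n + 1))
             * (1 + nome (- zeta) * npow tau (2 * Z.of_nat n + 1))
  end.

(** The finite form of Jacobi's triple product. *)
Lemma triple_prod_sum tau zeta N : (0 < Im tau)%R ->
  has_sum (fun k => triple_coef tau N k * npow zeta k) (triple_prod tau zeta N).
Proof.
  intros Ht. induction N as [|N IH].
  - assert (E : lsum (fun k => triple_coef tau 0 k * npow zeta k) (0%Z :: nil) = 1).
    { simpl. unfold triple_coef, inv_euler. simpl. rewrite !npow_0. field. all: nz. }
    cbn [triple_prod]. rewrite <- E. apply has_sum_finite; [repeat constructor; easy|].
    intros k Hk. unfold triple_coef, inv_euler.
    destruct (Z_lt_dec (Z.of_nat 0 - k) 0); [ring|].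
    destruct (Z_lt_dec (Z.of_nat 0 + k) 0); [ring|]. elim Hk. left. lia.
  - set (x := npow tau (2 * Z.of_nat N + 1)).
    assert (Hm : has_sum (fun k => triple_coef tau N (k - 1) * npow zeta k) (nome zeta * triple_prod tau zeta N)).
    { assert (R1 : has_sum (fun k => triple_coef tau N (k - 1) * npow zeta (k - 1)) (triple_prod tau zeta N)).
      { apply (has_sum_reindex (fun k => (k - 1)%Z) (fun k => (k + 1)%Z) (fun k => triple_coef tau N k * npow zeta k));
          [intros; lia|intros; lia|exact IH]. }
      apply (has_sum_scal (nome zeta)) in R1. revert R1. apply has_sum_ext. intros k. cbv beta.
      replace (npow zeta k) with (npow zeta (k - 1 + 1)) by (f_equal; lia). rewrite (npow_add zeta).
      replace (npow zeta 1) with (nome zeta) by (unfold npow; f_equal; ring). ring. }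
    assert (Hp : has_sum (fun k => triple_coef tau N (k + 1) * npow zeta k) (nome (- zeta) * triple_prod tau zeta N)).
    { assert (R1 : has_sum (fun k => triple_coef tau N (k + 1) * npow zeta (k + 1)) (triple_prod tau zeta N)).
      { apply (has_sum_reindex (fun k => (k + 1)%Z) (fun k => (k - 1)%Z) (fun k => triple_coef tau N k * npow zeta k));
          [intros; lia|intros; lia|exact IH]. }
      apply (has_sum_scal (nome (- zeta))) in R1. revert R1. apply has_sum_ext. intros k. cbv beta.
      replace (npow zeta k) with (npow zeta (k + 1 + -1)) by (f_equal; lia). rewrite (npow_add zeta (k + 1)).
      replace (npow zeta (-1)) with (nome (- zeta)) by (unfold npow; f_equal; ring). ring. }
    assert (Q := has_sum_plus _ _ _ _ (has_sum_scal (1 + npow tau (4 * Z.of_nat N + 2)) _ _ IH)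
      (has_sum_scal x _ _ (has_sum_plus _ _ _ _ Hm Hp))).
    replace (triple_prod tau zeta (S N)) with ((1 + npow tau (4 * Z.of_nat N + 2)) * triple_prod tau zeta N
      + x * (nome zeta * triple_prod tau zeta N + nome (- zeta) * triple_prod tau zeta N)).
    + revert Q. apply has_sum_ext. intros k. rewrite triple_coef_step by easy. fold x. ring.
    + cbn [triple_prod]. fold x.
      replace (npow tau (4 * Z.of_nat N + 2)) with (x * x) by (unfold x; rewrite <- npow_add; f_equal; lia).
      assert (Z1 : nome zeta * nome (- zeta) = 1).
      { rewrite <- nome_plus. replace (zeta + - zeta) with (RtoC 0) by ring. apply nome_0. }
      transitivity (triple_prod tau zeta N * (1 + (nome zeta + nome (- zeta)) * x + nome zeta * nome (- zeta) * (x * x))).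
      * rewrite Z1. ring.
      * ring.
Qed.

Definition eulerP (tau : C) : C := Cexp (- euler_log tau).

Lemma eulerP_neq_0 tau : eulerP tau <> 0.
Proof. apply Cexp_neq_0. Qed.

Lemma eulerP_add_int tau (x : R) (m : Z) : x = IZR m -> eulerP (tau + RtoC x) = eulerP tau.
Proof.
  intros ->. unfold eulerP, euler_log, lambert. rewrite (qsum_nome_eq _ _ (tau + RtoC (IZR m)) tau); [easy|].
  assert (E := npow_int_shift tau 1 m (IZR m) ltac:(ring)). unfold npow in E.
  now rewrite !Cmult_1_l in E.
Qed.

Lemma tendsto_subseq (u : nat -> C) l (f : nat -> nat) :
  (forall M, eventually (fun n => (M <= f n)%nat)) ->
  tendsto eventually u l -> tendsto eventually (fun n => u (f n)) l.
Proof.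
  intros Hf H eps He. destruct (H eps He) as [M HM]. generalize (Hf M).
  apply filter_imp. intros n Hn. now apply HM.
Qed.

(** Jacobi's triple product, for values of [zeta] at which the theta series and
    the partial products are known to converge. *)
Lemma theta_sum tau zeta T : (0 < Im tau)%R ->
  summable (fun k => Cmod (npow tau (k * k) * npow zeta k)) ->
  tendsto eventually (triple_prod tau zeta) T ->
  has_sum (fun k => npow tau (k * k) * npow zeta k) (eulerP (2 * tau) * T).
Proof.
  intros Ht Hs HT. assert (H2 := Im_mul_pos 2 tau ltac:(lra) Ht).
  set (P := eulerP (2 * tau)). assert (HP : P <> 0) by apply eulerP_neq_0.
  assert (LE : tendsto eventually (euler_prod (nome (2 * tau))) P) by now apply euler_prod_tendsto.
  assert (LI : tendsto eventually (fun n => / euler_prod (nome (2 * tau)) n) (/ P)) by now apply tendsto_inv.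
  destruct (tendsto_bounded _ _ LE) as [M [HM BM]]. destruct (tendsto_bounded _ _ LI) as [M' [HM' BM']].
  destruct (summable_has_sum _ _ (fun k => Rle_refl _) Hs) as [s Hsum].
  enough (E : / P * s = T) by (rewrite <- E; replace (P * (/ P * s)) with s by (field; easy); exact Hsum).
  refine (tendsto_unique (F := eventually) _ _ _ _ HT).
  apply (has_sum_tannery (F := eventually) (fun N k => triple_coef tau N k * npow zeta k)
    (fun k => / P * (npow tau (k * k) * npow zeta k))
    (fun k => ((M * (M' * M') + Cmod (/ P)) * Cmod (npow tau (k * k) * npow zeta k))%R)).
  - apply summable_scal; [|easy]. pose proof (Cmod_ge_0 (/ P)). nra.
  - apply filter_forall. intros N k.
    assert (BI : forall i, (Cmod (inv_euler (2 * tau) i) <= M')%R).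
    { intros i. unfold inv_euler. destruct (Z_lt_dec i 0); [rewrite Cmod_0; lra|apply BM']. }
    unfold triple_coef.
    replace (euler_prod (nome (2 * tau)) (2 * N) * inv_euler (2 * tau) (Z.of_nat N - k) *
      inv_euler (2 * tau) (Z.of_nat N + k) * npow tau (k * k) * npow zeta k)
      with (euler_prod (nome (2 * tau)) (2 * N) * (inv_euler (2 * tau) (Z.of_nat N - k) *
      inv_euler (2 * tau) (Z.of_nat N + k)) * (npow tau (k * k) * npow zeta k)) by ring.
    rewrite Cmod_mult. apply Rmult_le_compat_r; [apply Cmod_ge_0|].
    rewrite !Cmod_mult.
    assert (Cmod (inv_euler (2 * tau) (Z.of_nat N - k)) * Cmod (inv_euler (2 * tau) (Z.of_nat N + k)) <= M' * M')%R
      by (apply Rmult_le_compat; auto; apply Cmod_ge_0).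
    assert (Cmod (euler_prod (nome (2 * tau)) (2 * N)) * (Cmod (inv_euler (2 * tau) (Z.of_nat N - k)) * Cmod (inv_euler (2 * tau) (Z.of_nat N + k))) <= M * (M' * M'))%R
      by (apply Rmult_le_compat; auto; try apply Cmod_ge_0; apply Rmult_le_pos; apply Cmod_ge_0).
    pose proof (Cmod_ge_0 (/ P)). lra.
  - intros k. rewrite Cmod_mult. apply Rmult_le_compat_r; [apply Cmod_ge_0|].
    assert (0 <= M * (M' * M'))%R by nra. lra.
  - intros k.
    assert (LIi : forall J : nat -> Z, (forall m : nat, eventually (fun N => (Z.of_nat m <= J N)%Z)) ->
      tendsto eventually (fun N => inv_euler (2 * tau) (J N)) (/ P)).
    { intros J HJ.
      assert (L := tendsto_subseq _ _ (fun N => Z.to_nat (J N)) ltac:(intros m; generalize (HJ m); apply filter_imp; intros N; lia) LI).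
      revert L. apply tendsto_ext_loc. generalize (HJ O). apply filter_imp. intros N HN.
      unfold inv_euler. destruct (Z_lt_dec (J N) 0); [lia|easy]. }
    replace (/ P * (npow tau (k * k) * npow zeta k)) with (P * / P * / P * (npow tau (k * k) * npow zeta k)) by (field; easy).
    apply (tendsto_ext (fun N => euler_prod (nome (2 * tau)) (2 * N) * inv_euler (2 * tau) (Z.of_nat N - k) *
      inv_euler (2 * tau) (Z.of_nat N + k) * (npow tau (k * k) * npow zeta k))).
    { intros N. unfold triple_coef. ring. }
    apply tendsto_mult; [|apply tendsto_const]. apply tendsto_mult; [apply tendsto_mult|].
    + apply (tendsto_subseq _ _ (fun N => (2 * N)%nat)); [|easy]. intros m. exists m. intros n. lia.
    + apply LIi. intros m. exists (m + Z.abs_nat k)%nat. intros N. lia.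
    + apply LIi. intros m. exists (m + Z.abs_nat k)%nat. intros N. lia.
  - apply filter_forall. intros N. now apply triple_prod_sum.
  - apply has_sum_scal. exact Hsum.
Qed.

Lemma summable_npow_sqr tau (v : Z -> C) : (0 < Im tau)%R -> (forall k, (Cmod (v k) <= / Cmod (npow tau 1) * Cmod (npow tau (Z.abs k)))%R) ->
  summable (fun k => Cmod (v k)).
Proof.
  intros Ht Hv.
  apply (summable_le _ (fun k => (/ Cmod (npow tau 1) * Cmod (npow tau (Z.abs k)))%R)).
  - intros k. split; [apply Cmod_ge_0|apply Hv].
  - apply summable_scal; [left; apply Rinv_0_lt_compat, Cmod_npow|].
    assert (S : summable (fun n => Cmod (npow tau (Z.of_nat n)))).
    { apply (summable_le _ (fun n => (Cmod (nome tau) ^ n)%R)).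
      - intros n. split; [apply Cmod_ge_0|]. rewrite npow_nat, Cmod_pow. lra.
      - apply summable_geometric. pose proof (Cmod_nome_lt_1 tau Ht). lra. }
    apply summable_Z; [intros j; apply Cmod_ge_0| |];
      refine (summable_le _ _ _ S); intros n; (split; [apply Cmod_ge_0|]);
      replace (Z.abs _) with (Z.of_nat n) by lia; lra.
Qed.

Lemma Cmod_npow_antitone tau i j : (0 < Im tau)%R -> (i <= j)%Z ->
  (Cmod (npow tau j) <= Cmod (npow tau i))%R.
Proof.
  intros Ht Hij. unfold npow. rewrite !Cmod_nome, !im_scal_l. apply exp_le_compat.
  apply IZR_le in Hij. pose proof PI_RGT_0. assert (0 <= PI * Im tau)%R by nra. nra.
Qed.

Lemma Cmod_npow_le_shift tau i j : (0 < Im tau)%R -> (j <= i + 1)%Z ->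
  (Cmod (npow tau i) <= / Cmod (npow tau 1) * Cmod (npow tau j))%R.
Proof.
  intros Ht Hij. pose proof (Cmod_npow tau 1) as P.
  apply (Rmult_le_reg_l (Cmod (npow tau 1))); [easy|].
  rewrite <- Rmult_assoc, Rinv_r, Rmult_1_l by lra.
  rewrite <- Cmod_mult, <- npow_add. apply Cmod_npow_antitone; [easy|lia].
Qed.

Lemma npow_half_sqr k : npow (RtoC (1 / 2)) k * npow (RtoC (1 / 2)) k = 1.
Proof.
  unfold npow. rewrite <- nome_plus. replace (RtoC (IZR k) * RtoC (1 / 2) + RtoC (IZR k) * RtoC (1 / 2))
    with (RtoC (IZR k) * (0 + RtoC 1)).
  - assert (E := npow_int_shift 0 k k 1 ltac:(ring)). unfold npow in E.
    rewrite E, Cmult_0_r. apply nome_0.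
  - rewrite Cplus_0_l. replace (RtoC 1) with (RtoC (1 / 2) + RtoC (1 / 2)) by (rewrite <- RtoC_plus; f_equal; lra).
    ring.
Qed.

Lemma Cmod_npow_half k : Cmod (npow (RtoC (1 / 2)) k) = 1%R.
Proof. unfold npow. rewrite Cmod_nome, im_scal_l. simpl (Im (RtoC _)). rewrite <- exp_0. f_equal. ring. Qed.

Lemma nome_half : nome (RtoC (1 / 2)) = - (1).
Proof.
  unfold nome. rewrite <- Cexp_i_PI. f_equal.
  replace (RtoC (2 * PI) * Ci * RtoC (1 / 2)) with (Ci * (RtoC (2 * PI) * RtoC (1 / 2))) by ring.
  rewrite <- RtoC_mult. do 2 f_equal. field.
Qed.

(** Gauss: the alternating theta series as an Euler product. *)
Lemma theta4_sum tau : (0 < Im tau)%R ->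
  has_sum (fun k => npow tau (k * k) * npow (RtoC (1 / 2)) k) (eulerP tau ^ 2 / eulerP (2 * tau)).
Proof.
  intros Ht. assert (H2 := Im_mul_pos 2 tau ltac:(lra) Ht).
  assert (HP := eulerP_neq_0 (2 * tau)).
  replace (eulerP tau ^ 2 / eulerP (2 * tau))
    with (eulerP (2 * tau) * (eulerP tau * / eulerP (2 * tau) * (eulerP tau * / eulerP (2 * tau)))) by (field; easy).
  apply theta_sum; [easy| |].
  - apply (summable_npow_sqr tau); [easy|]. intros k. rewrite Cmod_mult, Cmod_npow_half, Rmult_1_r.
    apply Cmod_npow_le_shift; [easy|nia].
  - set (B := fun N => euler_prod (nome tau) (2 * N) * / euler_prod (nome (2 * tau)) N).
    assert (LB : tendsto eventually B (eulerP tau * / eulerP (2 * tau))).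
    { apply tendsto_mult.
      - apply (tendsto_subseq _ _ (fun N => (2 * N)%nat)); [|now apply euler_prod_tendsto].
        intros m. exists m. intros n. lia.
      - apply tendsto_inv; [easy|now apply euler_prod_tendsto]. }
    generalize (tendsto_mult _ _ _ _ LB LB). apply tendsto_ext. intros N.
    assert (Hm : nome (- RtoC (1 / 2)) = - (1)) by (rewrite nome_opp, nome_half; field; nz).
    induction N as [|N IH].
    + unfold B. simpl. field. all: nz.
    + cbn [triple_prod]. rewrite <- IH, nome_half, Hm.
      unfold B. replace (2 * S N)%nat with (S (S (2 * N))) by lia. cbn [euler_prod].
      pose proof (euler_prod_neq_0 (2 * tau) N H2). pose proof (euler_factor_neq_0 (2 * tau) N H2) as F.
      rewrite <- !npow_nat in *. rewrite !npow_double in *.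
      replace (2 * Z.of_nat N + 1)%Z with (Z.of_nat (S (2 * N))) by lia.
      replace (2 * Z.of_nat (S N))%Z with (Z.of_nat (S (S (2 * N)))) in * by lia.
      field. auto.
Qed.

(** The companion series over odd squares, shifted by a power of [q]. *)
Lemma theta2_sum tau : (0 < Im tau)%R ->
  has_sum (fun k => npow tau (k * k) * npow tau k) (2 * eulerP (4 * tau) ^ 2 / eulerP (2 * tau)).
Proof.
  intros Ht. assert (H2 := Im_mul_pos 2 tau ltac:(lra) Ht). assert (H4 := Im_mul_pos 4 tau ltac:(lra) Ht).
  assert (HP := eulerP_neq_0 (2 * tau)).
  replace (2 * eulerP (4 * tau) ^ 2 / eulerP (2 * tau))
    with (eulerP (2 * tau) * (2 * (eulerP (4 * tau) * / eulerP (2 * tau) * (eulerP (4 * tau) * / eulerP (2 * tau))) * / (1 + 0)))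
    by (field; repeat split; nz; easy).
  apply theta_sum; [easy| |].
  - apply (summable_npow_sqr tau); [easy|]. intros k. rewrite <- npow_add.
    apply Cmod_npow_le_shift; [easy|nia].
  - set (D := fun N => euler_prod (nome (4 * tau)) N * / euler_prod (nome (2 * tau)) N).
    assert (LD : tendsto eventually D (eulerP (4 * tau) * / eulerP (2 * tau))).
    { apply tendsto_mult; [now apply euler_prod_tendsto|].
      apply tendsto_inv; [easy|now apply euler_prod_tendsto]. }
    assert (LQ : tendsto eventually (fun N => nome (2 * tau) ^ N) 0).
    { pose proof (Cmod_nome_lt_1 _ H2) as Hq.
      intros eps He.
      destruct (pow_lt_1_zero (Cmod (nome (2 * tau))) ltac:(rewrite Rabs_pos_eq; lra) eps He) as [N0 HN].
      exists N0. intros n Hn. replace (nome (2 * tau) ^ n - 0) with (nome (2 * tau) ^ n) by ring.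
      specialize (HN n Hn). rewrite Cmod_pow. eapply Rle_lt_trans; [apply Rle_abs|exact HN]. }
    assert (L1 : tendsto eventually (fun N => 2 * (D N * D N) * / (1 + nome (2 * tau) ^ N))
      (2 * (eulerP (4 * tau) * / eulerP (2 * tau) * (eulerP (4 * tau) * / eulerP (2 * tau))) * / (1 + 0))).
    { apply tendsto_mult; [apply tendsto_scal; now apply tendsto_mult|].
      apply tendsto_inv; [rewrite Cplus_0_r; nz|]. apply tendsto_plus; [apply tendsto_const|easy]. }
    revert L1. apply tendsto_ext. intros N.
    assert (Nz : forall n, 1 + nome (2 * tau) ^ n <> 0).
    { intros [|n] E.
      - simpl in E. rewrite <- RtoC_plus in E. apply RtoC_inj in E. lra.
      - assert (B := Cmod_npow_lt_1 (2 * tau) (Z.of_nat (S n)) H2 ltac:(lia)). rewrite npow_nat in B.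
        assert (Ex : nome (2 * tau) ^ S n = - (1)).
        { transitivity (1 + nome (2 * tau) ^ S n - 1); [ring|rewrite E; ring]. }
        rewrite Ex, Cmod_opp, Cmod_1 in B. lra. }
    assert (E4 : forall n, nome (4 * tau) ^ n = nome (2 * tau) ^ n * nome (2 * tau) ^ n).
    { intros n. replace (4 * tau) with (2 * tau + 2 * tau) by ring. now rewrite nome_plus, Cpow_mult_l. }
    induction N as [|N IH].
    + unfold D. simpl. field. all: nz.
    + cbn [triple_prod]. rewrite <- IH. unfold D. cbn [euler_prod]. rewrite E4.
      pose proof (euler_prod_neq_0 (2 * tau) N H2). pose proof (euler_factor_neq_0 (2 * tau) N H2) as F.
      pose proof (Nz N) as N0. pose proof (Nz (S N)) as N1.
      replace (nome tau * npow tau (2 * Z.of_nat N + 1)) with (nome (2 * tau) ^ S N).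
      2:{ rewrite <- npow_nat, npow_double. replace (nome tau) with (npow tau 1) by (unfold npow; f_equal; ring).
          rewrite <- npow_add. f_equal. lia. }
      replace (nome (- tau) * npow tau (2 * Z.of_nat N + 1)) with (nome (2 * tau) ^ N).
      2:{ rewrite <- npow_nat, npow_double. replace (nome (- tau)) with (npow tau (-1)) by (unfold npow; f_equal; ring).
          rewrite <- npow_add. f_equal. lia. }
      set (X := nome (2 * tau) ^ S N) in *. set (Y := nome (2 * tau) ^ N) in *.
      field. auto.
Qed.

Lemma npow_plus_arg tau sigma j : npow (tau + sigma) j = npow tau j * npow sigma j.
Proof. unfold npow. rewrite <- nome_plus. f_equal. ring. Qed.

Lemma npow_half_even j : npow (RtoC (1 / 2)) (2 * j) = 1.
Proof. replace (2 * j)%Z with (j + j)%Z by lia. rewrite npow_add. apply npow_half_sqr. Qed.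

Lemma npow_half_odd j : npow (RtoC (1 / 2)) (2 * j + 1) = - (1).
Proof.
  rewrite npow_add, npow_half_even. unfold npow. rewrite Cmult_1_l, Cmult_1_l. apply nome_half.
Qed.

Lemma npow_triple tau j : npow (3 * tau) j = npow tau (3 * j).
Proof. unfold npow. rewrite mult_IZR, RtoC_mult. f_equal. ring. Qed.

(** The series without signs is the alternating one at [tau + 1/2]. *)
Lemma theta3_sum tau : (0 < Im tau)%R ->
  has_sum (fun k => npow tau (k * k)) (eulerP (tau + RtoC (1 / 2)) ^ 2 / eulerP (2 * tau)).
Proof.
  intros Ht.
  assert (Ht' : (0 < Im (tau + RtoC (1 / 2)))%R) by (rewrite im_plus; simpl (Im (RtoC _)); lra).
  pose proof (theta4_sum _ Ht') as H.
  replace (eulerP (2 * (tau + RtoC (1 / 2)))) with (eulerP (2 * tau)) in H.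
  2:{ replace (2 * (tau + RtoC (1 / 2))) with (2 * tau + RtoC 1).
      - symmetry. now apply (eulerP_add_int _ _ 1).
      - rewrite Cmult_plus_distr_l, <- RtoC_mult. do 2 f_equal. lra. }
  revert H. apply has_sum_ext. intros k.
  rewrite npow_plus_arg, <- Cmult_assoc, <- npow_add.
  destruct (Zeven_odd_dec k) as [E|E].
  - destruct (Zeven_ex _ E) as [j ->].
    replace (2 * j * (2 * j) + 2 * j)%Z with (2 * (2 * j * j + j))%Z by lia. rewrite npow_half_even. ring.
  - destruct (Zodd_ex _ E) as [j ->].
    replace ((2 * j + 1) * (2 * j + 1) + (2 * j + 1))%Z with (2 * (2 * j * j + 3 * j + 1))%Z by lia.
    rewrite npow_half_even. ring.
Qed.

Lemma summable_theta3 tau : (0 < Im tau)%R -> summable (fun k => Cmod (npow tau (k * k))).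
Proof.
  intros Ht. apply (summable_npow_sqr tau); [easy|]. intros k. apply Cmod_npow_le_shift; [easy|nia].
Qed.

Lemma summable_theta4 tau : (0 < Im tau)%R ->
  summable (fun k => Cmod (npow tau (k * k) * npow (RtoC (1 / 2)) k)).
Proof.
  intros Ht. apply (summable_npow_sqr tau); [easy|]. intros k.
  rewrite Cmod_mult, Cmod_npow_half, Rmult_1_r. apply Cmod_npow_le_shift; [easy|nia].
Qed.

Lemma summable_theta2 tau : (0 < Im tau)%R ->
  summable (fun k => Cmod (npow tau (k * k) * npow tau k)).
Proof.
  intros Ht. apply (summable_npow_sqr tau); [easy|]. intros k. rewrite <- npow_add.
  apply Cmod_npow_le_shift; [easy|nia].
Qed.

(** The classical modular equation of degree three, read on the quadratic form
    [m^2 + 3 n^2]: multiplication by a sixth root of unity carries the pairs of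
    odd [u], [v] with [u = v] modulo 4, via [m = (u + 3 v)/4] and
    [n = (u - v)/4], to the pairs [m], [n] of opposite parities. *)
Lemma theta_modular_equation tau : (0 < Im tau)%R ->
  eulerP (tau + RtoC (1 / 2)) ^ 2 / eulerP (2 * tau)
    * (eulerP (3 * tau + RtoC (1 / 2)) ^ 2 / eulerP (2 * (3 * tau)))
  - eulerP tau ^ 2 / eulerP (2 * tau) * (eulerP (3 * tau) ^ 2 / eulerP (2 * (3 * tau)))
  = nome tau * (2 * eulerP (4 * tau) ^ 2 / eulerP (2 * tau)
      * (2 * eulerP (4 * (3 * tau)) ^ 2 / eulerP (2 * (3 * tau)))).
Proof.
  intros Ht. assert (H3 := Im_mul_pos 3 tau ltac:(lra) Ht).
  pose proof (has_sum_minus _ _ _ _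
    (has_sum_mult _ _ _ _ (summable_theta3 _ Ht) (summable_theta3 _ H3) (theta3_sum _ Ht) (theta3_sum _ H3))
    (has_sum_mult _ _ _ _ (summable_theta4 _ Ht) (summable_theta4 _ H3) (theta4_sum _ Ht) (theta4_sum _ H3))) as L.
  pose proof (has_sum_scal (nome tau) _ _
    (has_sum_mult _ _ _ _ (summable_theta2 _ Ht) (summable_theta2 _ H3) (theta2_sum _ Ht) (theta2_sum _ H3))) as R1.
  set (lhs := _ - _ * _) in L |- *. set (rhs := nome tau * _) in R1 |- *.
  set (r := fun p : Z * Z => npow tau (fst p * fst p + fst p + 3 * (snd p * snd p + snd p) + 1)).
  assert (Hr : has_sum r rhs).
  { revert R1. apply has_sum_ext. intros [k l]. unfold r. cbn [fst snd].
    rewrite !npow_triple. replace (nome tau) with (npow tau 1) by (unfold npow; f_equal; ring).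
    rewrite <- !npow_add. f_equal. lia. }
  assert (Sr : summable (fun p => Cmod (r p))).
  { assert (P := summable_scal (Cmod (nome tau)) _ (Cmod_ge_0 _) (summable_prod _ _ (summable_theta2 _ Ht) (summable_theta2 _ H3))).
    refine (summable_le _ _ _ P). intros [k l]. split; [apply Cmod_ge_0|]. apply Req_le.
    cbn [fst snd]. rewrite <- !Cmod_mult. f_equal. unfold r. cbn [fst snd].
    rewrite !npow_triple. replace (nome tau) with (npow tau 1) by (unfold npow; f_equal; ring).
    rewrite <- !npow_add. f_equal. lia. }
  assert (I1 : forall x y : Z * Z, (snd x + 2 * fst x, snd x)%Z = (snd y + 2 * fst y, snd y)%Z -> x = y).
  { intros [n l] [n' l'] E. cbn [fst snd] in E. assert (E1 := f_equal fst E). assert (E2 := f_equal snd E). cbn [fst snd] in E1, E2. apply f_equal2; lia. }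
  destruct (summable_has_sum (fun p : Z * Z => r (snd p + 2 * fst p, snd p)%Z) _ (fun p => Rle_refl _)
    (summable_inj (fun p : Z * Z => (snd p + 2 * fst p, snd p)%Z) _ I1 Sr)) as [s Hs].
  assert (Even : has_sum (fun p : Z * Z => if Z.even (fst p - snd p) then r p else 0) s).
  { apply (has_sum_support (fun p : Z * Z => (snd p + 2 * fst p, snd p)%Z)); [exact I1| |].
    - intros [k l] Hkl. cbn [fst snd]. destruct (Z.even (k - l)) eqn:E; [|easy].
      apply Z.even_spec in E. destruct E as [n E]. elim (Hkl (n, l)). cbn [fst snd]. f_equal. lia.
    - revert Hs. apply has_sum_ext. intros [n l]. cbn [fst snd].
      replace (l + 2 * n - l)%Z with (2 * n)%Z by lia. now rewrite Z.even_mul. }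
  assert (Odd : has_sum (fun p : Z * Z => if Z.even (fst p - snd p) then 0 else r p) s).
  { apply (has_sum_support (fun p : Z * Z => (snd p + 2 * fst p, - snd p - 1)%Z)).
    - intros [n l] [n' l'] E. cbn [fst snd] in E. assert (E1 := f_equal fst E). assert (E2 := f_equal snd E). cbn [fst snd] in E1, E2. apply f_equal2; lia.
    - intros [k l] Hkl. cbn [fst snd]. destruct (Z.even (k - l)) eqn:E; [easy|].
      assert (O : Z.odd (k - l) = true) by (rewrite <- Z.negb_even, E; easy).
      apply Z.odd_spec in O. destruct O as [n O]. elim (Hkl (n + l + 1, - l - 1)%Z). cbn [fst snd]. apply f_equal2; lia.
    - revert Hs. apply has_sum_ext. intros [n l]. cbn [fst snd].
      replace (l + 2 * n - (- l - 1))%Z with (2 * (l + n) + 1)%Z by lia. rewrite Z.even_add, Z.even_mul. simpl.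
      unfold r. cbn [fst snd]. f_equal. lia. }
  assert (Er : rhs = s + s).
  { apply (has_sum_unique _ _ _ Hr). pose proof (has_sum_plus _ _ _ _ Even Odd) as P.
    revert P. apply has_sum_ext. intros p. simpl. destruct (Z.even (fst p - snd p)); ring. }
  rewrite Er. apply (has_sum_unique _ _ _ L).
  replace (s + s) with (2 * s) by ring.
  apply (has_sum_support (fun p : Z * Z => (fst p + 2 * snd p + 1, fst p)%Z)).
  - intros [n l] [n' l'] E. cbn [fst snd] in E. assert (E1 := f_equal fst E). assert (E2 := f_equal snd E). cbn [fst snd] in E1, E2. apply f_equal2; lia.
  - intros [m n] Hmn. cbn [fst snd]. rewrite !npow_triple.
    assert (Ev : Z.even (m - n - 1) = false).
    { destruct (Z.even (m - n - 1)) eqn:E; [|easy]. apply Z.even_spec in E. destruct E as [l E].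
      elim (Hmn (n, l)). cbn [fst snd]. f_equal. lia. }
    assert (O : Z.odd (m - n - 1) = true) by (rewrite <- Z.negb_even, Ev; easy).
    apply Z.odd_spec in O. destruct O as [j O].
    assert (Eh : npow (RtoC (1 / 2)) m * npow (RtoC (1 / 2)) n = 1).
    { rewrite <- npow_add. replace (m + n)%Z with (2 * (n + j + 1))%Z by lia. apply npow_half_even. }
    transitivity (npow tau (m * m) * npow tau (3 * (n * n)) * (1 - npow (RtoC (1 / 2)) m * npow (RtoC (1 / 2)) n)); [ring|].
    rewrite Eh. ring.
  - pose proof (has_sum_scal 2 _ _ Hs) as P. revert P. apply has_sum_ext. intros [n l]. cbn [fst snd].
    rewrite !npow_triple.
    assert (Eh : npow (RtoC (1 / 2)) (n + 2 * l + 1) * npow (RtoC (1 / 2)) n = - (1)).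
    { rewrite <- npow_add. replace (n + 2 * l + 1 + n)%Z with (2 * (n + l) + 1)%Z by lia. apply npow_half_odd. }
    transitivity (npow tau ((n + 2 * l + 1) * (n + 2 * l + 1)) * npow tau (3 * (n * n))
      * (1 - npow (RtoC (1 / 2)) (n + 2 * l + 1) * npow (RtoC (1 / 2)) n)); [|ring].
    rewrite Eh, <- npow_add. unfold r. cbn [fst snd].
    replace ((l + 2 * n) * (l + 2 * n) + (l + 2 * n) + 3 * (l * l + l) + 1)%Z
      with ((n + 2 * l + 1) * (n + 2 * l + 1) + 3 * (n * n))%Z by lia. ring.
Qed.

Lemma eta_sqr_eulerP tau : (0 < Im tau)%R -> eta tau ^ 2 = nome (tau / 12) * eulerP tau ^ 2.
Proof.
  intros Ht. rewrite eta_sqr by easy. unfold eulerP, nome. simpl (_ ^ 2).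
  rewrite Cmult_1_r, <- !Cexp_plus. f_equal. unfold eta_sqr_log. field. all: nz.
Qed.

Lemma phi_eulerP tau : (0 < Im tau)%R ->
  phi tau = nome tau * (eulerP tau ^ 2 * eulerP (2 * tau) ^ 2 * eulerP (3 * tau) ^ 2 * eulerP (6 * tau) ^ 2).
Proof.
  intros Ht. unfold phi.
  rewrite !eta_sqr_eulerP by (try (apply Im_mul_pos; [lra|easy]); easy).
  replace (nome tau) with (nome (tau / 12) * nome (2 * tau / 12) * nome (3 * tau / 12) * nome (6 * tau / 12)).
  - ring.
  - rewrite <- !nome_plus. f_equal. field. all: nz.
Qed.

(** The second Hecke operator multiplies [phi] by [a_2 = -2]. *)
Lemma phi_U2 tau : (0 < Im tau)%R -> phi tau + phi (tau + RtoC (1 / 2)) = - (4) * phi (2 * tau).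
Proof.
  intros Ht.
  assert (Ht' : (0 < Im (tau + RtoC (1 / 2)))%R) by (rewrite im_plus; simpl (Im (RtoC _)); lra).
  rewrite !phi_eulerP by (try (apply Im_mul_pos; [lra|easy]); easy).
  pose proof (theta_modular_equation tau Ht) as E.
  assert (Half : forall (m : R) (j : Z), (m = 2 * IZR j)%R -> RtoC m * (tau + RtoC (1 / 2)) = RtoC m * tau + RtoC (IZR j)).
  { intros m j ->. rewrite Cmult_plus_distr_l, <- RtoC_mult. do 2 f_equal. field. }
  assert (E2 : eulerP (2 * (tau + RtoC (1 / 2))) = eulerP (2 * tau)).
  { rewrite (Half 2%R 1%Z) by ring. now apply (eulerP_add_int _ _ 1). }
  assert (E6 : eulerP (6 * (tau + RtoC (1 / 2))) = eulerP (6 * tau)).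
  { rewrite (Half 6%R 3%Z) by ring. now apply (eulerP_add_int _ _ 3). }
  assert (E3 : eulerP (3 * (tau + RtoC (1 / 2))) = eulerP (3 * tau + RtoC (1 / 2))).
  { replace (3 * (tau + RtoC (1 / 2))) with (3 * tau + RtoC (1 / 2) + RtoC 1).
    - now apply (eulerP_add_int _ _ 1).
    - replace (RtoC 1) with (2 * RtoC (1 / 2)) by (rewrite <- RtoC_mult; f_equal; lra). ring. }
  rewrite E2, E3, E6.
  replace (nome (tau + RtoC (1 / 2))) with (- nome tau) by (rewrite nome_plus, nome_half; ring).
  replace (nome (2 * tau)) with (nome tau * nome tau) by (rewrite <- nome_plus; f_equal; ring).
  replace (2 * (3 * tau)) with (6 * tau) in E by ring.
  replace (4 * (3 * tau)) with (12 * tau) in E by ring.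
  replace (2 * (2 * tau)) with (4 * tau) by ring.
  replace (3 * (2 * tau)) with (6 * tau) by ring.
  replace (6 * (2 * tau)) with (12 * tau) by ring.
  pose proof (eulerP_neq_0 (2 * tau)) as N2. pose proof (eulerP_neq_0 (6 * tau)) as N6.
  set (A := eulerP (tau + RtoC (1 / 2))) in *. set (A3 := eulerP (3 * tau + RtoC (1 / 2))) in *.
  set (B := eulerP tau) in *. set (B3 := eulerP (3 * tau)) in *.
  set (P2 := eulerP (2 * tau)) in *. set (P6 := eulerP (6 * tau)) in *.
  set (P4 := eulerP (4 * tau)) in *. set (P12 := eulerP (12 * tau)) in *. set (q := nome tau) in *.
  transitivity (- q * P2 ^ 3 * P6 ^ 3 * (A ^ 2 / P2 * (A3 ^ 2 / P6) - B ^ 2 / P2 * (B3 ^ 2 / P6))).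
  - field. auto.
  - rewrite E. field. auto.
Qed.

Lemma tendsto_infinity_scale (u : R -> C) (l : C) (k : R) : (0 < k)%R ->
  tendsto (Rbar_locally p_infty) u l -> tendsto (Rbar_locally p_infty) (fun t => u (k * t)%R) l.
Proof.
  intros Hk H eps He. destruct (H eps He) as [M HM]. exists (M / k)%R. intros t Ht. apply HM.
  apply (Rmult_lt_compat_l k) in Ht; [|easy]. replace (k * (M / k))%R with M in Ht by (field; lra). easy.
Qed.

Lemma tendsto_at_right_0_scale (u : R -> C) (l : C) (k : R) : (0 < k)%R ->
  tendsto (at_right 0) u l -> tendsto (at_right 0) (fun t => u (k * t)%R) l.
Proof.
  intros Hk H eps He. destruct (H eps He) as [d Hd].
  apply (at_right_0_intro _ (d / k)%R); [apply Rdiv_lt_0_compat; [apply cond_pos|easy]|].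
  intros t [Ht1 Ht2]. apply (Rmult_lt_compat_l k) in Ht2; [|easy].
  replace (k * (d / k))%R with (d : R) in Ht2 by (field; lra).
  assert (0 < k * t)%R by now apply Rmult_lt_0_compat.
  apply Hd; [|easy]. change (Rabs (k * t + - 0) < d)%R. rewrite Ropp_0, Rplus_0_r, Rabs_pos_eq; lra.
Qed.

(** Three integrations of the relation for the form: the polynomial that they leave
    vanishes because every term decays at infinity. *)
Lemma eichler_U2 (a : nat -> C) : disc_coefs a ->
  (forall tau, (0 < Im tau)%R ->
    eichler a 0 tau + eichler a 0 (tau + RtoC (1 / 2)) = - (4) * eichler a 0 (2 * tau)) ->
  forall tau, (0 < Im tau)%R ->
    eichler a 3 tau + eichler a 3 (RtoC (1 / 2) + tau) + / 2 * eichler a 3 (2 * tau) = 0.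
Proof.
  intros Ha H0. set (c := RtoC (2 * PI) * Ci).
  assert (D1 : forall j w, (0 < Im w)%R -> cderiv (eichler a (S j)) w (c * eichler a j w))
    by (intros j w Hw; now apply cderiv_eichler).
  assert (Dh : forall j w, (0 < Im w)%R ->
    cderiv (fun w => eichler a (S j) (RtoC (1 / 2) + w)) w (c * eichler a j (RtoC (1 / 2) + w))).
  { intros j w Hw. apply cderiv_shift, D1. rewrite im_plus. simpl (Im (RtoC _)). lra. }
  assert (D2 : forall j w, (0 < Im w)%R ->
    cderiv (fun w => eichler a (S j) (2 * w)) w (c * eichler a j (2 * w) * (2 * 1))).
  { intros j w Hw. apply (cderiv_comp (eichler a (S j)) (fun w => 2 * w)).
    - apply D1. now apply Im_mul_pos; [lra|].
    - apply (cderiv_scal 2 (fun x => x)), cderiv_id. }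
  destruct (quadratic_of_zero_third_deriv
    (fun w => eichler a 3 w + eichler a 3 (RtoC (1 / 2) + w) + / 2 * eichler a 3 (2 * w))
    (fun w => c * (eichler a 2 w + eichler a 2 (RtoC (1 / 2) + w) + eichler a 2 (2 * w)))
    (fun w => c * c * (eichler a 1 w + eichler a 1 (RtoC (1 / 2) + w) + 2 * eichler a 1 (2 * w))))
    as [k0 [k1 [k2 HK]]].
  - intros w Hw. eapply cderiv_eq; [|apply cderiv_plus; [apply cderiv_plus; [now apply D1|now apply Dh]|
      apply cderiv_scal; now apply D2]]. cbv beta. field. all: nz.
  - intros w Hw. eapply cderiv_eq; [|apply cderiv_scal, cderiv_plus; [apply cderiv_plus; [now apply D1|now apply Dh]|
      now apply D2]]. cbv beta. ring.
  - intros w Hw. eapply cderiv_eq; [|apply cderiv_scal, cderiv_plus; [apply cderiv_plus; [now apply D1|now apply Dh]|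
      apply cderiv_scal; now apply D2]]. cbv beta.
    transitivity (c * c * c * (eichler a 0 w + eichler a 0 (w + RtoC (1 / 2)) + 4 * eichler a 0 (2 * w))).
    + rewrite (Cplus_comm (RtoC (1 / 2)) w). ring.
    + rewrite H0 by easy. ring.
  - assert (L : forall j (x y z : C), tendsto (Rbar_locally p_infty) (fun t =>
      x * eichler a j (Ci * RtoC t) + y * eichler a j (RtoC (1 / 2) + Ci * RtoC t) + z * eichler a j (2 * (Ci * RtoC t))) 0).
    { intros j x y z.
      assert (L1 : forall u, (forall t, Im (u t) = t) -> tendsto (Rbar_locally p_infty) (fun t => eichler a j (u t)) 0).
      { intros u Hu. generalize (eichler_infinity a Ha 0 j u ltac:(lia) Hu). apply tendsto_ext. intros t. simpl. ring. }
      replace (RtoC 0) with (x * 0 + y * 0 + z * 0) by ring.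
      apply tendsto_plus; [apply tendsto_plus|]; apply tendsto_scal.
      - apply L1. apply Im_Ci_RtoC.
      - apply (L1 (fun t => RtoC (1 / 2) + Ci * RtoC t)). intros t. rewrite im_plus, Im_Ci_RtoC. simpl. ring.
      - generalize (tendsto_infinity_scale _ _ 2 ltac:(lra) (L1 (fun t => Ci * RtoC t) Im_Ci_RtoC)).
        apply tendsto_ext. intros t. f_equal. rewrite RtoC_mult. ring. }
    assert (Pos : Rbar_locally p_infty (fun t => (0 < Im (Ci * RtoC t))%R)).
    { exists 0%R. intros t Ht. rewrite Im_Ci_RtoC. exact Ht. }
    assert (Z : forall k : C, (forall eps : R, (0 < eps)%R -> Rbar_locally p_infty (fun _ => (Cmod (k - 0) < eps)%R)) -> k = 0).
    { intros k Hk. exact (tendsto_unique (F := Rbar_locally p_infty) (fun _ => k) k 0 (tendsto_const k) Hk). }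
    assert (Z2 : 2 * k2 = 0).
    { apply Z. refine (tendsto_ext_loc _ _ _ _ (L 1%nat (c * c) (c * c) (c * c * 2))).
      revert Pos. apply filter_imp. intros t Ht. destruct (HK _ Ht) as [_ [_ E]]. rewrite <- E. ring. }
    assert (Z1 : k1 = 0).
    { apply Z. refine (tendsto_ext_loc _ _ _ _ (L 2%nat c c c)).
      revert Pos. apply filter_imp. intros t Ht. destruct (HK _ Ht) as [_ [E _]]. rewrite Z2 in E.
      replace k1 with (k1 + 0 * (Ci * RtoC t)) by ring. rewrite <- E. ring. }
    assert (Z2' : k2 = 0).
    { transitivity (/ 2 * (2 * k2)); [field; nz|]. rewrite Z2. ring. }
    assert (Z0 : k0 = 0).
    { apply Z. refine (tendsto_ext_loc _ _ _ _ (L 3%nat 1 1 (/ 2))).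
      revert Pos. apply filter_imp. intros t Ht. destruct (HK _ Ht) as [E _]. rewrite Z1, Z2' in E.
      replace k0 with (k0 + 0 * (Ci * RtoC t) + 0 * (Ci * RtoC t * (Ci * RtoC t))) by ring. rewrite <- E. ring. }
    intros w Hw. destruct (HK w Hw) as [E _]. rewrite E, Z0, Z1, Z2'. ring.
Qed.

(** * The period relations of [phi] *)

Lemma RtoC_third : RtoC (1 / 3) = 1 / 3.
Proof. rewrite RtoC_div by lra. easy. Qed.

Lemma RtoC_half : RtoC (1 / 2) = 1 / 2.
Proof. rewrite RtoC_div by lra. easy. Qed.

Lemma Im_add_real (x : R) (w : C) : (0 < Im w)%R -> (0 < Im (RtoC x + w))%R.
Proof. intros H. rewrite im_plus. simpl (Im (RtoC _)). lra. Qed.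

(** The involution at 1/2 is the one at 0 followed by the one at 1/3, up to a
    translation. *)
Lemma phi_law_half : involution_law phi (1 / 2) 12.
Proof.
  intros w Hw. pose proof (Im_pos_neq_0 _ Hw) as H0.
  set (tau := RtoC (- (1 / 2)) + w).
  assert (Ht : (0 < Im tau)%R) by now apply Im_add_real.
  pose proof (Im_pos_neq_0 _ Ht) as Ht0.
  assert (Ew : w = tau + 1 / 2) by (unfold tau; rewrite RtoC_opp, RtoC_half; ring).
  set (v := RtoC (- (1 / 3)) + - / (6 * tau)).
  assert (Hv : (0 < Im v)%R) by (apply Im_add_real, Im_opp_inv_pos, Im_mul_pos; [lra|easy]).
  assert (Ev : v = - w / (3 * tau)).
  { unfold v. rewrite RtoC_opp, RtoC_third, Ew. field. repeat split; nz. }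
  pose proof (phi_law_third v Hv) as L3. pose proof (phi_law_0 tau Ht) as L0.
  replace (RtoC (1 / 3) + v) with (RtoC 0 - / (6 * tau)) in L3 by (unfold v; rewrite RtoC_opp; ring).
  rewrite L0 in L3.
  replace (RtoC (1 / 3) - / (18 * v)) with (RtoC (1 / 2) - / (12 * w)) in L3.
  2:{ rewrite Ev, RtoC_third, RtoC_half.
      transitivity (1 / 3 + tau / (6 * w)); [|field; repeat split; nz].
      replace tau with (w - 1 / 2) by (rewrite Ew; ring). field. all: repeat split; nz. }
  rewrite L3. replace (RtoC (1 / 2) + w) with (tau + 1) by (rewrite Ew, RtoC_half; field; nz).
  rewrite phi_add_1 by easy. rewrite Ev, Cplus_0_l. field. easy.
Qed.

(** The involution at -1/3 is the one at 0 followed by the one at 1/2, up to a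
    translation. *)
Lemma phi_law_third_neg : involution_law phi (- (1 / 3)) 18.
Proof.
  intros w Hw. pose proof (Im_pos_neq_0 _ Hw) as H0.
  set (x := RtoC (- (1 / 3)) + w).
  assert (Hx : (0 < Im x)%R) by now apply Im_add_real.
  pose proof (Im_pos_neq_0 _ Hx) as Hx0.
  assert (Ex : w = x + 1 / 3) by (unfold x; rewrite RtoC_opp, RtoC_third; ring).
  set (tau := - / (6 * x)).
  assert (Ht : (0 < Im tau)%R) by (apply Im_opp_inv_pos, Im_mul_pos; [lra|easy]).
  set (v := RtoC (- (1 / 2)) + tau).
  assert (Hv : (0 < Im v)%R) by now apply Im_add_real.
  assert (Ev : v = - w / (2 * x)).
  { unfold v, tau. rewrite RtoC_opp, RtoC_half, Ex. field. repeat split; nz. }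
  pose proof (phi_law_half v Hv) as L2. pose proof (phi_law_0 x Hx) as L0.
  replace (RtoC (1 / 2) + v) with (RtoC 0 - / (6 * x)) in L2 by (unfold v, tau; rewrite RtoC_opp; ring).
  rewrite L0 in L2.
  assert (Hy : (0 < Im (RtoC (- (1 / 3)) - / (18 * w)))%R) by (apply Im_add_real, Im_opp_inv_pos, Im_mul_pos; [lra|easy]).
  rewrite <- (phi_add_1 _ Hy).
  replace (RtoC (- (1 / 3)) - / (18 * w) + 1) with (RtoC (1 / 2) - / (12 * v)).
  2:{ rewrite Ev, RtoC_opp, RtoC_third, RtoC_half.
      transitivity (1 / 2 + x / (6 * w)); [field; repeat split; nz|].
      replace x with (w - 1 / 3) by (rewrite Ex; ring). field. all: repeat split; nz. }
  rewrite L2, Ev, Cplus_0_l. field. easy.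
Qed.

Section PeriodAlgebra.
Context (a : nat -> C) (Ha : disc_coefs a).
Context (Hphi : forall tau, (0 < Im tau)%R -> eichler a 0 tau = phi tau).
Context (p0 p1 r0 r1 r0' r1' s0 s1 : C).
Context (Hp : period_relations a 0 6 p0 p1) (Hr : period_relations a (1 / 3) 18 r0 r1).
Context (Hr' : period_relations a (- (1 / 3)) 18 r0' r1') (Hs : period_relations a (1 / 2) 12 s0 s1).

Lemma eichler_nome_eq j z w : nome z = nome w -> eichler a j z = eichler a j w.
Proof. apply qsum_nome_eq. Qed.

(** The first cocycle relation: the composition of the involutions attached to
    0 and 1/3 is, up to a translation, the one attached to 1/2. *)
Lemma cocycle_third tau : (0 < Im tau)%R ->
  s0 + s1 * (tau + 1 / 2) - 12 * s0 * ((tau + 1 / 2) * (tau + 1 / 2))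
  = p0 + p1 * tau - 6 * p0 * (tau * tau)
    + (6 * r0 * (tau * tau) - r1 * (tau + 2 * (tau * tau)) - 3 * r0 * ((1 + 2 * tau) * (1 + 2 * tau))).
Proof.
  intros Ht. pose proof (Im_pos_neq_0 _ Ht) as H0.
  set (w := RtoC (1 / 2) + tau). assert (Hw : (0 < Im w)%R) by now apply Im_add_real.
  pose proof (Im_pos_neq_0 _ Hw) as Hw0.
  assert (Ew : tau = w - 1 / 2) by (unfold w; rewrite RtoC_half; ring).
  set (v := RtoC (- (1 / 3)) + - / (6 * tau)).
  assert (Hv : (0 < Im v)%R) by (apply Im_add_real, Im_opp_inv_pos, Im_mul_pos; [lra|easy]).
  assert (Ev : v = - w / (3 * tau)).
  { unfold v. rewrite RtoC_opp, RtoC_third. replace w with (tau + 1 / 2) by (rewrite Ew; ring).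
    field. repeat split; nz. }
  destruct (Hp tau Ht) as [E1 _]. destruct (Hr v Hv) as [E2 _]. destruct (Hs w Hw) as [E3 _].
  replace (involute (1 / 3) 18 v) with (involute (1 / 2) 12 w) in E2.
  2:{ unfold involute. rewrite Ev, RtoC_third, RtoC_half.
      transitivity (1 / 3 + tau / (6 * w)); [|field; repeat split; nz].
      rewrite Ew. field. all: repeat split; nz. }
  replace (RtoC (1 / 3) + v) with (involute 0 6 tau) in E2 by (unfold involute, v; rewrite RtoC_opp; ring).
  replace (eichler a 3 (RtoC (1 / 2) + w)) with (eichler a 3 (RtoC 0 + tau)) in E3.
  2:{ apply eichler_nome_eq. rewrite Cplus_0_l, <- nome_add_1. f_equal. rewrite Ew, RtoC_half. field. all: nz. }
  set (X := eichler a 3 (involute (1 / 2) 12 w)) in *.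
  set (Y := eichler a 3 (involute 0 6 tau)) in *.
  set (Z := eichler a 3 (RtoC 0 + tau)) in *.
  replace (tau + 1 / 2) with w by (rewrite Ew; ring).
  replace (1 + 2 * tau) with (2 * w) by (rewrite Ew; field; nz).
  rewrite Ev in E2.
  transitivity (12 * (w * w) * X - Z); [rewrite E3; ring|].
  transitivity (6 * (tau * tau) * (18 * (- w / (3 * tau) * (- w / (3 * tau))) * X - Y) + (6 * (tau * tau) * Y - Z)).
  { field. easy. }
  rewrite E1, E2.
  replace (tau + 2 * (tau * tau)) with (2 * w * tau) by (rewrite Ew; field; nz). field. easy.
Qed.

(** The second cocycle relation, for -1/3 in place of 1/3 and the opposite translation. *)
Lemma cocycle_third_neg tau : (0 < Im tau)%R ->
  s0 + s1 * (tau - 1 / 2) - 12 * s0 * ((tau - 1 / 2) * (tau - 1 / 2))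
  = p0 + p1 * tau - 6 * p0 * (tau * tau)
    + (6 * r0' * (tau * tau) + r1' * (2 * (tau * tau) - tau) - 3 * r0' * ((2 * tau - 1) * (2 * tau - 1))).
Proof.
  intros Ht. pose proof (Im_pos_neq_0 _ Ht) as H0.
  set (w := RtoC (- (1 / 2)) + tau). assert (Hw : (0 < Im w)%R) by now apply Im_add_real.
  pose proof (Im_pos_neq_0 _ Hw) as Hw0.
  assert (Ew : tau = w + 1 / 2) by (unfold w; rewrite RtoC_opp, RtoC_half; ring).
  set (v := RtoC (1 / 3) + - / (6 * tau)).
  assert (Hv : (0 < Im v)%R) by (apply Im_add_real, Im_opp_inv_pos, Im_mul_pos; [lra|easy]).
  assert (Ev : v = w / (3 * tau)).
  { unfold v. rewrite RtoC_third. replace w with (tau - 1 / 2) by (rewrite Ew; ring).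
    field. repeat split; nz. }
  destruct (Hp tau Ht) as [E1 _]. destruct (Hr' v Hv) as [E2 _]. destruct (Hs w Hw) as [E3 _].
  replace (eichler a 3 (involute (- (1 / 3)) 18 v)) with (eichler a 3 (involute (1 / 2) 12 w)) in E2.
  2:{ apply eichler_nome_eq. rewrite <- (nome_add_1 (involute (- (1 / 3)) 18 v)). f_equal.
      unfold involute. rewrite Ev, RtoC_opp, RtoC_third, RtoC_half.
      transitivity (2 / 3 - tau / (6 * w)); [|field; repeat split; nz].
      rewrite Ew. field. all: repeat split; nz. }
  replace (RtoC (- (1 / 3)) + v) with (involute 0 6 tau) in E2 by (unfold involute, v; rewrite RtoC_opp; ring).
  replace (RtoC (1 / 2) + w) with (RtoC 0 + tau) in E3 by (rewrite Ew, RtoC_half; ring).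
  set (X := eichler a 3 (involute (1 / 2) 12 w)) in *.
  set (Y := eichler a 3 (involute 0 6 tau)) in *.
  set (Z := eichler a 3 (RtoC 0 + tau)) in *.
  replace (tau - 1 / 2) with w by (rewrite Ew; ring).
  replace (2 * tau - 1) with (2 * w) by (rewrite Ew; field; nz).
  rewrite Ev in E2.
  transitivity (12 * (w * w) * X - Z); [rewrite E3; ring|].
  transitivity (6 * (tau * tau) * (18 * (w / (3 * tau) * (w / (3 * tau))) * X - Y) + (6 * (tau * tau) * Y - Z)).
  { field. easy. }
  rewrite E1, E2.
  replace (2 * (tau * tau) - tau) with (2 * w * tau) by (rewrite Ew; field; nz). field. easy.
Qed.

(** The Hecke eigenvalue at 2, read at the cusps 0 and 1/2. It is the only
    relation that sees the constant term of the Eichler integral. *)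
Lemma hecke_period_relation : 2 * s0 = - (3) * p0.
Proof.
  assert (H0 : forall tau, (0 < Im tau)%R ->
    eichler a 0 tau + eichler a 0 (tau + RtoC (1 / 2)) = - (4) * eichler a 0 (2 * tau)).
  { intros tau Ht. rewrite !Hphi; [now apply phi_U2|now apply (Im_mul_pos 2); [lra|]| |easy].
    rewrite im_plus. simpl (Im (RtoC _)). lra. }
  pose proof (eichler_U2 a Ha H0) as U.
  destruct (period_boundary_values a Ha 0 6 p0 p1 ltac:(lra) Hp) as [Lp _].
  destruct (period_boundary_values a Ha (1 / 2) 12 s0 s1 ltac:(lra) Hs) as [Ls _].
  assert (L2 := tendsto_at_right_0_scale _ _ 2 ltac:(lra) Lp).
  pose proof (tendsto_plus _ _ _ _ (tendsto_plus _ _ _ _ Lp Ls) (tendsto_scal (/ 2) _ _ L2)) as L.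
  assert (Z : - p0 + - s0 + / 2 * - p0 = 0).
  { refine (tendsto_unique (F := at_right 0) _ _ _ L _).
    refine (tendsto_ext_loc _ _ _ _ (tendsto_const 0)).
    generalize at_right_0_pos. apply filter_imp. intros t Ht. cbv beta.
    assert (Hi : (0 < Im (Ci * RtoC t))%R) by now rewrite Im_Ci_RtoC.
    symmetry. etransitivity; [|exact (U (Ci * RtoC t) Hi)].
    rewrite !Cplus_0_l. replace (Ci * RtoC (2 * t)) with (2 * (Ci * RtoC t)); [easy|].
    rewrite RtoC_mult. ring. }
  transitivity (- (2) * (- p0 + - s0 + / 2 * - p0) - 3 * p0); [field; nz|]. rewrite Z. ring.
Qed.

(** The coefficients of the three relations, combined linearly. *)
Lemma period_solution : r0 - r0' = 2 / 3 * p1 /\ r1 - r1' = - (20) * p0.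
Proof.
  destruct (quadratic_coefs
    (s0 + s1 / 2 - 3 * s0 - (p0 - 3 * r0))
    (s1 - 12 * s0 - (p1 - r1 - 12 * r0))
    (- (12) * s0 - (- (6) * p0 - 6 * r0 - 2 * r1))) as [A0 [A1 A2]].
  { intros w Hw. pose proof (cocycle_third w Hw) as E. apply Ceq_minus in E.
    rewrite <- E. field. all: nz. }
  destruct (quadratic_coefs
    (s0 - s1 / 2 - 3 * s0 - (p0 - 3 * r0'))
    (s1 + 12 * s0 - (p1 - r1' + 12 * r0'))
    (- (12) * s0 - (- (6) * p0 - 6 * r0' + 2 * r1'))) as [B0 [B1 B2]].
  { intros w Hw. pose proof (cocycle_third_neg w Hw) as E. apply Ceq_minus in E.
    rewrite <- E. field. all: nz. }
  pose proof hecke_period_relation as H. apply Ceq_minus in H.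
  split; apply Ceq_minus.
  - transitivity (/ 3 * (
      ((s1 - 12 * s0 - (p1 - r1 - 12 * r0)) + (s1 + 12 * s0 - (p1 - r1' + 12 * r0')))
      - 2 * ((s0 + s1 / 2 - 3 * s0 - (p0 - 3 * r0)) - (s0 - s1 / 2 - 3 * s0 - (p0 - 3 * r0')))
      - / 2 * ((- (12) * s0 - (- (6) * p0 - 6 * r0 - 2 * r1)) - (- (12) * s0 - (- (6) * p0 - 6 * r0' + 2 * r1'))))).
    + field. all: nz.
    + rewrite A0, A1, A2, B0, B1, B2. ring.
  - transitivity (
      / 2 * ((- (12) * s0 - (- (6) * p0 - 6 * r0 - 2 * r1)) + (- (12) * s0 - (- (6) * p0 - 6 * r0' + 2 * r1')))
      - ((s0 + s1 / 2 - 3 * s0 - (p0 - 3 * r0)) + (s0 - s1 / 2 - 3 * s0 - (p0 - 3 * r0')))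
      - (- (4)) * (2 * s0 - - (3) * p0)).
    + field. all: nz.
    + rewrite A0, A2, B0, B2, H. ring.
Qed.

End PeriodAlgebra.

(** * The twist *)

Lemma sin_cos_third : Cexp (Ci * RtoC (2 * (PI / 3))) = RtoC (- (1 / 2)) + Ci * RtoC (sqrt 3 / 2).
Proof.
  unfold Cexp, Ci, RtoC, Cmult, Cplus; simpl.
  match goal with |- context [exp ?x] => replace x with 0%R by ring end.
  match goal with |- context [cos ?x] => replace x with (2 * (PI / 3))%R by ring end.
  rewrite exp_0, cos_2PI3, sin_2PI3. f_equal; field.
Qed.

Lemma nome_third : nome (RtoC (1 / 3)) = RtoC (- (1 / 2)) + Ci * RtoC (sqrt 3 / 2).
Proof.
  rewrite <- sin_cos_third. unfold nome. f_equal.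
  replace (RtoC (2 * PI) * Ci * RtoC (1 / 3)) with (Ci * (RtoC (2 * PI) * RtoC (1 / 3))) by ring.
  rewrite <- RtoC_mult. do 2 f_equal. field.
Qed.

Lemma sqrt3_sqr : RtoC (sqrt 3) * RtoC (sqrt 3) = 3.
Proof. rewrite <- RtoC_mult, sqrt_sqrt by lra. easy. Qed.

Lemma sqrt3_neq_0 : RtoC (sqrt 3) <> 0.
Proof. intros E. apply RtoC_inj in E. pose proof (sqrt_lt_R0 3 ltac:(lra)). lra. Qed.

(** The Gauss sum of the character, with the additive characters of Z/3. *)
Lemma chi_m3_gauss (n : nat) :
  Ci * RtoC (sqrt 3) * chi_m3 n = nome (RtoC (1 / 3)) ^ n - nome (RtoC (- (1 / 3))) ^ n.
Proof.
  set (z := nome (RtoC (1 / 3))).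
  assert (Ez : nome (RtoC (- (1 / 3))) = / z) by (rewrite RtoC_opp; apply nome_opp).
  assert (Hz : z <> 0) by apply nome_neq_0.
  assert (H3 : z ^ 3 = 1).
  { unfold z. rewrite <- nome_mul_nat, <- RtoC_mult.
    replace (INR 3 * (1 / 3))%R with 1%R by (simpl; field). apply nome_1. }
  assert (Hd : z - / z = Ci * RtoC (sqrt 3)).
  { assert (Hc : / z = RtoC (- (1 / 2)) - Ci * RtoC (sqrt 3 / 2)).
    { assert (M : z * (RtoC (- (1 / 2)) - Ci * RtoC (sqrt 3 / 2)) = 1).
      { unfold z. rewrite nome_third.
        transitivity (RtoC (- (1 / 2)) * RtoC (- (1 / 2)) - (Ci * Ci) * (RtoC (sqrt 3 / 2) * RtoC (sqrt 3 / 2))); [ring|].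
        rewrite Ci_sqr, <- !RtoC_mult.
        replace (sqrt 3 / 2 * (sqrt 3 / 2))%R with (sqrt 3 * sqrt 3 / 4)%R by field.
        rewrite sqrt_sqrt, <- RtoC_opp, <- RtoC_mult, <- RtoC_minus by lra. f_equal. lra. }
      transitivity (/ z * (z * (RtoC (- (1 / 2)) - Ci * RtoC (sqrt 3 / 2)))).
      - rewrite M. ring.
      - field. easy. }
    rewrite Hc. unfold z. rewrite nome_third.
    replace (RtoC (sqrt 3)) with (RtoC (sqrt 3 / 2) + RtoC (sqrt 3 / 2)) by (rewrite <- RtoC_plus; f_equal; field).
    ring. }
  rewrite Ez.
  assert (Hn : n = (3 * (n / 3) + n mod 3)%nat) by (apply Nat.div_mod; lia).
  pose proof (Nat.mod_upper_bound n 3 ltac:(lia)) as Hb.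
  assert (P : forall k m, z ^ (3 * k + m) = z ^ m).
  { intros k m. rewrite Cpow_add_r, Cpow_mult_r, H3, Cpow_1_l. ring. }
  assert (P' : forall k m, (/ z) ^ (3 * k + m) = (/ z) ^ m).
  { intros k m. rewrite !Cpow_inv by easy. now rewrite P. }
  unfold chi_m3. rewrite Hn at 2 3. rewrite P, P'.
  destruct (n mod 3)%nat as [|[|[|m]]]; [| | |lia].
  - simpl. ring.
  - simpl. rewrite !Cmult_1_r. symmetry. exact Hd.
  - assert (Z2 : z ^ 2 = / z).
    { transitivity (z ^ 3 * / z); [simpl; field; easy|]. rewrite H3. ring. }
    rewrite Cpow_inv by easy. rewrite Z2.
    replace (/ / z) with z by (field; easy).
    transitivity (- (z - / z)); [rewrite Hd; ring|ring].
Qed.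

Lemma Cmod_chi_m3 n : (Cmod (chi_m3 n) <= 1)%R.
Proof.
  unfold chi_m3. destruct (Nat.modulo n 3) as [|[|[|m]]];
    rewrite ?Cmod_0, ?Cmod_opp, ?Cmod_1; lra.
Qed.

Lemma twist_disc_coefs a : disc_coefs a -> disc_coefs (twist chi_m3 a).
Proof.
  apply disc_summable_le. intros k. unfold twist. rewrite Cmod_mult.
  pose proof (Cmod_chi_m3 (S k)). pose proof (Cmod_ge_0 (a (S k))). nra.
Qed.

Lemma eichler_twist a j tau : disc_coefs a -> (0 < Im tau)%R ->
  eichler (twist chi_m3 a) j tau =
    / (Ci * RtoC (sqrt 3)) * (eichler a j (RtoC (1 / 3) + tau) - eichler a j (RtoC (- (1 / 3)) + tau)).
Proof.
  intros Ha Ht. apply Csum_unique.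
  pose proof (has_sum_scal (/ (Ci * RtoC (sqrt 3))) _ _ (has_sum_minus _ _ _ _
    (qsum_correct _ _ _ (eichler_disc_summable a j Ha) (Im_add_real (1 / 3) tau Ht))
    (qsum_correct _ _ _ (eichler_disc_summable a j Ha) (Im_add_real (- (1 / 3)) tau Ht)))) as P.
  revert P. apply has_sum_ext. intros k. cbv beta.
  pose proof (chi_m3_gauss (S k)) as G. unfold twist.
  rewrite !nome_plus, !Cpow_mult_l.
  assert (N := Cpow_nz _ j (RtoC_INR_S_neq_0 k)). pose proof sqrt3_neq_0.
  transitivity (/ (Ci * RtoC (sqrt 3)) * (nome (RtoC (1 / 3)) ^ S k - nome (RtoC (- (1 / 3))) ^ S k)
    * (a (S k) / RtoC (INR (S k)) ^ j) * nome tau ^ S k); [ring|].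
  rewrite <- G. field. repeat split; nz.
Qed.

Lemma involution_law_ext (f g : C -> C) (r N : R) : (0 < N)%R ->
  (forall tau, (0 < Im tau)%R -> f tau = g tau) -> involution_law g r N -> involution_law f r N.
Proof.
  intros HN E H w Hw. rewrite !E; [now apply H|now apply Im_add_real|].
  now apply (Im_involute r N).
Qed.

Theorem theorem5p1 (a : nat -> C) (Ha : is_q_expansion phi a) :
  L_value (twist chi_m3 a) 3 =
    RtoC (4 * PI / (3 * sqrt 3)) * L_value a 2 /\
  L_value a 3 =
    RtoC (PI * sqrt 3 / 10) * L_value (twist chi_m3 a) 2.
Proof.
  destruct (q_expansion_coefs phi a Ha) as [Hd Hphi].
  assert (Hex : forall r N, (1 < N)%R -> involution_law phi r N -> exists p0 p1, period_relations a r N p0 p1).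
  { intros r N HN H. apply period_relations_exist; [easy|easy|].
    apply (involution_law_ext _ phi); [lra|exact Hphi|exact H]. }
  destruct (Hex 0%R 6%R ltac:(lra) phi_law_0) as [p0 [p1 Hp]].
  destruct (Hex (1 / 3)%R 18%R ltac:(lra) phi_law_third) as [r0 [r1 Hr]].
  destruct (Hex (- (1 / 3))%R 18%R ltac:(lra) phi_law_third_neg) as [r0' [r1' Hr']].
  destruct (Hex (1 / 2)%R 12%R ltac:(lra) phi_law_half) as [s0 [s1 Hs]].
  destruct (period_solution a Hd Hphi p0 p1 r0 r1 r0' r1' s0 s1 Hp Hr Hr' Hs) as [E0 E1].
  destruct (period_boundary_values a Hd 0 6 p0 p1 ltac:(lra) Hp) as [P3 [P2 P1]].
  destruct (period_boundary_values a Hd (1 / 3) 18 r0 r1 ltac:(lra) Hr) as [R3 [R2 R1]].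
  destruct (period_boundary_values a Hd (- (1 / 3)) 18 r0' r1' ltac:(lra) Hr') as [R3' [R2' R1']].
  assert (Hp0 : forall j l, tendsto (at_right 0) (fun t => eichler a j (RtoC 0 + Ci * RtoC t)) l ->
    tendsto (at_right 0) (fun t => eichler a j (Ci * RtoC t)) l).
  { intros j l. apply tendsto_ext. intros t. now rewrite Cplus_0_l. }
  assert (P1' : tendsto (at_right 0) (fun t => RtoC t * eichler a 1 (Ci * RtoC t)) 0).
  { revert P1. apply tendsto_ext. intros t. now rewrite Cplus_0_l. }
  assert (T0 : forall j l, tendsto (at_right 0) (fun t => eichler a j (Ci * RtoC t)) l ->
    tendsto (at_right 0) (fun t => RtoC t * eichler a j (Ci * RtoC t)) 0).
  { intros j l H. replace (RtoC 0) with (0 * l) by ring. apply tendsto_mult; [apply tendsto_at_right_0_id|easy]. }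
  set (b := twist chi_m3 a). assert (Hb : disc_coefs b) by now apply twist_disc_coefs.
  set (g := / (Ci * RtoC (sqrt 3))).
  assert (Tw : forall j l l', tendsto (at_right 0) (fun t => eichler a j (RtoC (1 / 3) + Ci * RtoC t)) l ->
    tendsto (at_right 0) (fun t => eichler a j (RtoC (- (1 / 3)) + Ci * RtoC t)) l' ->
    tendsto (at_right 0) (fun t => eichler b j (Ci * RtoC t)) (g * (l - l'))).
  { intros j l l' H H'. generalize (tendsto_scal g _ _ (tendsto_minus _ _ _ _ H H')). apply tendsto_ext_loc.
    generalize at_right_0_pos. apply filter_imp. intros t Ht. symmetry. apply eichler_twist; [easy|].
    now rewrite Im_Ci_RtoC. }
  assert (B1 : tendsto (at_right 0) (fun t => RtoC t * eichler b 1 (Ci * RtoC t)) 0).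
  { replace (RtoC 0) with (g * (0 - 0)) by ring.
    generalize (tendsto_scal g _ _ (tendsto_minus _ _ _ _ R1 R1')). apply tendsto_ext_loc.
    generalize at_right_0_pos. apply filter_imp. intros t Ht.
    assert (E : eichler b 1 (Ci * RtoC t) = _)
      by (apply (eichler_twist a 1 _ Hd); now rewrite Im_Ci_RtoC).
    rewrite E. unfold g. ring. }
  assert (T0b : forall j l, tendsto (at_right 0) (fun t => eichler b j (Ci * RtoC t)) l ->
    tendsto (at_right 0) (fun t => RtoC t * eichler b j (Ci * RtoC t)) 0).
  { intros j l H. replace (RtoC 0) with (0 * l) by ring. apply tendsto_mult; [apply tendsto_at_right_0_id|easy]. }
  pose proof (Tw _ _ _ R3 R3') as B3. pose proof (Tw _ _ _ R2 R2') as B2.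
  rewrite (L_value_3_limit b Hb _ B3 (T0b _ _ B2) B1).
  rewrite (L_value_2_limit b Hb _ B2 B1).
  rewrite (L_value_3_limit a Hd _ (Hp0 _ _ P3) (T0 _ _ (Hp0 _ _ P2)) P1').
  rewrite (L_value_2_limit a Hd _ (Hp0 _ _ P2) P1').
  pose proof sqrt3_neq_0 as N3. pose proof sqrt3_sqr as S3.
  assert (Npi : RtoC PI <> 0) by (intros E; apply RtoC_inj in E; pose proof PI_RGT_0; lra).
  assert (N3' : sqrt 3 <> 0%R) by (intros E; apply N3; now rewrite E).
  rewrite !RtoC_mult. unfold g. split.
  - rewrite RtoC_div, !RtoC_mult by (apply Rmult_integral_contrapositive_currified; lra || easy).
    transitivity (- / (Ci * RtoC (sqrt 3)) * (r0 - r0')); [ring|]. rewrite E0.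
    field. repeat split; nz.
  - rewrite RtoC_div, !RtoC_mult by lra.
    transitivity (RtoC (sqrt 3) / 10 * (- / (2 * (Ci * Ci) * RtoC (sqrt 3)) * (r1 - r1'))).
    + rewrite E1, Ci_sqr. field. all: nz.
    + field. repeat split; nz.
Qed.
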